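(* Let $f:L^2(0,T)\to\mathbb{R}$ be Fréchet differentiable (not necessarily convex), and consider the problem $$\min_{u\in\mathrm{BV}(0,T)}J(u),\qquad J(u)=f(u)+\mathrm{TGV}(u).\tag{P}$$ For $\bar u\in\mathrm{BV}(0,T)$, let $\bar w\in\mathrm{BV}(0,T)$ be such that $\mathrm{TGV}(\bar u)=\alpha\|D\bar u-\bar w\|_M+\beta\|D\bar w\|_M$ and set $$\bar p(x)=\int_0^x\nabla f(\bar u)(s)\,ds,\qquad \bar P(x)=-\int_0^x\bar p(s)\,ds .$$ If $\bar u$ is a minimizer of (P), then $$\text{(i)}\quad \bar p\in H^1_0(0,T),\quad \bar P\in H^2(0,T)\cap H^1_0(0,T),\quad \|\bar p\|_C\le\alpha,\quad\|\bar P\|_C\le\beta,$$ and $$\text{(ii)}\quad \operatorname{supp}(D\bar u-\bar w)_\pm\subset\{x\in(0,T)\,|\,\bar p(x)=\pm\alpha\},\qquad \operatorname{supp}(D\bar w)_\pm\subset\{x\in(0,T)\,|\,\bar P(x)=\pm\beta\}.$$ Conversely, if $f$ is convex and (i) and (ii) are satisfied, then $\bar u$ is a solution of (P).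
   Context: $T>0$, $\alpha,\beta>0$ are fixed. $C_0(0,T)$ is the space of continuous functions on $(0,T)$ vanishing at the boundary, with uniform norm $\|\cdot\|_C$; $M(0,T)=C_0(0,T)^*$ is the space of Radon measures with dual norm $\|\cdot\|_M$. $\mathrm{BV}(0,T)$ is the space of $u\in L^1(0,T)$ with distributional derivative $Du\in M(0,T)$. For $u\in\mathrm{BV}(0,T)$, $$\mathrm{TGV}(u)=\sup\left\{\int_0^T u\,v''\;\middle|\;v\in C_c^\infty(0,T),\ \|v\|_C\le\alpha,\ \|v'\|_C\le\beta\right\}=\inf_{w\in\mathrm{BV}(0,T)}\alpha\|Du-w\|_M+\beta\|Dw\|_M,$$ where $w$ is identified with the measure $w\,dx$. $\nabla f(u)\in L^2(0,T)$ is the Riesz representative of the Fréchet derivative of $f$ at $u$. For a measure $\mu$, $\mu=\mu_+-\mu_-$ is its Jordan decomposition.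
   Formalization: TGV(u) is taken to be the infimum of α‖Du−w‖+β‖Dw‖; the supremum printed as equal to it has α and β exchanged (for a unit jump with α>β it gives at most β, while the infimum is α) and is not used. *)

(* Defs.v *)
From HB Require Import structures.
From mathcomp Require Import all_boot all_order all_algebra.
From mathcomp Require Import all_classical all_reals all_analysis.
From mathcomp Require Import measurable_realfun ess_sup_inf.

Set Implicit Arguments.
Unset Strict Implicit.
Unset Printing Implicit Defensive.

Import Order.TTheory GRing.Theory Num.Theory numFieldNormedType.Exports.

Local Open Scope ring_scope.
Local Open Scope classical_set_scope.
Local Open Scope quotient_scope.

(* The quotient type [LspaceType mu p1] carries no algebraic structure in the  *)
(* library; it is equipped here with that of a normed module, which gives      *)
(* access to [differentiable] and ['d f u] for functionals on L^2.             *)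
Section LspaceNormed.
Context d (T : measurableType d) (R : realType).
Variables (mu : {measure set T -> \bar R}) (p : \bar R) (p1 : (1 <= p)%E).
Local Notation L := (LspaceType mu p1).
Local Notation ty := (LfunType mu p1).
Local Notation Q := (@aeEqMfun _ _ R T (measurableTypeR R) mu).

HB.instance Definition _ := gen_eqMixin L.
HB.instance Definition _ := gen_choiceMixin L.

Lemma Lspace_Lfun (f : L) : (f : T -> R) \in Lfun mu p.
Proof.
rewrite inE; apply/andP; split.
  by rewrite inE/=; exact: (@measurable_funPT _ _ _ _ (repr (f : Q))).
by rewrite inE/=; exact: Lebesgue_finite.
Qed.

Lemma LspaceP (f g : L) : f = g <-> (f : T -> R) = g %[ae mu].
Proof.
split=> [->|]; first exact: ae_eq_refl.
case: f => f [[pf]]; case: g => g [[pg]] /= fg.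
have efg : f = g by rewrite -[f]reprK -[g]reprK; apply/eqmodP/asboolP.
by subst g; rewrite (Prop_irrelevance pf pg).
Qed.

Lemma ae_eq_Lnorm (f g : T -> R) : measurable_fun [set: T] f ->
  measurable_fun [set: T] g -> f = g %[ae mu] ->
  ('N[mu]_p[EFin \o f] = 'N[mu]_p[EFin \o g])%E.
Proof.
move=> mf mg fg; rewrite unlock /Lnorm; case: p p1 => [r r1|_|//].
  have mp (h : T -> R) : measurable_fun [set: T] h ->
      @measurable_fun _ _ T (\bar R) setT (fun x => `|(EFin \o h) x| `^ r)%E.
    move=> mh; apply: (@measurableT_comp _ _ _ _ _ _ (fun x => x `^ r)%E) => //=.
      exact: measurable_poweR.
    by do 2 apply: measurableT_comp => //.
  congr (_ `^ _)%E; apply: ae_eq_integral => //; [exact: mp..|].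
  by apply: filterS fg => x /= fgx /fgx ->.
case: ifPn => // _; apply: eq_ess_sup.
by apply: filterS fg => x /= /(_ I) ->.
Qed.

Section of_Lfun.
Variable f : ty.

Let g : T -> measurableTypeR R := f.
Let mg : measurable_fun [set: T] g.
Proof. exact: (@measurable_funPT _ _ _ _ f). Qed.
HB.instance Definition _ :=
  @isMeasurableFun.Build _ _ T (measurableTypeR R) g mg.
Definition Lclass_subdef : Q := \pi_Q (g : {mfun T >-> measurableTypeR R}).

Lemma Lclass_subdefE : (Lclass_subdef : T -> R) = f %[ae mu].
Proof.
by have /eqmodP/asboolP := reprK Lclass_subdef.
Qed.

Lemma Lclass_finite : finite_norm mu p Lclass_subdef.
Proof.
rewrite /finite_norm (@ae_eq_Lnorm _ f) //.
- exact: Lfunction_finite.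
- exact: (@measurable_funPT _ _ _ _ (repr Lclass_subdef)).
- exact: Lclass_subdefE.
Qed.

HB.instance Definition _ :=
  @isFinLebesgue.Build _ T R mu p p1 Lclass_subdef Lclass_finite.

Definition Lclass : L := Lclass_subdef.

Lemma LclassE : (Lclass : T -> R) = f %[ae mu].
Proof. exact: Lclass_subdefE. Qed.

End of_Lfun.

Definition Lrepr (f : L) : ty := Lfun_Sub p1 (Lspace_Lfun f).

Definition Lspace_zero : L := Lclass 0.
Definition Lspace_opp (f : L) : L := Lclass (- Lrepr f).
Definition Lspace_add (f g : L) : L := Lclass (Lrepr f + Lrepr g).
Definition Lspace_scale (a : R) (f : L) : L := Lclass (a *: Lrepr f).
Definition Lspace_norm (f : L) : R := fine ('N[mu]_p[EFin \o f])%E.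

Lemma Lspace_zeroE : \forall x \ae mu, Lspace_zero x = 0.
Proof. by apply: filterS (LclassE 0) => x /(_ I). Qed.

Lemma Lspace_oppE f : \forall x \ae mu, Lspace_opp f x = - f x.
Proof. by apply: filterS (LclassE (- Lrepr f)) => x /(_ I). Qed.

Lemma Lspace_addE f g : \forall x \ae mu, Lspace_add f g x = f x + g x.
Proof. by apply: filterS (LclassE (Lrepr f + Lrepr g)) => x /(_ I). Qed.

Lemma Lspace_scaleE a f : \forall x \ae mu, Lspace_scale a f x = a * f x.
Proof. by apply: filterS (LclassE (a *: Lrepr f)) => x /(_ I). Qed.

Lemma Lspace_eq (f g : L) : (\forall x \ae mu, f x = g x) -> f = g.
Proof. by move=> fg; apply/LspaceP; apply: filterS fg. Qed.

Lemma Lspace_addA : associative Lspace_add.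
Proof.
move=> f g h; apply: Lspace_eq.
near=> x.
have -> : Lspace_add f (Lspace_add g h) x = f x + Lspace_add g h x.
  by near: x; exact: Lspace_addE.
have -> : Lspace_add g h x = g x + h x by near: x; exact: Lspace_addE.
have -> : Lspace_add (Lspace_add f g) h x = Lspace_add f g x + h x.
  by near: x; exact: Lspace_addE.
have -> : Lspace_add f g x = f x + g x by near: x; exact: Lspace_addE.
by rewrite addrA.
Unshelve. all: by end_near. Qed.

Lemma Lspace_addC : commutative Lspace_add.
Proof.
move=> f g; apply: Lspace_eq.
by apply: filterS2 (Lspace_addE f g) (Lspace_addE g f) => x -> ->; rewrite addrC.
Qed.

Lemma Lspace_add0 : left_id Lspace_zero Lspace_add.
Proof.
move=> f; apply: Lspace_eq.
apply: filterS2 (Lspace_addE Lspace_zero f) Lspace_zeroE => x -> ->.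
by rewrite add0r.
Qed.

Lemma Lspace_addN : left_inverse Lspace_zero Lspace_opp Lspace_add.
Proof.
move=> f; apply: Lspace_eq.
apply: filterS3 (Lspace_addE (Lspace_opp f) f) (Lspace_oppE f) Lspace_zeroE.
by move=> x -> -> ->; rewrite addNr.
Qed.

HB.instance Definition _ := GRing.isZmodule.Build L
  Lspace_addA Lspace_addC Lspace_add0 Lspace_addN.

Lemma Lspace_scaleA a b f :
  Lspace_scale a (Lspace_scale b f) = Lspace_scale (a * b) f.
Proof.
apply: Lspace_eq.
apply: filterS3 (Lspace_scaleE a (Lspace_scale b f)) (Lspace_scaleE b f)
  (Lspace_scaleE (a * b) f).
by move=> x -> -> ->; rewrite mulrA.
Qed.

Lemma Lspace_scale1 : left_id 1 Lspace_scale.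
Proof.
move=> f; apply: Lspace_eq.
by apply: filterS (Lspace_scaleE 1 f) => x ->; rewrite mul1r.
Qed.

Lemma Lspace_scaleDr : right_distributive Lspace_scale +%R.
Proof.
move=> a f g; apply: Lspace_eq; near=> x.
have -> : Lspace_scale a (f + g) x = a * (f + g) x.
  by near: x; exact: Lspace_scaleE.
have -> : (f + g) x = f x + g x by near: x; exact: Lspace_addE.
have -> : (Lspace_scale a f + Lspace_scale a g) x =
          Lspace_scale a f x + Lspace_scale a g x.
  by near: x; exact: Lspace_addE.
have -> : Lspace_scale a f x = a * f x by near: x; exact: Lspace_scaleE.
have -> : Lspace_scale a g x = a * g x by near: x; exact: Lspace_scaleE.
by rewrite mulrDr.
Unshelve. all: by end_near. Qed.

Lemma Lspace_scaleDl f : {morph Lspace_scale^~ f : a b / a + b}.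
Proof.
move=> a b; apply: Lspace_eq; near=> x.
have -> : Lspace_scale (a + b) f x = (a + b) * f x.
  by near: x; exact: Lspace_scaleE.
have -> : (Lspace_scale a f + Lspace_scale b f) x =
          Lspace_scale a f x + Lspace_scale b f x.
  by near: x; exact: Lspace_addE.
have -> : Lspace_scale a f x = a * f x by near: x; exact: Lspace_scaleE.
have -> : Lspace_scale b f x = b * f x by near: x; exact: Lspace_scaleE.
by rewrite mulrDl.
Unshelve. all: by end_near. Qed.

HB.instance Definition _ := GRing.Zmodule_isLmodule.Build R L
  Lspace_scaleA Lspace_scale1 Lspace_scaleDr Lspace_scaleDl.

Let Lspace_measurable (f : L) : measurable_fun [set: T] (f : T -> R).
Proof. by have := Lspace_Lfun f; rewrite inE => /andP[]; rewrite inE. Qed.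

Lemma Lspace_normE (f : L) (g : ty) : (f : T -> R) = g %[ae mu] ->
  Lspace_norm f = fine ('N[mu]_p[EFin \o g])%E.
Proof. by move=> fg; congr fine; apply: ae_eq_Lnorm. Qed.

Lemma Lspace_ler_normD (f g : L) :
  Lspace_norm (f + g) <= Lspace_norm f + Lspace_norm g.
Proof.
rewrite (Lspace_normE (LclassE (Lrepr f + Lrepr g))).
exact: (ler_LnormD (Lrepr f) (Lrepr g)).
Qed.

Lemma Lspace_normZ a (f : L) : Lspace_norm (a *: f) = `|a| * Lspace_norm f.
Proof.
rewrite (Lspace_normE (LclassE (a *: Lrepr f))).
apply: EFin_inj; rewrite EFinM /Lspace_norm (finite_norm_fine (Lrepr f)).
by rewrite finite_norm_fine -LnormZ.
Qed.

Lemma Lspace_normr0_eq0 (f : L) : Lspace_norm f = 0 -> f = 0.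
Proof.
move=> /(fine_Lnormr_eq0 (f := Lrepr f)) f0; apply: Lspace_eq.
by apply: filterS2 f0 Lspace_zeroE => x /(_ I) /= -> ->.
Qed.

HB.instance Definition _ := Lmodule_isNormed.Build R L
  Lspace_ler_normD Lspace_normZ Lspace_normr0_eq0.

Lemma Lspace_normrE (f : L) : `|f| = fine ('N[mu]_p[EFin \o f])%E.
Proof. by []. Qed.

End LspaceNormed.

Lemma Lspace1_integrable d (T : measurableType d) (R : realType)
    (mu : {measure set T -> \bar R}) (w : LspaceType1 mu) :
  mu.-integrable [set: T] (EFin \o w).
Proof. by apply/Lfun1_integrable; exact: Lspace_Lfun. Qed.

Section jordan_parts.
Context d (X : measurableType d) (R : realType).
Implicit Type nu : {charge set X -> \bar R}.

Lemma hahn_exists nu :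
  exists PN : set X * set X, hahn_decomposition nu PN.1 PN.2.
Proof. by have [P [N nuPN]] := Hahn_decomposition nu; exists (P, N). Qed.

(* On measurable sets the Jordan parts do not depend on the chosen Hahn        *)
(* decomposition ([Hahn_decomposition_uniq]).                                  *)
Definition jpos nu : {measure set X -> \bar R} :=
  jordan_pos (projT2 (cid (hahn_exists nu))).

Definition jneg nu : {measure set X -> \bar R} :=
  jordan_neg (projT2 (cid (hahn_exists nu))).

Definition charge_Rintegral nu (D : set X) (phi : X -> R) : R :=
  \int[jpos nu]_(x in D) phi x - \int[jneg nu]_(x in D) phi x.

End jordan_parts.

Section interval_0T.
Context {R : realType}.
Variable T : R.
Implicit Types (u v phi : R -> R) (nu : {charge set (measurableTypeR R) -> \bar R}).

Definition I0T : set R := `]0, T[.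

Definition leb0T : {measure set (measurableTypeR R) -> \bar R} :=
  mrestr lebesgue_measure (measurable_itv (`]0, T[)%R).

Definition L1 := LspaceType1 leb0T.
Definition L2 := LspaceType2 leb0T.

Definition Ccinfty phi :=
  [/\ forall n x, derivable (phi^`(n)) x 1,
      compact (closure [set x | phi x != 0])
    & closure [set x | phi x != 0] `<=` I0T].

Definition C0 phi :=
  [/\ {in I0T, continuous phi},
      phi x @[x --> 0^'+] --> 0
    & phi x @[x --> T^'-] --> 0].

Definition normC phi : \bar R := ereal_sup [set `|phi x|%:E | x in I0T].

(* M(0,T) is represented by the finite signed Borel measures on R that are     *)
(* concentrated on ]0, T[; [normM] is the norm dual to [normC] on C_0(0,T).    *)
Definition M0T nu :=
  forall A, measurable A -> nu A = nu (A `&` I0T).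

Definition normM nu : \bar R :=
  ereal_sup [set (charge_Rintegral nu I0T phi)%:E
            | phi in [set phi | C0 phi /\ (normC phi <= 1)%E]].

Definition is_distr_deriv u nu :=
  forall phi, Ccinfty phi ->
    \int[leb0T]_x (u x * derive1 phi x) = - charge_Rintegral nu I0T phi.

Definition BV u :=
  u \in Lfun leb0T 1 /\ exists nu, M0T nu /\ is_distr_deriv u nu.

(* The distributional derivative: unique on measurable sets when [BV u], and   *)
(* the zero charge otherwise.                                                  *)
Definition Dmeas u : {charge set (measurableTypeR R) -> \bar R} :=
  match pselect (exists nu, M0T nu /\ is_distr_deriv u nu) with
  | left h => projT1 (cid h)
  | right _ => czero
  end.

(* The measure w dx. *)
Definition dens (w : L1) : {charge set (measurableTypeR R) -> \bar R} :=
  induced_charge (Lspace1_integrable w).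

Definition Dmeas_sub u (w : L1) : {charge set (measurableTypeR R) -> \bar R} :=
  cadd (Dmeas u) (copp (dens w)).

Definition TGV_obj (alpha beta : R) u (w : L1) : \bar R :=
  (alpha%:E * normM (Dmeas_sub u w) + beta%:E * normM (Dmeas w))%E.

(* In dual form: the supremum of the integrals of u v'' over the test          *)
(* functions v with normC v <= beta and normC v' <= alpha.                     *)
Definition TGV (alpha beta : R) u : \bar R :=
  ereal_inf [set TGV_obj alpha beta u w | w in [set w : L1 | BV w]].

Definition is_gradient (f : L2 -> R) (u g : L2) :=
  forall h : L2, 'd f u h = \int[leb0T]_x (g x * h x).

Definition J (f : L2 -> R) (alpha beta : R) (u : L2) : \bar R :=
  ((f u)%:E + TGV alpha beta u)%E.

(* BV(0,T) is contained in L^2(0,T), so the competitors are the elements of    *)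
(* L^2(0,T) of bounded variation.                                              *)
Definition is_minimizer (f : L2 -> R) (alpha beta : R) (u : L2) :=
  BV u /\ forall v : L2, BV v -> (J f alpha beta u <= J f alpha beta v)%E.

Definition weak_deriv u v :=
  forall phi, Ccinfty phi ->
    \int[leb0T]_x (u x * derive1 phi x) = - \int[leb0T]_x (v x * phi x).

Definition H10 u :=
  u \in Lfun leb0T 2%:E /\
  exists v, [/\ v \in Lfun leb0T 2%:E, weak_deriv u v
    & exists phi : nat -> R -> R,
      [/\ forall n, Ccinfty (phi n),
          ('N[leb0T]_2%:E[EFin \o (phi n \- u)%R])%E @[n --> \oo] --> 0%E
        & ('N[leb0T]_2%:E[EFin \o (derive1 (phi n) \- v)%R])%E @[n --> \oo] --> 0%E]].

Definition H2 u :=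
  u \in Lfun leb0T 2%:E /\
  exists v w, [/\ v \in Lfun leb0T 2%:E, w \in Lfun leb0T 2%:E,
    weak_deriv u v & weak_deriv v w].

(* The support relative to the open interval ]0, T[. *)
Definition supp0T (m : set R -> \bar R) : set R :=
  [set x | I0T x /\ forall U : set R, open U -> U x -> m (U `&` I0T) != 0%E].

Definition primitive (g : R -> R) (x : R) : R := \int[leb0T]_(s in `]0, x[) g s.

End interval_0T.

(* Main.v *)
(* For directions h, eta of bounded variation and small t > 0, TGV (u + t h)
   is at most TGV u + t C with C = alpha |Dh - eta| + beta |D eta|, so that a
   minimizer satisfies - <grad f, h> <= C.  Two integrations by parts give
     - <grad f, h> = int p d(Dh - eta) + int P d(D eta)
   up to boundary terms in p(T) and P(T).  Additive constants in h and eta force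
   p(T) = P(T) = 0; jumps at x in h and eta then give |p(x)| <= alpha and
   |P(x)| <= beta.  In the direction (- u, - w) one may take C = - TGV u, hence
     TGV u <= int p d(Du - w) + int P d(Dw) <= alpha |Du - w| + beta |Dw| = TGV u,
   and equality in both pairings is the condition on the supports.  Conversely
   these equalities give TGV u = - <grad f, u>, the bounds give
   TGV v >= - <grad f, v> for all v, and f v >= f u + <grad f, v - u>. *)

From HB Require Import structures.
Require Import Defs.
From mathcomp Require Import all_boot all_order all_algebra.
From mathcomp Require Import all_classical all_reals all_analysis.
From mathcomp Require Import ring lra measurable_realfun.

Set Implicit Arguments.
Unset Strict Implicit.
Unset Printing Implicit Defensive.

Import Order.TTheory GRing.Theory Num.Theory numFieldNormedType.Exports.

Local Open Scope ring_scope.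
Local Open Scope classical_set_scope.

(** * Smooth bumps *)

(** The obstacle is that all objects are given through test functions: a distributional derivative
    by its action on smooth functions of compact support, the norm of a charge by continuous
    functions vanishing at the ends. The argument pairs charges with primitives, which are neither
    smooth nor compactly supported. The bridge is the density of test functions in L^2 of an
    arbitrary finite measure. For the variation of charges it extends identities to bounded
    measurable functions and identifies [normM] with the total variation; for Lebesgue measure it
    yields approximation by test functions of integral zero, whose primitives are again test
    functions. Charges are compared through [charge_Rintegral] rather than set by set, because
    [Dmeas] and the Jordan parts come from a choice. Boundary values are recorded as integrals: that
    of the gradient is p(T), that of p is - P(T), and membership in [H10] is exchanged for the
    vanishing of these two numbers. For primitives of integrable functions, integration by parts is
    Fubini's theorem on the triangle x < y, so no differentiability is required. *)

Section smooth.
Context {R : realType}.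
Implicit Types (f g : R -> R) (n : nat).

(** Finite-order form of the smoothness clause of [Ccinfty]: each induction step peels off one
    derivative, so closure under products and affine substitution needs only first-order rules and
    no Leibniz formula. *)
Fixpoint Cdiff n f : Prop :=
  if n is n.+1 then (forall x, derivable f x 1) /\ Cdiff n (derive1 f) else True.

Lemma CdiffP f : (forall n x, derivable f^`(n) x 1) <-> forall n, Cdiff n f.
Proof.
split=> [+ n|].
  elim: n f => //= n IH f fd; split; first exact: (fd 0%N).
  by apply: IH => m x; rewrite -derive1Sn.
move=> fd n; elim: n f fd => [f fd x|n IH f fd x].
  by rewrite derive1n0; have [] := fd 1%N.
by rewrite derive1Sn; apply: IH => m; have [] := fd m.+1.
Qed.

Lemma CdiffW n f : Cdiff n.+1 f -> Cdiff n f.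
Proof. by elim: n f => // n IH f [fd dfd]; split => //; exact: IH. Qed.

Lemma Cdiff_derive1 n f f' :
  (forall x, is_derive (x:R) (1:R) f (f' x)) -> Cdiff n f' -> Cdiff n.+1 f.
Proof.
move=> ff' f'd; split => [x|]; first exact: ex_derive.
by rewrite (_ : derive1 f = f')//; apply/funext => x; rewrite derive1E derive_val.
Qed.

Lemma Cdiff_is_derive n f x : Cdiff n.+1 f -> is_derive (x:R) (1:R) f (derive1 f x).
Proof. by case=> fd _; rewrite derive1E; apply: derivableP. Qed.

Lemma CdiffD n f g : Cdiff n f -> Cdiff n g -> Cdiff n (fun x => f x + g x).
Proof.
elim: n f g => // n IH f g fd gd.
apply: (@Cdiff_derive1 _ _ (fun x => derive1 f x + derive1 g x)).
  by move=> x; exact: (is_deriveD (Cdiff_is_derive x fd) (Cdiff_is_derive x gd)).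
by apply: IH; [case: fd|case: gd].
Qed.

Lemma CdiffM n f g : Cdiff n f -> Cdiff n g -> Cdiff n (fun x => f x * g x).
Proof.
elim: n f g => // n IH f g fd gd.
apply: (@Cdiff_derive1 _ _ (fun x => f x * derive1 g x + g x * derive1 f x)).
  by move=> x; exact: (is_deriveM (Cdiff_is_derive x fd) (Cdiff_is_derive x gd)).
apply: CdiffD; apply: IH; try exact: CdiffW.
  by case: gd.
by case: fd.
Qed.

Lemma Cdiff_cst n (c : R) : Cdiff n (fun=> c).
Proof.
by elim: n c => // n IH c; apply: (@Cdiff_derive1 _ _ (fun=> 0)).
Qed.

Lemma CdiffZ n c f : Cdiff n f -> Cdiff n (fun x => c * f x).
Proof. by move=> ?; apply: CdiffM => //; exact: Cdiff_cst. Qed.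

Lemma CdiffX n f k : Cdiff n f -> Cdiff n (fun x => f x ^+ k).
Proof.
move=> fd; elim: k => [|k IH].
  by under eq_fun do rewrite expr0; exact: Cdiff_cst.
by under eq_fun do rewrite exprS; exact: CdiffM.
Qed.

Lemma is_derive_affine (a b x : R) :
  is_derive x (1 : R) (fun y => a * y + b) a.
Proof. by apply: is_derive_eq; rewrite addr0; exact: mulr1. Qed.

Lemma Cdiff_affine n f a b : Cdiff n f -> Cdiff n (fun x => f (a * x + b)).
Proof.
elim: n f => // n IH f fd.
apply: (@Cdiff_derive1 _ _ (fun x => a * derive1 f (a * x + b))).
  move=> x; rewrite mulrC.
  exact: (is_derive1_comp (Cdiff_is_derive _ fd) (is_derive_affine a b x)).
by apply: CdiffZ; apply: IH; case: fd.
Qed.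

(* A family stable under derivation up to linear combinations, whence smoothness
   at 0 without computing iterated derivatives. *)
Definition expNV_pow k (x : R) : R :=
  if 0 < x then x ^- k * expR (- x^-1) else 0.

Lemma expR_ge_pow n (y : R) : 0 <= y -> y ^+ n <= n`!%:R * expR y.
Proof.
move=> y0; case: n => [|n].
  by rewrite expr0 fact0 mul1r -[leLHS]expR0 ler_expR.
rewrite mulrC -ler_pdivrMr ?ltr0n ?fact_gt0//.
by rewrite (le_trans _ (expR_ge1Dxn n y0))// lerDr.
Qed.

Lemma expNV_pow_ge0 k x : 0 <= expNV_pow k x.
Proof.
rewrite /expNV_pow; case: ifPn => // x0.
by rewrite mulr_ge0 ?expR_ge0// invr_ge0 exprn_ge0// ltW.
Qed.

(** This is [expR_ge_pow] at [x^-1] with exponent [k.+2]. The two surplus powers leave the factor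
    [x ^+ 2], which makes the difference quotient at 0 vanish in the limit. *)
Lemma expNV_pow_le k x : expNV_pow k x <= k.+2`!%:R * x ^+ 2.
Proof.
rewrite /expNV_pow; case: ifPn => [x0|_]; last first.
  by rewrite mulr_ge0// sqr_ge0.
have xV0 : 0 <= x^-1 by rewrite invr_ge0 ltW.
rewrite expRN ler_pdivrMr ?expR_gt0// mulrAC -ler_pdivrMr ?exprn_gt0//.
apply: le_trans (expR_ge_pow k.+2 xV0).
rewrite exprVn -(addn2 k) exprD.
by rewrite -invfM.
Qed.

Lemma is_derive_expNV_pow k (x : R) :
  is_derive x (1:R) (expNV_pow k)
    (- k%:R * expNV_pow k.+1 x + expNV_pow k.+2 x).
Proof.
have [x0|x0|->] := ltgtP x 0.
- rewrite {2 3}/expNV_pow ltNge (ltW x0)/= mulr0 addr0.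
  apply: near_eq_is_derive (is_derive_cst (0:R) x 1).
  near=> y; rewrite /expNV_pow ifF//; apply/negbTE; rewrite -leNgt ltW//.
  by near: y; exact: lt_nbhsl.
- have h1 : is_derive x (1:R) (fun y : R => y ^+ k) (k%:R * x ^+ k.-1).
    by split; [exact: exprn_derivable|rewrite exp_derive /GRing.scale/= mulr1].
  have xk0 : x ^+ k != 0 by rewrite expf_neq0// gt_eqF.
  have h2 := @is_deriveV _ (fun y => y ^+ k) _ _ _ xk0 h1.
  have xV : is_derive x (1:R) (fun y : R => - y^-1) (x ^- 2).
    have := @is_deriveV _ id _ _ _ (lt0r_neq0 x0) (is_derive_id x (1:R)).
    move=> /is_deriveN h; apply: (is_derive_eq h).
    by rewrite /GRing.scale/= mulr1 opprK.
  have h3 := is_derive1_comp (is_derive_expR _) xV.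
  have h4 := is_deriveM h2 h3.
  apply: near_eq_is_derive (is_derive_eq h4 _).
    near=> y; rewrite /expNV_pow ifT//.
    by near: y; exact: lt_nbhsr.
  (* The exponent [k.-1] of the power rule truncates at [k = 0], so that case is computed apart. *)
  rewrite /expNV_pow x0 /GRing.scale/=; case: k {h1 xk0 h2 h4} => [|k] /=.
    by rewrite !mul0r !mulr0 addr0 oppr0 mul0r add0r expr0 invr1 mul1r mulrC.
  have x1 : x != 0 by rewrite gt_eqF.
  rewrite !exprS; field.
  by rewrite x1 expf_neq0.
- rewrite {2 3}/expNV_pow ltxx mulr0 addr0.
  (* By [expNV_pow_le] the quotient is at most (k + 2)! |h| in absolute value, on both sides of 0 at
     once. *)
  have H : h^-1 *: ((expNV_pow k \o shift 0) (h *: (1:R)) - expNV_pow k 0)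
     @[h --> (0:R)^'] --> (0:R).
    rewrite [expNV_pow k 0]/expNV_pow ltxx.
    apply/cvgr0Pnorm_le => e e0; near=> h.
    rewrite /= addr0 subr0 /GRing.scale/= mulr1 normrM (ger0_norm (expNV_pow_ge0 _ _)).
    rewrite normfV ler_pdivrMl ?normr_gt0//; last first.
      by near: h; exact: nbhs_dnbhs_neq.
    apply: le_trans (expNV_pow_le k h) _.
    rewrite -(real_normK (num_real h)) expr2 mulrA mulrC; apply: ler_wpM2l => //.
    rewrite mulrC -ler_pdivlMr ?ltr0n ?fact_gt0// ltW//.
    near: h.
    apply: dnbhs0_lt. by rewrite divr_gt0// ltr0n fact_gt0.
  by split; [exact: cvgP H|exact: cvg_lim H].
Unshelve. all: by end_near. Qed.

Lemma Cdiff_expNV_pow n k : Cdiff n (expNV_pow k).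
Proof.
elim: n k => // n IH k; apply: Cdiff_derive1 (is_derive_expNV_pow k) _.
by apply: CdiffD => //; apply: CdiffZ.
Qed.

Lemma expNV_pow0_le1 x : expNV_pow 0 x <= 1.
Proof.
rewrite /expNV_pow; case: ifPn => // x0.
by rewrite expr0 invr1 mul1r -expR0 ler_expR oppr_le0 invr_ge0 ltW.
Qed.

Lemma expNV_pow0_le x y : x <= y -> expNV_pow 0 x <= expNV_pow 0 y.
Proof.
move=> xy; rewrite {1}/expNV_pow; case: ifPn => [x0|_]; last exact: expNV_pow_ge0.
have y0 : 0 < y by exact: lt_le_trans xy.
by rewrite /expNV_pow y0 !expr0 invr1 !mul1r ler_expR lerN2 lef_pV2.
Qed.

Lemma expNV_pow0_gt0 x : 0 < x -> 0 < expNV_pow 0 x.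
Proof. by move=> x0; rewrite /expNV_pow x0 expr0 invr1 mul1r expR_gt0. Qed.

Definition hump a b (x : R) := expNV_pow 0 (x - a) * expNV_pow 0 (b - x).

Lemma Cdiff_hump n a b : Cdiff n (hump a b).
Proof.
apply: CdiffM.
  have := Cdiff_affine 1 (- a) (Cdiff_expNV_pow n 0).
  by under eq_fun do rewrite mul1r.
have := Cdiff_affine (-1) b (Cdiff_expNV_pow n 0).
by under eq_fun do rewrite mulN1r addrC.
Qed.

Lemma hump_ge0 a b x : 0 <= hump a b x.
Proof. by rewrite mulr_ge0// expNV_pow_ge0. Qed.

Lemma hump_le1 a b x : hump a b x <= 1.
Proof. by rewrite mulr_ile1// ?expNV_pow_ge0// expNV_pow0_le1. Qed.

Lemma hump_eq0 a b x : ~~ (a < x < b) -> hump a b x = 0.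
Proof.
rewrite negb_and -!leNgt => /orP[xa|bx]; rewrite /hump /expNV_pow.
  by rewrite ifF ?mul0r//; apply/negbTE; rewrite -leNgt subr_le0.
by rewrite [X in _ * X]ifF ?mulr0//; apply/negbTE; rewrite -leNgt subr_le0.
Qed.

(* At each point of ]a, b[ the shrunk hump eventually stays above a positive
   constant, so the power tends to 0 there; the support is inside ]a, b[. *)
Definition bump a b k (x : R) :=
  1 - (1 - hump (a + k.+1%:R^-1) (b - k.+1%:R^-1) x) ^+ k.

Lemma Cdiff_bump n a b k : Cdiff n (bump a b k).
Proof.
rewrite /bump; apply: CdiffD; first exact: Cdiff_cst.
under eq_fun do rewrite -mulN1r; apply/CdiffZ/CdiffX.
apply: CdiffD; first exact: Cdiff_cst.
by under eq_fun do rewrite -mulN1r; exact/CdiffZ/Cdiff_hump.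
Qed.

Lemma bump_ge0 a b k x : 0 <= bump a b k x.
Proof.
rewrite /bump subr_ge0 exprn_ile1// ?subr_ge0 ?hump_le1//.
by rewrite lerBlDr lerDl hump_ge0.
Qed.

Lemma bump_le1 a b k x : bump a b k x <= 1.
Proof. by rewrite /bump lerBlDr lerDl exprn_ge0// subr_ge0 hump_le1. Qed.

Lemma bump_eq0 a b k x :
  ~~ (a + k.+1%:R^-1 < x < b - k.+1%:R^-1) -> bump a b k x = 0.
Proof. by move=> /hump_eq0 h; rewrite /bump h subr0 expr1n subrr. Qed.

Lemma bump_cvg a b x : bump a b k x @[k --> \oo] --> (\1_(`]a, b[) x : R).
Proof.
rewrite indicE mem_setE in_itv/=; have [/andP[ax xb]|axb] := boolP (a < x < b); last first.
  rewrite (_ : bump a b ^~ x = cst 0)//; first exact: cvg_cst.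
  apply/funext => k; apply: bump_eq0; apply: contra axb => /andP[ax xb].
  have h : (0 : R) < k.+1%:R^-1 by [].
  by rewrite (lt_trans _ ax) ?ltrDl// (lt_trans xb)// gtrDl oppr_lt0.
(* As soon as [k.+1%:R^-1] is below half the distance from [x] to each endpoint, monotonicity of
   [expNV_pow 0] puts the hump at [x] above [c], and [(1 - c) ^+ k] bounds the power. *)
pose c := expNV_pow 0 ((x - a) / 2) * expNV_pow 0 ((b - x) / 2).
have ea : 0 < (x - a) / 2 by rewrite divr_gt0// subr_gt0.
have eb : 0 < (b - x) / 2 by rewrite divr_gt0// subr_gt0.
have c0 : 0 < c by rewrite mulr_gt0// expNV_pow0_gt0// divr_gt0// subr_gt0.
have c1 : c <= 1 by rewrite mulr_ile1// ?expNV_pow_ge0// expNV_pow0_le1.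
have H : (fun k => (1 - hump (a + k.+1%:R^-1) (b - k.+1%:R^-1) x) ^+ k) @ \oo --> (0:R).
  apply: (@squeeze_cvgr _ _ _ _ (fun=> 0) (fun k => (1 - c) ^+ k)); last 2 first.
  - exact: cvg_cst.
  - by apply: cvg_expr; rewrite ger0_norm ?subr_ge0// gtrDl oppr_lt0.
  near=> k.
  have d0 : (0 : R) < k.+1%:R^-1 by [].
  have da : k.+1%:R^-1 < (x - a) / 2.
    by near: k; exact: (near_infty_natSinv_lt (PosNum ea)).
  have db : k.+1%:R^-1 < (b - x) / 2.
    by near: k; exact: (near_infty_natSinv_lt (PosNum eb)).
  move: (k.+1%:R^-1 : R) d0 da db => d d0 da db.
  rewrite exprn_ge0 ?subr_ge0 ?hump_le1//= lerXn2r ?nnegrE ?subr_ge0 ?hump_le1//.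
  apply: lerB => //; apply: ler_pM; rewrite ?expNV_pow_ge0//; apply: expNV_pow0_le; lra.
by have := cvgB (cvg_cst (1 : R)) H; rewrite subr0; exact.
Unshelve. all: by end_near. Qed.

End smooth.

(** * Test functions *)

Section test_functions.
Context {R : realType}.
Variable T : R.
Implicit Types phi psi : R -> R.

(** A nonempty compact subset of ]0, T[ has a least and a greatest element. Vanishing off an
    explicit [[a, b]] passes to sums, derivatives and primitives of integral zero by direct
    computation, with no closure of a support to track. *)
Lemma CcinftyP phi (T0 : 0 < T) : Ccinfty T phi <-> (forall n, Cdiff n phi) /\
  exists a b : R, [/\ 0 < a, a < b, b < T & forall x, ~~ (a <= x <= b) -> phi x = 0].
Proof.
split=> [[/CdiffP phis Kc KI]|[/CdiffP phis [a [b [a0 ab bT phi0]]]]].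
  split => //; set K := closure _ in Kc KI.
  have phiK x : ~ K x -> phi x = 0.
    move=> Kx; apply/eqP/negPn/negP => phix; apply: Kx.
    exact: subset_closure.
  have [K0|/set0P K0] := eqVneq K set0.
    exists (T / 3), (2 * T / 3); split; [clear -T0; lra|lra|lra|].
    by move=> x _; apply: phiK; rewrite K0.
  have idc : {within K, continuous (id : R -> R)}.
    by apply: continuous_subspaceT => x; exact: cvg_id.
  have [M /set_mem KM Mmax] := compact_EVT_max K0 Kc idc.
  have [m /set_mem Km mmin] := compact_EVT_min K0 Kc idc.
  have := KI _ Km; have := KI _ KM; rewrite /I0T /= !in_itv/= => /andP[M0 MT] /andP[m0 mT].
  have mM := mmin _ (mem_set KM).
  (* Halving [m] turns [m <= M] into the strict inequality [a < b]. *)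
  exists (m / 2), M; split => //; [lra|lra|].
  move=> x xmM; apply: phiK => Kx; move/negP: xmM; apply; apply/andP; split.
    by have := mmin _ (mem_set Kx) => /=; lra.
  by have := Mmax _ (mem_set Kx).
have Kab : closure [set x | phi x != 0] `<=` `[a, b]%classic.
  rewrite [X in _ `<=` X](closure_id _).1; last exact: itv_closed.
  apply: closure_subset => x /= phix; rewrite in_itv/=.
  by apply: contraNT phix => /phi0 ->.
split => //.
  apply: (@subclosed_compact _ _ `[a, b]%classic) => //; first exact: closed_closure.
  exact: segment_compact.
move=> x /Kab; rewrite /I0T/= !in_itv/=; lra.
Qed.

Lemma CcinftyD phi psi (T0 : 0 < T) : Ccinfty T phi -> Ccinfty T psi ->
  Ccinfty T (fun x => phi x + psi x).
Proof.
move=> /(CcinftyP _ T0)[phis [a [b [a0 ab bT phi0]]]].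
move=> /(CcinftyP _ T0)[psis [c [d [c0 cd dT psi0]]]].
apply/(CcinftyP _ T0); split; first by move=> n; exact: CdiffD.
exists (Num.min a c), (Num.max b d); split.
- by rewrite lt_min a0 c0.
- by rewrite gt_min !lt_max ab.
- by rewrite gt_max bT.
- move=> x; rewrite negb_and -!ltNge lt_min gt_max => h.
  rewrite phi0 ?psi0 ?addr0// negb_and -!ltNge.
    by move: h => /orP[/andP[_ ->]|/andP[_ ->]]; rewrite ?orbT.
  by move: h => /orP[/andP[-> _]|/andP[-> _]]; rewrite ?orbT.
Qed.

Lemma CcinftyZ phi c (T0 : 0 < T) : Ccinfty T phi -> Ccinfty T (fun x => c * phi x).
Proof.
move=> /(CcinftyP _ T0)[phis [a [b [a0 ab bT phi0]]]].
apply/(CcinftyP _ T0); split; first by move=> n; exact: CdiffZ.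
by exists a, b; split => // x /phi0 ->; rewrite mulr0.
Qed.

Lemma Ccinfty_bump a b k (T0 : 0 < T) : 0 <= a -> b <= T ->
  Ccinfty T (bump a b k).
Proof.
move=> a0 bT; apply/(CcinftyP _ T0); split; first by move=> n; exact: Cdiff_bump.
have d0 : (0 : R) < k.+1%:R^-1 by [].
have [ab|ab] := ltP (a + k.+1%:R^-1) (b - k.+1%:R^-1).
  exists (a + k.+1%:R^-1), (b - k.+1%:R^-1); split => //.
  - by rewrite ltr_wpDl.
  - by rewrite (lt_le_trans _ bT)// gtrDl oppr_lt0.
  - move=> x xab; apply: bump_eq0; apply: contra xab => /andP[ax xb].
    by rewrite !ltW.
exists (T / 3), (2 * T / 3); split; [lra|lra|lra|].
move=> x _; apply: bump_eq0; apply/negP => /andP[ax xb].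
by have := lt_trans ax xb; rewrite ltNge ab.
Qed.

Lemma Cdiff_continuous n phi : Cdiff n.+1 phi -> continuous phi.
Proof.
by move=> [phid _] x; apply: differentiable_continuous; apply/derivable1_diffP.
Qed.

Lemma Ccinfty_continuous phi : Ccinfty T phi -> continuous phi.
Proof. by case=> /CdiffP/(_ 1%N)/Cdiff_continuous. Qed.

Lemma Ccinfty_measurable phi (D : set R) :
  Ccinfty T phi -> measurable_fun D phi.
Proof.
move=> /Ccinfty_continuous phic; apply: measurable_funTS; exact: continuous_measurable_fun.
Qed.

Lemma Ccinfty_derive1 phi (T0 : 0 < T) : Ccinfty T phi -> Ccinfty T (derive1 phi).
Proof.
move=> /(CcinftyP _ T0)[phis [a [b [a0 ab bT phi0]]]].
apply/(CcinftyP _ T0); split; first by move=> n; case: (phis n.+1).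
exists (a / 2), ((b + T) / 2); split; [lra|lra|lra|].
move=> x xab; rewrite derive1E.
have [|] := ltP x a => xa.
  have : \near x, cst 0 x = phi x.
    near=> y; rewrite phi0// negb_and -!ltNge; apply/orP; left.
    by near: y; exact: lt_nbhsl.
  by move=> /near_eq_derive <-//; rewrite derive_cst.
have bx : b < x by move: xab; rewrite negb_and -!ltNge => /orP[]; lra.
have : \near x, cst 0 x = phi x.
  near=> y; rewrite phi0// negb_and -!ltNge; apply/orP; right.
  by near: y; exact: lt_nbhsr.
by move=> /near_eq_derive <-//; rewrite derive_cst.
Unshelve. all: by end_near. Qed.

Lemma Ccinfty_bounded phi (T0 : 0 < T) : Ccinfty T phi ->
  exists2 M, 0 < M & forall x, `|phi x| <= M.
Proof.
move=> phiC; have phic := Ccinfty_continuous phiC.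
move: phiC => /(CcinftyP _ T0)[phis [a [b [a0 ab bT phi0]]]].
have nc : {within `[a, b]%classic, continuous (fun x => `|phi x|)}.
  by apply: continuous_subspaceT => x; apply: continuous_comp; [exact: phic|exact: norm_continuous].
have [c _ cmax] := EVT_max (ltW ab) nc.
exists (`|phi c| + 1) => [|x]; first by rewrite ltr_wpDl.
have [xab|/phi0 ->] := boolP (a <= x <= b); last by rewrite normr0 addr_ge0.
by rewrite (le_trans (cmax x _))// ?lerDl// in_itv.
Qed.

End test_functions.

(** * Density of test functions in L^2 of a finite measure *)

Lemma cvge0_ex (R : realType) (u : (\bar R)^nat) (e : R) :
  u @ \oo --> 0%E -> 0 < e -> exists k, (u k < e%:E)%E.
Proof.
move=> u0 e0.
have : nbhs (0%E : \bar R) [set y | (y < e%:E)%E].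
  by apply: open_nbhs_nbhs; split; [exact: open_ereal_lt_ereal|rewrite /= lte_fin].
by move=> /u0 [k _ /(_ k (leqnn k))] h; exists k.
Qed.

Lemma finite_integrable (R : realType) (m : {finite_measure set (measurableTypeR R) -> \bar R})
    (M : R) (D : set (measurableTypeR R)) (f : R -> R) :
  measurable D -> measurable_fun D f -> (forall x, D x -> `|f x| <= M) ->
  m.-integrable D (EFin \o f).
Proof.
move=> mD mf fM; apply: measurable_bounded_integrable => //.
  by rewrite -ge0_fin_numE// fin_num_measure.
exists M; split; first exact: num_real.
by move=> N MN x Dx; exact: le_trans (fM _ Dx) (ltW MN).
Qed.

Section density.
Context {R : realType}.
Variables (T : R) (m : {finite_measure set (measurableTypeR R) -> \bar R}).
Implicit Types f g h : R -> R.

Lemma measurable_I0T : measurable (I0T T : set (measurableTypeR R)).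
Proof. exact: measurable_itv. Qed.

Lemma measurable_sqr_EFin f : measurable_fun [set: measurableTypeR R] f ->
  measurable_fun (I0T T : set (measurableTypeR R)) (fun x => (f x ^+ 2)%:E).
Proof.
by move=> mf; apply/measurable_EFinP/measurable_funX/measurable_funTS.
Qed.

(** Pointwise the two sides differ by [(f x - g x) ^+ 2]. This stands in for the triangle inequality
    of the L^2 norm, whence the [e / 4] in the density arguments. *)
Lemma ge0_integral_sqrD f g :
  measurable_fun [set: measurableTypeR R] f ->
  measurable_fun [set: measurableTypeR R] g ->
  (\int[m]_(x in I0T T) ((f x + g x) ^+ 2)%:E <=
   2%:E * \int[m]_(x in I0T T) (f x ^+ 2)%:E +
   2%:E * \int[m]_(x in I0T T) (g x ^+ 2)%:E)%E.
Proof.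
move=> mf mg.
have mI := measurable_I0T.
have mf2 := measurable_sqr_EFin mf.
have mg2 := measurable_sqr_EFin mg.
rewrite -!ge0_integralZl_EFin//; try by move=> x _; rewrite lee_fin sqr_ge0.
rewrite -ge0_integralD//; try by [move=> x _; rewrite lee_fin mulr_ge0// sqr_ge0|
  exact: measurable_funeM].
apply: ge0_le_integral => //.
- by move=> x _; rewrite lee_fin sqr_ge0.
- by apply: measurable_sqr_EFin; exact: measurable_funD.
- by apply: emeasurable_funD; exact: measurable_funeM.
- move=> x _; rewrite -!EFinM -EFinD lee_fin -subr_ge0.
  have -> : 2 * f x ^+ 2 + 2 * g x ^+ 2 - (f x + g x) ^+ 2 = (f x - g x) ^+ 2 by ring.
  exact: sqr_ge0.
Qed.

(** The finite measure [m] is arbitrary: Lebesgue measure on ]0, T[ and the variation of a charge,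
    which may have atoms, are both covered. *)
Definition L2approx f := measurable_fun [set: measurableTypeR R] f /\
  forall e : R, 0 < e -> exists2 phi, Ccinfty T phi &
    (\int[m]_(x in I0T T) ((f x - phi x) ^+ 2)%:E < e%:E)%E.

Lemma L2approx_lim f : measurable_fun [set: measurableTypeR R] f ->
  (forall e : R, 0 < e -> exists2 g, L2approx g &
    (\int[m]_(x in I0T T) ((f x - g x) ^+ 2)%:E < e%:E)%E) -> L2approx f.
Proof.
move=> mf fg; split => // e e0.
have e4 : 0 < e / 4 by rewrite divr_gt0.
have [g [mg /(_ _ e4)[phi phiC gphi]] fg4] := fg _ e4.
exists phi => //.
have mphi : measurable_fun [set: measurableTypeR R] phi by exact: Ccinfty_measurable phiC.
under eq_integral => x _ do rewrite -(subrKA (g x)).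
apply: le_lt_trans (ge0_integral_sqrD _ _) _; try exact: measurable_funB.
have -> : e%:E = (2%:E * (e / 4)%:E + 2%:E * (e / 4)%:E)%E.
  by rewrite -!EFinM -EFinD; congr EFin; field.
apply: lteD; rewrite lte_pmul2l//.
Qed.

Lemma L2approxD f g (T0 : 0 < T) : L2approx f -> L2approx g ->
  L2approx (fun x => f x + g x).
Proof.
move=> [mf fa] [mg ga]; split; first exact: measurable_funD.
move=> e e0; have e4 : 0 < e / 4 by rewrite divr_gt0.
have [phi phiC fphi] := fa _ e4.
have [psi psiC gpsi] := ga _ e4.
exists (fun x => phi x + psi x); first exact: CcinftyD.
under eq_integral do rewrite opprD addrACA.
apply: le_lt_trans (ge0_integral_sqrD _ _) _.
- by apply: measurable_funB => //; exact: Ccinfty_measurable phiC.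
- by apply: measurable_funB => //; exact: Ccinfty_measurable psiC.
have -> : e%:E = (2%:E * (e / 4)%:E + 2%:E * (e / 4)%:E)%E.
  by rewrite -!EFinM -EFinD; congr EFin; field.
by apply: lteD; rewrite lte_pmul2l.
Qed.

Lemma L2approxZ f c (T0 : 0 < T) : L2approx f -> L2approx (fun x => c * f x).
Proof.
move=> [mf fa]; split; first exact: measurable_funM.
(* The added 1 covers [c = 0]. *)
move=> e e0; have e4 : 0 < e / (c ^+ 2 + 1).
  by rewrite divr_gt0// ltr_wpDl// sqr_ge0.
have [phi phiC fphi] := fa _ e4.
exists (fun x => c * phi x); first exact: CcinftyZ.
under eq_integral do rewrite -mulrBr exprMn EFinM.
have mfp := measurable_sqr_EFin (measurable_funB mf (Ccinfty_measurable (D := setT) phiC)).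
have mI := measurable_I0T.
rewrite ge0_integralZl_EFin ?sqr_ge0//; last first.
  by move=> x _; rewrite lee_fin sqr_ge0.
apply: (@le_lt_trans _ _ ((c ^+ 2 + 1)%:E * \int[m]_(x in I0T T) ((f x - phi x) ^+ 2)%:E)%E).
  apply: lee_wpmul2r; last by rewrite lee_fin lerDl.
  by apply: integral_ge0 => x _; rewrite lee_fin sqr_ge0.
rewrite -lte_pdivlMl ?ltr_wpDl ?sqr_ge0//.
by rewrite -EFinM mulrC.
Qed.

(** Dominated convergence along [bump a b k], with the constant 1 as bound, integrable because [m]
    is finite. *)
Lemma L2approx_itv a b (T0 : 0 < T) : 0 <= a -> b <= T ->
  L2approx (\1_(`]a, b[) : R -> R).
Proof.
move=> a0 bT; split; first exact: measurable_indic.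
move=> e e0.
have mI := measurable_I0T.
have mbump k : measurable_fun [set: measurableTypeR R] (bump a b k).
  exact: (Ccinfty_measurable (Ccinfty_bump k T0 a0 bT)).
have m1 : measurable_fun [set: measurableTypeR R] (\1_(`]a, b[) : R -> R).
  exact: measurable_indic.
have [||//|||_ _] := @dominated_convergence _ _ R m _ mI
  (fun k x => ((\1_(`]a, b[) x - bump a b k x) ^+ 2)%:E) (cst 0%E) (cst 1%E).
- by move=> k; exact: (measurable_sqr_EFin (measurable_funB m1 (mbump k))).
- exact: measurable_cst.
- apply: aeW => x _; apply: cvg_EFin; first exact: nearW.
  have : \1_`]a, b[ x - bump a b k x @[k --> \oo] --> (0 : R).
    rewrite -[X in _ --> X](subrr (\1_`]a, b[ x : R)).
    by apply: cvgB; [exact: cvg_cst|exact: bump_cvg].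
  move=> h; have := cvgM h h; rewrite mulr0; exact.
- apply: (finite_integrable m (M := 1)) => //.
  by move=> x _; rewrite /= normr1.
- apply: aeW => x k _; rewrite gee0_abs ?lee_fin ?sqr_ge0//.
  have := bump_ge0 a b k x; have := bump_le1 a b k x.
  by move: (bump a b k x) => y; rewrite indicE; case: (_ \in _) => /=; nra.
rewrite integral0 => /cvge0_ex /(_ e0)[k ke].
by exists (bump a b k) => //; exact: Ccinfty_bump.
Qed.

Lemma L2approx_eq f g : measurable_fun [set: measurableTypeR R] f ->
  {in I0T T, f =1 g} -> L2approx g -> L2approx f.
Proof.
move=> mf fg [_ ga]; split => // e /ga[phi phiC gphi]; exists phi => //.
by under eq_integral => x xI do rewrite fg//.
Qed.

(** Monotone class argument: the sets with approximable indicator form a lambda-system, and the rays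
    ]x, +oo[ are a pi-system generating the Borel sets. Inside ]0, T[ such a ray is the interval
    from [Num.max x 0] to [T], treated by [L2approx_itv]. *)
Lemma L2approx_indic (A : set (measurableTypeR R)) (T0 : 0 < T) :
  measurable A -> L2approx (\1_A : R -> R).
Proof.
move=> mA.
pose H := [set A : set (measurableTypeR R) | measurable A /\ L2approx (\1_A : R -> R)].
suff [] : H A by [].
have mI := measurable_I0T.
have ray x : L2approx (\1_(`]x, +oo[) : R -> R).
  apply: (@L2approx_eq _ (\1_(`]Num.max x 0, T[))).
  - by apply: measurable_indic; exact: measurable_itv.
  - move=> y; rewrite /I0T inE/= in_itv/= => /andP[y0 yT].
    by rewrite !indicE !mem_setE !in_itv/= andbT gt_max y0 yT !andbT.
  - by apply: L2approx_itv => //; rewrite le_max lexx orbT.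
have : (@RGenOInfty.G R).-sigma.-measurable A by rewrite -RGenOInfty.measurableE.
apply: (@lambda_system_subset _ (@RGenOInfty.G R) _ setT H) => //.
- move=> _ _ [x ->] [y ->]; exists (Num.max x y).
  by apply/seteqP; split => z /=; rewrite !in_itv/= !andbT gt_max => /andP.
- split => //.
  + split => //; apply: (@L2approx_eq _ (\1_(`]0, T[))).
    * exact: measurable_indic.
    * by move=> y; rewrite /I0T inE/= => yI; rewrite !indicE in_setT mem_setE yI.
    * exact: L2approx_itv.
  + move=> B C CB [mB Ba] [mC Ca]; split; first exact: measurableD.
    have := L2approxD T0 Ba (L2approxZ (-1) T0 Ca).
    apply: L2approx_eq; first by apply: measurable_indic; exact: measurableD.
    move=> x _; rewrite mulN1r !indicE in_setD.
    have [xC|xC] /= := boolP (x \in C); last by rewrite andbT subr0.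
    by rewrite (_ : x \in B) ?subrr//; apply/mem_set/CB/set_mem.
  + move=> F ndF FH; split; first by apply: bigcup_measurable => k _; case: (FH k).
    have mU : measurable (\bigcup_k F k).
      by apply: bigcup_measurable => k _; case: (FH k).
    apply: L2approx_lim; first exact: measurable_indic.
    move=> e e0.
    (* The squared L^2 distance between the two indicators is at most the measure of this remainder,
       which tends to 0 by continuity from above since [m] is finite. *)
    have : m ((\bigcup_k F k) `\` F n) @[n --> \oo] --> 0%E.
      rewrite -(measure0 m).
      have DF0 : \bigcap_n ((\bigcup_k F k) `\` F n) = set0.
        apply/seteqP; split => // x xF; have [[n _ Fnx] _] := xF 0%N I.
        by have [] := xF n I.
      rewrite -DF0; apply: (@nonincreasing_cvg_mu _ _ _ m
        (fun n => (\bigcup_k F k) `\` F n)).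
      - rewrite -ge0_fin_numE// fin_num_measure//; apply: measurableD => //.
        by case: (FH 0%N).
      - by move=> n; apply: measurableD => //; case: (FH n).
      - by rewrite DF0.
      - move=> n k nk; apply/subsetPset => x [Ux nFx]; split => // Fnx; apply: nFx.
        by have /subsetPset := ndF _ _ nk; exact.
    move=> /cvge0_ex /(_ e0)[n ne]; exists (\1_(F n)); first by case: (FH n).
    apply: le_lt_trans ne.
    have mD : measurable ((\bigcup_k F k) `\` F n : set (measurableTypeR R)).
      by apply: measurableD => //; case: (FH n).
    apply: (@le_trans _ _ (m (((\bigcup_k F k) `\` F n) `&` I0T T))); last first.
      by apply: le_measure; rewrite ?inE//; exact: measurableI.
    rewrite -integral_indic// le_eqVlt; apply/orP; left; apply/eqP/eq_integral => x _.
    rewrite !indicE in_setD.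
    have [xF|xF] /= := boolP (x \in F n); last first.
      by rewrite andbT subr0 -natrX; case: (_ \in _).
    by rewrite (_ : x \in _) ?subrr ?expr0n//; apply/mem_set; exists n => //; exact: set_mem.
by move=> _ [x ->]; split => //; exact: measurable_itv.
Qed.
Import HBNNSimple.

Lemma L2approx_nnsfun (h : {nnsfun measurableTypeR R >-> R}) (T0 : 0 < T) :
  L2approx h.
Proof.
rewrite (_ : (h : _ -> _) = fun x => \sum_(y <- finmap.enum_fset (fset_set (range h)))
    y * \1_(h @^-1` [set y]) x); last first.
  by apply/funext => x; rewrite fimfunE fsbig_finite.
elim: (finmap.enum_fset _) => [|y s IH].
  under eq_fun do rewrite big_nil.
  have := L2approxZ 0 T0 (L2approx_indic T0 measurableT).
  by under eq_fun do rewrite mul0r.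
under eq_fun do rewrite big_cons.
by apply: L2approxD => //; apply: L2approxZ => //; exact: L2approx_indic.
Qed.

(** Simple functions increase to [f], and the squared error is dominated by [f x ^+ 2]. *)
Lemma ge0_L2approx f (T0 : 0 < T) : measurable_fun [set: measurableTypeR R] f ->
  (forall x, 0 <= f x) ->
  (\int[m]_(x in I0T T) (f x ^+ 2)%:E < +oo)%E -> L2approx f.
Proof.
move=> mf f0 f2; apply: L2approx_lim => // e e0.
have mI := measurable_I0T.
have mEf : measurable_fun [set: measurableTypeR R] (EFin \o f) by exact/measurable_EFinP.
pose h := nnsfun_approx measurableT mEf.
have hf x : h n x @[n --> \oo] --> f x.
  have := @cvg_nnsfun_approx _ _ _ _ measurableT _ mEf (fun x _ => f0 x) x I.
  by move=> /fine_cvgP[_].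
have h_nd x : {homo (h ^~ x) : k n / (k <= n)%N >-> k <= n}.
  by move=> k n kn; have /lefP := nd_nnsfun_approx measurableT mEf kn; exact.
have h_le n x : h n x <= f x.
  rewrite -(cvg_lim _ (hf x))//; apply: nondecreasing_cvgn_le (h_nd x) _ _.
  exact: cvgP (hf x).
have [|||||_ _] := @dominated_convergence _ _ R m _ mI
  (fun k x => ((f x - h k x) ^+ 2)%:E) (cst 0%E) (fun x => (f x ^+ 2)%:E).
- by move=> k; apply: measurable_sqr_EFin; exact: measurable_funB.
- exact: measurable_cst.
- apply: aeW => x _; apply: cvg_EFin; first exact: nearW.
  have : f x - h n x @[n --> \oo] --> (0 : R).
    rewrite -[X in _ --> X](subrr (f x)); apply: cvgB; [exact: cvg_cst|exact: hf].
  by move=> H; have := cvgM H H; rewrite mulr0; exact.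
- apply/integrableP; split; first exact: measurable_sqr_EFin.
  by under eq_integral do rewrite gee0_abs ?lee_fin ?sqr_ge0//.
- apply: aeW => x k _; rewrite gee0_abs ?lee_fin ?sqr_ge0//.
  rewrite lerXn2r ?nnegrE// ?subr_ge0//.
  by rewrite gerBl.
rewrite integral0 => /cvge0_ex /(_ e0)[k ke].
by exists (h k) => //; exact: L2approx_nnsfun.
Qed.

Lemma sqr_integrable_L2approx f (T0 : 0 < T) : measurable_fun [set: measurableTypeR R] f ->
  (\int[m]_(x in I0T T) (f x ^+ 2)%:E < +oo)%E -> L2approx f.
Proof.
move=> mf f2.
have h g : measurable_fun [set: measurableTypeR R] g -> (forall x, `|g x| <= `|f x|) ->
    (\int[m]_(x in I0T T) (g x ^+ 2)%:E < +oo)%E.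
  move=> mg gf; apply: le_lt_trans f2; apply: ge0_le_integral => //.
  - exact: measurable_I0T.
  - by move=> x _; rewrite lee_fin sqr_ge0.
  - exact: measurable_sqr_EFin.
  - exact: measurable_sqr_EFin.
  - by move=> x _; rewrite lee_fin -[leLHS]real_normK ?num_real//
      -[leRHS]real_normK ?num_real// lerXn2r ?nnegrE.
have mp : measurable_fun [set: measurableTypeR R] f^\+ by exact: measurable_funrpos.
have mn : measurable_fun [set: measurableTypeR R] f^\- by exact: measurable_funrneg.
have pf x : `|f^\+ x| <= `|f x|.
  rewrite /funrpos ger0_norm ?le_max ?lexx ?orbT//.
  by rewrite ge_max ler_norm normr_ge0.
have nf x : `|f^\- x| <= `|f x|.
  rewrite /funrneg ger0_norm ?le_max ?lexx ?orbT//.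
  by rewrite ge_max -normrN ler_norm normr_ge0.
have := L2approxD T0 (ge0_L2approx T0 mp (@funrpos_ge0 _ _ f) (h _ mp pf))
  (L2approxZ (-1) T0 (ge0_L2approx T0 mn (@funrneg_ge0 _ _ f) (h _ mn nf))).
rewrite -[in X in _ -> X](funrposBneg f).
by under eq_fun do rewrite mulN1r.
Qed.

End density.

(** * Primitives and integration by parts on ]0, T[ *)

Section lebesgue0T.
Context {R : realType}.
Variable T : R.
Local Notation mR := (measurableTypeR R).
Local Notation mu := (leb0T T).
Implicit Types f g : R -> R.

Lemma lebesgue_I0T_lty : (@lebesgue_measure R [set` `]0, T[%R] < +oo)%E.
Proof.
rewrite lebesgue_measure_itv/=; case: ifPn => //= _.
by rewrite -EFinD ltry.
Qed.

#[local] Instance leb0T_ae_filter : Filter (almost_everywhere mu) :=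
  ae_filter_ringOfSetsType mu.

(** The measure [leb0T T] again, now with the finite-measure structure on which density, Fubini and
    Radon-Nikodym rely. *)
Definition fleb0T : {finite_measure set mR -> \bar R} :=
  @mfrestr _ mR R _ (@lebesgue_measure R) (measurable_itv (`]0, T[)%R) lebesgue_I0T_lty.

Lemma leb0TT (T0 : 0 < T) : mu setT = T%:E.
Proof.
by rewrite /= /mrestr setTI lebesgue_measure_itv/= lte_fin T0 oppr0 adde0.
Qed.

Lemma leb0TCI : mu (~` I0T T) = 0%E.
Proof. by rewrite /= /mrestr setICl measure0. Qed.

Lemma leb0T_set1 (x : R) : mu [set x] = 0%E.
Proof.
rewrite /= /mrestr; apply/eqP; rewrite eq_le measure_ge0 andbT.
rewrite -(lebesgue_measure_set1 x); apply: le_measure; rewrite ?inE//.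
by apply: measurableI => //; exact: measurable_itv.
Qed.

Lemma leb0T_bounded_integrable (D : set mR) (M : R) f : measurable D ->
  measurable_fun D f -> (forall x, D x -> `|f x| <= M) ->
  mu.-integrable D (EFin \o f).
Proof.
move=> mD mf fM; exact: (@finite_integrable _ fleb0T _ _ _ mD mf fM).
Qed.

Lemma ae_I0T : \forall x \ae mu, I0T T x.
Proof.
exists (~` I0T T); split => //; first by apply: measurableC; exact: measurable_itv.
exact: leb0TCI.
Qed.

Lemma eq_Rintegral_ae f g : measurable_fun [set: mR] f ->
  measurable_fun [set: mR] g -> (\forall x \ae mu, f x = g x) ->
  \int[mu]_x f x = \int[mu]_x g x.
Proof.
move=> mf mg fg; congr fine; apply: ae_eq_integral => //; try exact/measurable_EFinP.
by apply: filterS fg => x /= ->.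
Qed.

Lemma Rintegral_I0T f : measurable_fun [set: mR] f ->
  \int[mu]_x f x = \int[mu]_(x in I0T T) f x.
Proof.
move=> mf; have mI := measurable_I0T T.
rewrite [RHS]Rintegral_mkcond; apply: eq_Rintegral_ae => //.
  by apply/(measurable_restrictT _ mI); exact: measurable_funTS.
by have := ae_I0T; apply: filterS => x xI; rewrite patchE mem_set.
Qed.

Lemma integral_leb0T (A : set mR) (f : R -> \bar R) : measurable A ->
  A `<=` I0T T ->
  (\int[mu]_(x in A) f x = \int[lebesgue_measure]_(x in A) f x)%E.
Proof.
move=> mA AI; apply: eq_measure_integral => B mB BA.
by rewrite /= /mrestr setIidl//; exact: subset_trans AI.
Qed.

Lemma measurable_restr (D : set mR) f : measurable D ->
  measurable_fun [set: mR] f -> measurable_fun [set: mR] (f \_ D).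
Proof.
by move=> mD mf; apply/(measurable_restrictT _ mD); exact: measurable_funTS.
Qed.

Lemma measurable_mul_indic (D : set mR) f : measurable D ->
  measurable_fun [set: mR] f -> measurable_fun [set: mR] (fun x => f x * \1_D x).
Proof. by move=> mD mf; apply: measurable_funM => //; exact: measurable_indic. Qed.

Lemma primitive_ltE g x : measurable_fun [set: mR] g ->
  primitive T g x = \int[mu]_s (g s * \1_(`]-oo, x[) s).
Proof.
move=> mg; rewrite /primitive Rintegral_mkcond; apply: eq_Rintegral_ae.
- exact: measurable_restr (measurable_itv _) mg.
- exact: measurable_mul_indic (measurable_itv _) mg.
- have := ae_I0T; apply: filterS => s; rewrite /I0T/= in_itv/= => /andP[s0 _].
  rewrite patchE indicE !mem_setE !in_itv/= s0/=.
  by case: (s < x); rewrite ?mulr1 ?mulr0.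
Qed.

Lemma integrable_measurable g : mu.-integrable setT (EFin \o g) ->
  measurable_fun [set: mR] g.
Proof. by move=> /integrableP[/measurable_EFinP]. Qed.

Lemma lebesgue_integrable_restr (D : set mR) g : measurable D ->
  mu.-integrable setT (EFin \o g) ->
  (@lebesgue_measure R).-integrable D (EFin \o (g \_ (I0T T))).
Proof.
move=> mD ig; have mg := integrable_measurable ig; have mI := measurable_I0T T.
apply: (@integrableS _ _ _ lebesgue_measure setT) => //.
apply/integrableP; split.
  by apply/measurable_EFinP; exact: measurable_restr.
rewrite [ltLHS](_ : _ = \int[lebesgue_measure]_(x in I0T T) `|(EFin \o g) x|)%E.
  rewrite -integral_leb0T//.
  have /integrableP[_] : mu.-integrable (I0T T) (EFin \o g) by exact: integrableS ig.
  exact.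
rewrite [RHS]integral_mkcond; apply: eq_integral => x _.
by rewrite /= !patchE; case: ifPn => //=; rewrite normr0.
Qed.

(** The integrand is cut off outside ]0, T[, so any [a <= 0] may serve as origin. A sufficiently
    negative origin makes a given point interior to the interval of integration, and continuity or
    differentiability then holds at 0 and below as well. *)
Lemma primitive_lebesgueE g (a x : R) : a <= 0 -> mu.-integrable setT (EFin \o g) ->
  primitive T g x = \int[lebesgue_measure]_(t in `[a, x]) (g \_ (I0T T)) t.
Proof.
move=> a0 ig; have mI := measurable_I0T T; have mg := integrable_measurable ig.
rewrite -Rintegral_itv_bndo_bndc; last first.
  by apply: lebesgue_integrable_restr => //; exact: measurable_itv.
rewrite /primitive Rintegral_mkcond Rintegral_I0T//; last first.
  exact: measurable_restr (measurable_itv _) mg.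
rewrite {1}/Rintegral integral_leb0T//.
rewrite -/(Rintegral _ _ _) Rintegral_mkcond [RHS]Rintegral_mkcond.
congr Rintegral; apply/funext => t.
rewrite !patchE /I0T !mem_setE !in_itv/=.
have [t0|t0] /= := ltP 0 t; last by rewrite !if_same.
by rewrite (le_trans a0 (ltW t0))/=; case: (t < T); case: (t < x).
Qed.

Lemma primitive_continuous g : mu.-integrable setT (EFin \o g) ->
  continuous (primitive T g).
Proof.
move=> ig x; pose b := `|x| + 1.
have b0 : 0 < b by rewrite ltr_wpDl.
have xb : - b < x < b.
  by rewrite -ltr_norml ltrDl.
have bb : - b <= b by rewrite ge0_cp// ltW.
have := @parameterized_integral_continuous _ (- b) b (g \_ (I0T T)) bb.
move=> /(_ (lebesgue_integrable_restr (measurable_itv _) ig)) pc.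
rewrite (_ : primitive T g = (fun y =>
    parameterized_integral lebesgue_measure (- b) y (g \_ (I0T T)))).
  by apply: within_continuous_continuous pc _; rewrite ?gt0_cp// in_itv.
by apply/funext => y; rewrite (@primitive_lebesgueE _ (- b))// oppr_le0 ltW.
Qed.

Lemma primitive_measurable g : mu.-integrable setT (EFin \o g) ->
  measurable_fun [set: mR] (primitive T g).
Proof. by move=> /primitive_continuous; exact: continuous_measurable_fun. Qed.

Lemma le_norm_primitive g x : mu.-integrable setT (EFin \o g) ->
  `|primitive T g x| <= \int[mu]_s `|g s|.
Proof.
move=> ig; have mg := integrable_measurable ig.
rewrite primitive_ltE//.
have igx : mu.-integrable setT (EFin \o (fun s => g s * \1_(`]-oo, x[) s)).
  apply: (le_integrable measurableT _ _ ig).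
    by apply/measurable_EFinP; exact: measurable_mul_indic (measurable_itv _) mg.
  move=> s _; rewrite lee_fin normrM ler_piMr// indicE.
  by case: (_ \in _); rewrite ?normr1 ?normr0.
apply: le_trans (le_normr_Rintegral measurableT igx) _.
apply: le_Rintegral => //.
- by move: igx => /integrable_norm.
- by move: ig => /integrable_norm.
- move=> s _; rewrite normrM ler_piMr// indicE.
  by case: (_ \in _); rewrite ?normr1 ?normr0.
Qed.

(** This is how boundary values at the right end enter: as integrals over the whole interval. *)
Lemma primitiveT g (x : R) : T <= x -> mu.-integrable setT (EFin \o g) ->
  primitive T g x = \int[mu]_s g s.
Proof.
move=> Tx ig; have mg := integrable_measurable ig.
rewrite primitive_ltE//; apply: eq_Rintegral_ae => //.
  exact: measurable_mul_indic (measurable_itv _) mg.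
have := ae_I0T; apply: filterS => s; rewrite /I0T/= in_itv/= => /andP[_ sT].
by rewrite indicE mem_setE in_itv/= (lt_le_trans sT Tx) mulr1.
Qed.

Lemma integrable_mul_indic (D : set mR) g : measurable D ->
  mu.-integrable setT (EFin \o g) ->
  mu.-integrable setT (EFin \o (fun s => g s * \1_D s)).
Proof.
move=> mD ig; have mg := integrable_measurable ig.
apply: (le_integrable measurableT _ _ ig).
  by apply/measurable_EFinP; exact: measurable_mul_indic.
move=> s _; rewrite lee_fin normrM ler_piMr// indicE.
by case: (_ \in _); rewrite ?normr1 ?normr0.
Qed.

Lemma integrable_mul_bounded (M : R) f g : measurable_fun [set: mR] f ->
  (forall x, `|f x| <= M) ->
  mu.-integrable setT (EFin \o g) ->
  mu.-integrable setT (EFin \o (fun s => f s * g s)).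
Proof.
move=> mf fM ig; have mg := integrable_measurable ig.
have M0 : 0 <= M by exact: le_trans (fM 0).
have := integrableZl measurableT M ig.
apply: le_integrable => //.
  by apply/measurable_EFinP; exact: measurable_funM.
by move=> s _; rewrite lee_fin !normrM ler_wpM2r// (le_trans (fM s))// ler_norm.
Qed.

Lemma primitive_bounded g : mu.-integrable setT (EFin \o g) ->
  forall x, `|primitive T g x| <= \int[mu]_s `|g s|.
Proof. by move=> ig x; exact: le_norm_primitive. Qed.

Lemma integral_EFin_Rintegral (D : set mR) f : mu.-integrable D (EFin \o f) ->
  measurable D ->
  (\int[mu]_(x in D) (f x)%:E)%E = (\int[mu]_(x in D) f x)%:E.
Proof. by move=> ig mD; rewrite /Rintegral fineK//; exact: integrable_fin_num. Qed.

Lemma Rintegral_mul_indic_gt g x : mu.-integrable setT (EFin \o g) ->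
  \int[mu]_y (g y * \1_(`]x, +oo[) y) = \int[mu]_y g y - primitive T g x.
Proof.
move=> ig; have mg := integrable_measurable ig.
rewrite primitive_ltE// -RintegralB//; last first.
  exact: integrable_mul_indic (measurable_itv _) ig.
have m1 := measurable_mul_indic (measurable_itv (`]x, +oo[)%R) mg.
have m2 := measurable_mul_indic (measurable_itv (`]-oo, x[)%R) mg.
apply: eq_Rintegral_ae => //; first exact: measurable_funB.
(* The two indicators add up to 1 except at [x] itself. *)
exists [set x]; split; [exact: measurable_set1|exact: leb0T_set1|].
move=> y /= /eqP; apply: contraTeq => /= yx; rewrite negbK !indicE !mem_setE !in_itv/= andbT.
case: ltgtP yx => //; rewrite ?mulr1 ?mulr0 ?subr0 ?subrr//.
Qed.

(** * Integration by parts for primitives, and primitives of test functions *)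

Lemma indic_lt_gt (x y : R) :
  \1_[set z : mR * mR | (z.1 : R) < z.2] (x, y) = \1_(`]x, +oo[) y :> R.
Proof.
rewrite !indicE; congr (nat_of_bool _)%:R.
apply/idP/idP => /set_mem h; apply/mem_set; move: h => /=.
  by rewrite in_itv/= andbT.
by rewrite in_itv/= andbT.
Qed.

Lemma indic_lt_lt (x y : R) :
  \1_[set z : mR * mR | (z.1 : R) < z.2] (x, y) = \1_(`]-oo, y[) x :> R.
Proof. by rewrite indic_lt_gt !indicE !mem_setE !in_itv/= andbT. Qed.

(** Fubini's theorem for [g1 x * g2 y] on the triangle x < y: integrating over [y] first produces
    the tail of [g2], its total integral minus its primitive; integrating over [x] first produces
    the primitive of [g1]. *)
Lemma primitive_IBP g1 g2 : mu.-integrable setT (EFin \o g1) ->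
  mu.-integrable setT (EFin \o g2) ->
  \int[mu]_x (primitive T g1 x * g2 x) + \int[mu]_x (g1 x * primitive T g2 x) =
  (\int[mu]_x g1 x) * (\int[mu]_x g2 x).
Proof.
move=> ig1 ig2; have mg1 := integrable_measurable ig1.
have mg2 := integrable_measurable ig2.
pose F (z : mR * mR) : R := g1 z.1 * g2 z.2 * \1_[set z : mR * mR | z.1 < z.2] z.
have mF : measurable_fun [set: mR * mR] F.
  apply: measurable_funM.
    apply: measurable_funM.
      exact: (measurableT_comp mg1 measurable_fst).
    exact: (measurableT_comp mg2 measurable_snd).
  apply: measurable_indic.
  rewrite -[X in measurable X]setTI.
  have := @measurable_fun_ltr _ (mR * mR)%type R setT fst snd measurable_fst measurable_snd.
  move=> /(_ measurableT [set true]); apply => //.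
have intF : (fleb0T \x fleb0T)%E.-integrable setT (EFin \o F).
  apply/integrable12ltyP; first exact/measurable_EFinP.
  pose C := \int[mu]_y `|g2 y|.
  have C0 : 0 <= C by exact: Rintegral_ge0.
  have ig2' : mu.-integrable setT (EFin \o (fun y => `|g2 y|)).
    by move: ig2 => /integrable_norm.
  have ig1' : mu.-integrable setT (EFin \o (fun y => C * `|g1 y|)).
    by have := integrableZl measurableT C (integrable_norm ig1).
  apply: (@le_lt_trans _ _ (\int[mu]_x (C * `|g1 x|)%:E)%E); last first.
    by rewrite integral_EFin_Rintegral// ltry.
  apply: ge0_le_integral => //.
  - by move=> x _; exact: integral_ge0.
  - apply: (@measurable_fun_fubini_tonelli_F _ _ _ _ _ fleb0T (fun z => `|(EFin \o F) z|%E)) => //.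
    by apply: measurableT_comp => //; exact/measurable_EFinP.
  - exact: measurable_int ig1'.
  - move=> x _; rewrite mulrC EFinM -[C%:E]integral_EFin_Rintegral//.
    rewrite -ge0_integralZl_EFin//; last exact: measurable_int ig2'.
    apply: ge0_le_integral => //.
    + apply: measurableT_comp => //; apply/measurable_EFinP.
      by apply: (measurableT_comp mF); exact: measurable_pair1.
    + by apply: measurable_funeM; exact: measurable_int ig2'.
    + move=> y _; rewrite -EFinM lee_fin /F/= !normrM ler_piMr// indicE.
      by case: (_ \in _); rewrite ?normr1 ?normr0.
have := Fubini intF.
have iG2 : mu.-integrable setT
    (EFin \o (fun x => g1 x * ((\int[mu]_y g2 y) - primitive T g2 x))).
  apply: (eq_integrable measurableT) (integrable_mul_bounded
    (M := `|\int[mu]_y g2 y| + \int[mu]_y `|g2 y|) _ _ ig1).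
  - by move=> x _ /=; rewrite [in RHS]mulrC.
  - by apply: measurable_funB => //; exact: primitive_measurable.
  - move=> x; rewrite (le_trans (ler_normB _ _))// lerD2l.
    exact: primitive_bounded.
have iG1 : mu.-integrable setT (EFin \o (fun x => primitive T g1 x * g2 x)).
  apply: (integrable_mul_bounded (primitive_measurable ig1) _ ig2).
  exact: primitive_bounded.
have -> : (\int[fleb0T]_x \int[fleb0T]_y (EFin \o F) (x, y) =
   (\int[mu]_x (g1 x * ((\int[mu]_y g2 y) - primitive T g2 x)))%:E)%E.
  rewrite -integral_EFin_Rintegral//.
  apply: eq_integral => x _; rewrite -Rintegral_mul_indic_gt//.
  have ig2x := integrable_mul_indic (measurable_itv (`]x, +oo[)%R) ig2.
  rewrite -RintegralZl// -integral_EFin_Rintegral//; last first.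
    by have := integrableZl measurableT (g1 x) ig2x.
  by apply: eq_integral => y _; rewrite /F/= indic_lt_gt mulrA.
have -> : (\int[fleb0T]_y \int[fleb0T]_x (EFin \o F) (x, y) =
   (\int[mu]_x (primitive T g1 x * g2 x))%:E)%E.
  rewrite -integral_EFin_Rintegral//.
  apply: eq_integral => y _; rewrite primitive_ltE//.
  have ig1y := integrable_mul_indic (measurable_itv (`]-oo, y[)%R) ig1.
  rewrite -RintegralZr// -integral_EFin_Rintegral//; last first.
    by have := integrableZr measurableT (g2 y) ig1y.
  by apply: eq_integral => x _; rewrite /F/= indic_lt_lt mulrAC.
move=> [<-].
have ig12 : mu.-integrable setT (EFin \o (fun x => g1 x * primitive T g2 x)).
  apply: (eq_integrable measurableT) (integrable_mul_bounded (primitive_measurable ig2)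
    (primitive_bounded ig2) ig1).
  by move=> x _ /=; rewrite [in RHS]mulrC.
rewrite -RintegralD//.
under eq_Rintegral do rewrite mulrBr subrK.
by rewrite RintegralZr.
Qed.

Lemma Ccinfty_integrable phi (T0 : 0 < T) : Ccinfty T phi ->
  mu.-integrable setT (EFin \o phi).
Proof.
move=> phiC; have [M _ phiM] := Ccinfty_bounded T0 phiC.
apply: (leb0T_bounded_integrable (M := M)) => //; exact: Ccinfty_measurable phiC.
Qed.

Lemma Ccinfty_out phi x (T0 : 0 < T) : Ccinfty T phi -> ~ I0T T x -> phi x = 0.
Proof.
move=> /(CcinftyP _ T0)[_ [a [b [a0 ab bT phi0]]]] xI; apply: phi0.
apply/negP => /andP[ax xb]; apply: xI; rewrite /I0T/= in_itv/=.
by rewrite (lt_le_trans a0 ax) (le_lt_trans xb bT).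
Qed.

Lemma Ccinfty_restr phi (T0 : 0 < T) : Ccinfty T phi -> phi \_ (I0T T) = phi.
Proof.
move=> phiC; apply/funext => x; rewrite patchE; case: ifPn => // /negP xI.
by rewrite (Ccinfty_out T0 phiC)// => h; apply: xI; exact: mem_set.
Qed.

Lemma Ccinfty_derivable phi x : Ccinfty T phi -> derivable phi x 1.
Proof. by case=> /CdiffP/(_ 1%N)[]. Qed.

Lemma Ccinfty_primitive_derive1 phi x (T0 : 0 < T) : Ccinfty T phi ->
  primitive T (derive1 phi) x = phi x.
Proof.
move=> phiC; have dphiC := Ccinfty_derive1 T0 phiC.
rewrite (primitive_lebesgueE (a := 0))//; last exact: Ccinfty_integrable.
rewrite (Ccinfty_restr T0 dphiC).
have [x0|x0] := leP x 0.
  rewrite (Ccinfty_out T0 phiC); last first.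
    by rewrite /I0T/= in_itv/= ltNge x0.
  move: x0; rewrite le_eqVlt => /predU1P[->|x0]; first by rewrite set_itv1 Rintegral_set1.
  by rewrite set_itv_ge ?bnd_simp -?ltNge// Rintegral_set0.
rewrite /Rintegral (@continuous_FTC2 _ _ phi)//.
- rewrite /= (Ccinfty_out T0 phiC (x := 0)) ?subr0//.
  by rewrite /I0T/= in_itv/= ltxx.
- by apply: continuous_subspaceT; exact: Ccinfty_continuous dphiC.
- split.
  + by move=> y _; exact: Ccinfty_derivable.
  + by apply: cvg_at_right_filter; exact: Ccinfty_continuous phiC 0.
  + by apply: cvg_at_left_filter; exact: Ccinfty_continuous phiC x.
Qed.

Lemma primitive_derive1 psi x (T0 : 0 < T) : Ccinfty T psi ->
  derivable (primitive T psi) x 1 /\ derive1 (primitive T psi) x = psi x.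
Proof.
move=> psiC; have ipsi := Ccinfty_integrable T0 psiC.
pose a := - (`|x| + 1).
have a0 : a <= 0 by rewrite oppr_le0 addr_ge0.
have ax : a < x by rewrite ltrNl (le_lt_trans (ler_norm _))// normrN ltrDl.
rewrite (_ : primitive T psi = (fun y => \int[lebesgue_measure]_(t in `[a, y]) psi t)); last first.
  by apply/funext => y; rewrite (primitive_lebesgueE _ a0 ipsi) Ccinfty_restr.
apply: (@continuous_FTC1_closed _ psi a x (x + 1)) => //.
- by rewrite ltrDl.
- have := lebesgue_integrable_restr (measurable_itv `[a, x + 1]%R) ipsi.
  by rewrite Ccinfty_restr.
- exact: Ccinfty_continuous psiC x.
Qed.

(** To the right of the support of [psi] the primitive equals the whole integral, so integral zero
    is what keeps its support compact in ]0, T[. Such primitives are the test functions with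
    prescribed derivative. *)
Lemma Ccinfty_primitive psi (T0 : 0 < T) : Ccinfty T psi -> \int[mu]_x psi x = 0 ->
  Ccinfty T (primitive T psi).
Proof.
move=> psiC psi0; have ipsi := Ccinfty_integrable T0 psiC.
have [psis [a [b [a0 ab bT psiab]]]] := (CcinftyP _ T0).1 psiC.
apply/(CcinftyP _ T0); split.
  move=> [//|n]; split; first by move=> x; case: (primitive_derive1 x T0 psiC).
  rewrite (_ : derive1 _ = psi)//; apply/funext => x.
  by case: (primitive_derive1 x T0 psiC).
exists a, b; split => // x; rewrite negb_and -!ltNge => xab.
rewrite primitive_ltE; last exact: Ccinfty_measurable psiC.
move: xab => /orP[xa|bx].
  rewrite /Rintegral integral0_eq// => s _; rewrite indicE mem_setE in_itv/=.
  have [sx|] := ltP s x; last by rewrite mulr0.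
  by rewrite psiab ?mul0r// negb_and -ltNge (lt_trans sx xa).
rewrite -psi0; apply: eq_Rintegral => s _; rewrite indicE mem_setE in_itv/=.
have [sx|xs] := ltP s x; first by rewrite mulr1.
by rewrite mulr0 psiab// negb_and -!ltNge (lt_le_trans bx xs) orbT.
Qed.

(** An instance of [primitive_IBP] whose second factor is the derivative of a test function, of
    integral [phi T = 0]. *)
Lemma primitive_weak_deriv g (T0 : 0 < T) : mu.-integrable setT (EFin \o g) ->
  weak_deriv T (primitive T g) g.
Proof.
move=> ig phi phiC; have dphiC := Ccinfty_derive1 T0 phiC.
have idphi := Ccinfty_integrable T0 dphiC.
have := primitive_IBP ig idphi.
have -> : \int[mu]_x derive1 phi x = 0.
  rewrite -(primitiveT (lexx T) idphi) Ccinfty_primitive_derive1//.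
  by apply: (Ccinfty_out T0 phiC); rewrite /I0T/= in_itv/= ltxx andbF.
under [X in _ + X = _ -> _]eq_Rintegral do rewrite Ccinfty_primitive_derive1//.
by rewrite mulr0 => /eqP; rewrite addr_eq0 => /eqP.
Qed.

(** * Square-integrable functions and approximation under the constraint of integral zero *)

Lemma Lfun2P f : f \in Lfun mu 2%:E <->
  measurable_fun [set: mR] f /\ mu.-integrable setT (EFin \o (fun x => f x ^+ 2)).
Proof.
split=> [f2|[mf f2]].
  split; last exact: Lfun2_integrable_sqr.
  by move: f2; rewrite inE => /andP[]; rewrite inE.
rewrite inE; apply/andP; split; rewrite inE//= /finite_norm unlock/=.
apply: poweR_lty; move: f2 => /integrableP[_].
under eq_integral do rewrite gee0_abs ?lee_fin ?sqr_ge0//.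
apply: le_lt_trans; rewrite le_eqVlt; apply/orP; left; apply/eqP.
by apply: eq_integral => x _; rewrite powR_mulrn// real_normK// num_real.
Qed.

Lemma Lfun2_integrable f : f \in Lfun mu 2%:E -> mu.-integrable setT (EFin \o f).
Proof.
move=> f2; apply/Lfun1_integrable; apply: Lfun_subset12 f2.
exact: (@fin_num_measure _ _ _ fleb0T).
Qed.

Lemma bounded_Lfun2 (M : R) f : measurable_fun [set: mR] f ->
  (forall x, `|f x| <= M) -> f \in Lfun mu 2%:E.
Proof.
move=> mf fM; apply/Lfun2P; split => //.
apply: (leb0T_bounded_integrable (M := M ^+ 2)) => //; first exact: measurable_funX.
by move=> x _; rewrite normrX lerXn2r// nnegrE// (le_trans (normr_ge0 (f x))).
Qed.

Lemma Lnorm2E f : f \in Lfun mu 2%:E ->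
  'N[mu]_2%:E[EFin \o f]%E = (Num.sqrt (\int[mu]_x (f x ^+ 2)))%:E.
Proof.
move=> /Lfun2P[mf f2]; rewrite unlock/=.
rewrite [X in (X `^ _)%E = _](_ : _ = (\int[mu]_x (f x ^+ 2))%:E).
  by rewrite poweR_EFin powR12_sqrt// Rintegral_ge0// => x _; exact: sqr_ge0.
rewrite -integral_EFin_Rintegral//; apply: eq_integral => x _.
by rewrite /= powR_mulrn// real_normK// num_real.
Qed.

Lemma Lnorm2_le (e : R) f : 0 <= e -> f \in Lfun mu 2%:E ->
  \int[mu]_x (f x ^+ 2) <= e ^+ 2 -> ('N[mu]_2%:E[EFin \o f] <= e%:E)%E.
Proof.
move=> e0 f2 fe; rewrite Lnorm2E// lee_fin -(ger0_norm e0) -sqrtr_sqr.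
by rewrite ler_sqrt// sqr_ge0.
Qed.

Lemma Rintegral_cst0T (T0 : 0 < T) (c : R) : \int[mu]_x c = c * T.
Proof. by rewrite Rintegral_cst// leb0TT. Qed.

(** The square of [h] minus its average [c] integrates to [Q - I ^+ 2 / T], which is therefore
    nonnegative. *)
Lemma sqr_Rintegral_le h (T0 : 0 < T) : h \in Lfun mu 2%:E ->
  (\int[mu]_x h x) ^+ 2 <= T * \int[mu]_x (h x ^+ 2).
Proof.
move=> h2; have ih := Lfun2_integrable h2; have [mh ih2] := (Lfun2P h).1 h2.
set I := \int[mu]_x h x; set Q := \int[mu]_x (h x ^+ 2).
pose c := I / T.
have : 0 <= \int[mu]_x ((h x - c) ^+ 2) by apply: Rintegral_ge0 => x _; exact: sqr_ge0.
have ic : mu.-integrable setT (EFin \o (fun=> c ^+ 2)).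
  by apply: (leb0T_bounded_integrable (M := `|c ^+ 2|)).
have ich : mu.-integrable setT (EFin \o (fun x => (c *+ 2) * h x)).
  by have := integrableZl measurableT (c *+ 2) ih.
under eq_Rintegral do rewrite sqrrB -mulrnAr mulrC.
rewrite RintegralD// ?RintegralB//; last first.
  by have := integrableB measurableT ih2 ich.
rewrite RintegralZl// Rintegral_cst0T// -/I -/Q.
have -> : Q - c *+ 2 * I + c ^+ 2 * T = Q - I ^+ 2 / T.
  rewrite /c; field; by rewrite gt_eqF.
by rewrite subr_ge0 ler_pdivrMr// mulrC.
Qed.

Lemma Lfun2_approx g (e : R) (T0 : 0 < T) : g \in Lfun mu 2%:E -> 0 < e ->
  exists2 phi, Ccinfty T phi & \int[mu]_x ((g x - phi x) ^+ 2) < e.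
Proof.
move=> /Lfun2P[mg g2] e0; have mI := measurable_I0T T.
have gI2 : (\int[mu]_(x in I0T T) (g x ^+ 2)%:E < +oo)%E.
  have /integrableP[_] : mu.-integrable (I0T T) (EFin \o (fun x => g x ^+ 2)).
    exact: (integrableS measurableT mI (@subsetT _ _) g2).
  by under eq_integral do rewrite gee0_abs ?lee_fin ?sqr_ge0//.
have [_ /(_ _ e0)[phi phiC gphi]] := @sqr_integrable_L2approx _ T fleb0T g T0 mg gI2.
exists phi => //.
rewrite Rintegral_I0T; last first.
  by apply/measurable_funX/measurable_funB => //; exact: Ccinfty_measurable phiC.
rewrite -lte_fin fineK//.
by rewrite ge0_fin_numE ?(lt_trans gphi) ?ltry// integral_ge0// => x _; rewrite lee_fin sqr_ge0.
Qed.

Lemma Ccinfty_Lfun2 phi (T0 : 0 < T) : Ccinfty T phi -> phi \in Lfun mu 2%:E.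
Proof.
move=> phiC; have [M _ phiM] := Ccinfty_bounded T0 phiC.
by apply: (bounded_Lfun2 (M := M)) => //; exact: Ccinfty_measurable phiC.
Qed.

Lemma Lfun2D f g : f \in Lfun mu 2%:E -> g \in Lfun mu 2%:E ->
  (fun x => f x + g x) \in Lfun mu 2%:E.
Proof. exact: (@Lfun_addr_closed _ _ _ mu _ (lee1n 2)).2. Qed.

Lemma Lfun2Z f (c : R) : f \in Lfun mu 2%:E -> (fun x => c * f x) \in Lfun mu 2%:E.
Proof.
move=> /Lfun2P[mf f2]; apply/Lfun2P; split; first exact: measurable_funM.
under eq_fun do rewrite exprMn.
by have := integrableZl measurableT (c ^+ 2) f2.
Qed.

Lemma Lfun2B f g : f \in Lfun mu 2%:E -> g \in Lfun mu 2%:E ->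
  (fun x => f x - g x) \in Lfun mu 2%:E.
Proof.
move=> f2 g2; have := Lfun2D f2 (Lfun2Z (-1) g2).
by under eq_fun do rewrite mulN1r.
Qed.

Lemma Lfun2_cst (c : R) : (fun=> c) \in Lfun mu 2%:E.
Proof. exact: (bounded_Lfun2 (M := `|c|)). Qed.

Lemma Lfun2_sqr f : f \in Lfun mu 2%:E -> mu.-integrable setT (EFin \o (fun x => f x ^+ 2)).
Proof. by move=> /Lfun2P[]. Qed.

Lemma Lfun2_mul f g : f \in Lfun mu 2%:E -> g \in Lfun mu 2%:E ->
  mu.-integrable setT (EFin \o (fun x => f x * g x)).
Proof. by move=> f2 g2; apply/Lfun1_integrable; exact: Lfun2_mul_Lfun1. Qed.

(** Because [1 - 2 * phi <= (1 - phi) ^+ 2], a squared L^2 distance to 1 below [T] forces a positive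
    integral, and [phi] can be normalised. *)
Lemma Ccinfty_unit_mass (T0 : 0 < T) :
  exists2 phi, Ccinfty T phi & \int[mu]_x phi x = 1.
Proof.
have [phi phiC phi1] := Lfun2_approx T0 (Lfun2_cst 1) T0.
have phi2 := Ccinfty_Lfun2 T0 phiC; have iphi := Lfun2_integrable phi2.
have J0 : 0 < \int[mu]_x phi x.
  have : \int[mu]_x (1 - 2 * phi x) <= \int[mu]_x (1 - phi x) ^+ 2.
    apply: le_Rintegral => //.
    - have := integrableB measurableT (Lfun2_integrable (Lfun2_cst 1))
        (Lfun2_integrable (Lfun2Z 2 phi2)).
      exact.
    - exact: Lfun2_sqr (Lfun2B (Lfun2_cst 1) phi2).
    - move=> x _; rewrite -subr_ge0 (_ : _ - _ = phi x ^+ 2) ?sqr_ge0//; ring.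
  rewrite RintegralB//;
    [|exact: Lfun2_integrable (Lfun2_cst 1)|exact: Lfun2_integrable (Lfun2Z 2 phi2)].
  rewrite Rintegral_cst0T// RintegralZl// mul1r => h.
  by move: (le_lt_trans h phi1); rewrite ltrBlDr ltrDl pmulr_rgt0.
exists (fun x => (\int[mu]_x phi x)^-1 * phi x); first exact: CcinftyZ.
by rewrite RintegralZl// mulVf// gt_eqF.
Qed.

(** A test function close to [g] has a small integral, which a multiple of a fixed test function of
    unit mass removes. *)
Lemma Lfun2_mean0_approx g (e : R) (T0 : 0 < T) : g \in Lfun mu 2%:E ->
  \int[mu]_x g x = 0 -> 0 < e ->
  exists phi, [/\ Ccinfty T phi, \int[mu]_x phi x = 0 &
    \int[mu]_x ((g x - phi x) ^+ 2) < e].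
Proof.
move=> g2 g0 e0; have [w wC w1] := Ccinfty_unit_mass T0.
have w2 := Ccinfty_Lfun2 T0 wC; have iw := Lfun2_integrable w2.
set K := \int[mu]_x (w x ^+ 2).
have K0 : 0 <= K by apply: Rintegral_ge0 => x _; exact: sqr_ge0.
(* Cauchy-Schwarz for [g - phi] bounds the squared coefficient of the correction by [T * e']. The
   resulting bound [2 * e' + 2 * (T * e') * K] equals [e]. *)
pose e' := e / (2 + 2 * T * K).
have D0 : 0 < 2 + 2 * T * K by rewrite ltr_pwDl// !mulr_ge0// ltW.
have e'0 : 0 < e' by rewrite divr_gt0.
have [phi phiC gphi] := Lfun2_approx T0 g2 e'0.
have phi2 := Ccinfty_Lfun2 T0 phiC; have iphi := Lfun2_integrable phi2.
set c := \int[mu]_x phi x.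
have gp2 := Lfun2B g2 phi2.
have c2 : c ^+ 2 <= T * e'.
  have := sqr_Rintegral_le T0 gp2.
  rewrite RintegralB//; last exact: Lfun2_integrable.
  rewrite g0 sub0r sqrrN => /le_trans; apply.
  by rewrite ler_pM2l// ltW.
exists (fun x => phi x + - c * w x); split.
- by apply: CcinftyD => //; exact: CcinftyZ.
- rewrite RintegralD//; last exact: Lfun2_integrable (Lfun2Z _ w2).
  by rewrite RintegralZl// w1 mulr1 subrr.
- have i1 : mu.-integrable setT (EFin \o (fun x => 2 * (g x - phi x) ^+ 2)).
    by have := integrableZl measurableT 2 (Lfun2_sqr gp2).
  have i2 : mu.-integrable setT (EFin \o (fun x => 2 * c ^+ 2 * w x ^+ 2)).
    by have := integrableZl measurableT (2 * c ^+ 2) (Lfun2_sqr w2).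
  apply: (@le_lt_trans _ _ (\int[mu]_x (2 * (g x - phi x) ^+ 2 + 2 * c ^+ 2 * w x ^+ 2))).
    apply: le_Rintegral => //.
    + by apply: Lfun2_sqr; apply/Lfun2B/Lfun2D/Lfun2Z.
    + by have := integrableD measurableT i1 i2.
    + move=> x _; rewrite -subr_ge0 (_ : _ - _ = (g x - phi x - c * w x) ^+ 2) ?sqr_ge0//; ring.
  rewrite RintegralD// !RintegralZl//; [|exact: Lfun2_sqr..].
  rewrite -/K (_ : e = 2 * e' + 2 * (T * e') * K); last first.
    by rewrite /e'; field; rewrite gt_eqF.
  by rewrite ltr_leD ?ltr_pM2l// ler_wpM2r// ler_pM2l.
Qed.

Lemma primitive_subE g h x : mu.-integrable setT (EFin \o g) ->
  mu.-integrable setT (EFin \o h) ->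
  primitive T g x - primitive T h x = primitive T (fun y => g y - h y) x.
Proof.
move=> ig ih; have mg := integrable_measurable ig; have mh := integrable_measurable ih.
have ix := integrable_mul_indic (measurable_itv (`]-oo, x[)%R).
rewrite !primitive_ltE//; last exact: measurable_funB.
rewrite -RintegralB//; [|exact: ix..].
by apply: eq_Rintegral => y _; rewrite mulrBl.
Qed.

(** Cauchy-Schwarz for the absolute value of [g]. The bound is independent of [x], so L^2 closeness
    of functions becomes uniform closeness of their primitives. *)
Lemma sqr_primitive_le g x (T0 : 0 < T) : g \in Lfun mu 2%:E ->
  primitive T g x ^+ 2 <= T * \int[mu]_y (g y ^+ 2).
Proof.
move=> g2; have ig := Lfun2_integrable g2.
have g2' : (fun y => `|g y|) \in Lfun mu 2%:E.
  apply/Lfun2P; split.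
    exact: (measurableT_comp (@normr_measurable _ setT) (integrable_measurable ig)).
  under eq_fun do rewrite real_normK ?num_real//.
  exact: Lfun2_sqr.
apply: (@le_trans _ _ ((\int[mu]_y `|g y|) ^+ 2)).
  rewrite -(real_normK (num_real (primitive T g x))) lerXn2r ?nnegrE//.
    by apply: Rintegral_ge0.
  exact: le_norm_primitive.
apply: le_trans (sqr_Rintegral_le T0 g2') _.
by under eq_Rintegral do rewrite real_normK ?num_real//.
Qed.

Lemma primitive_Lfun2 g : mu.-integrable setT (EFin \o g) ->
  primitive T g \in Lfun mu 2%:E.
Proof.
by move=> ig; apply: bounded_Lfun2 (primitive_measurable ig) (primitive_bounded ig).
Qed.

(** Test functions of integral zero approximate [g] in L^2 and their primitives are test functions;
    [sqr_primitive_le] carries the approximation over to the primitives. *)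
Lemma primitive_H10 g (T0 : 0 < T) : g \in Lfun mu 2%:E ->
  \int[mu]_x g x = 0 -> H10 T (primitive T g).
Proof.
move=> g2 g0; have ig := Lfun2_integrable g2.
have pg2 := primitive_Lfun2 ig.
split => //; exists g; split => //; first exact: primitive_weak_deriv.
have e0 n : (0 : R) < n.+1%:R^-1 ^+ 2 by rewrite exprn_gt0.
pose h n := projT1 (cid (Lfun2_mean0_approx T0 g2 g0 (e0 n))).
have hC n : Ccinfty T (h n) by rewrite /h; case: cid => ? [].
have h0 n : \int[mu]_x h n x = 0 by rewrite /h; case: cid => ? [].
have gh n : \int[mu]_x ((g x - h n x) ^+ 2) < n.+1%:R^-1 ^+ 2 by rewrite /h; case: cid => ? [].
have h2 n := Ccinfty_Lfun2 T0 (hC n).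
have ih n := Lfun2_integrable (h2 n).
have hg2 n : (fun x => h n x - g x) \in Lfun mu 2%:E by exact: Lfun2B.
have hg n : \int[mu]_x ((h n x - g x) ^+ 2) <= n.+1%:R^-1 ^+ 2.
  by rewrite ltW//; under eq_Rintegral do rewrite -sqrrN opprB.
have cvg0 (c : R) : (c * n.+1%:R^-1)%:E @[n --> \oo] --> 0%E.
  apply: cvg_EFin; first exact: nearW.
  by rewrite -[X in _ --> X](mulr0 c); apply: cvgM; [exact: cvg_cst|exact: cvg_harmonic].
have dh n : derive1 (primitive T (h n)) = h n.
  by apply/funext => x; have [] := primitive_derive1 x T0 (hC n).
exists (fun n => primitive T (h n)); split.
- by move=> n; exact: Ccinfty_primitive.
- apply: (squeeze_cvge _ (cvg_cst _) (cvg0 T)); near=> n.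
  rewrite Lnorm_ge0/=; apply: Lnorm2_le; first by rewrite mulr_ge0// ltW.
    exact: Lfun2B (primitive_Lfun2 (ih n)) pg2.
  (* The squared error of the primitives is bounded pointwise by this integrand; integration over
     ]0, T[ supplies a second factor [T]. *)
  apply: (@le_trans _ _ (\int[mu]_x (T * n.+1%:R^-1 ^+ 2))).
    apply: le_Rintegral => //.
    + exact: Lfun2_sqr (Lfun2B (primitive_Lfun2 (ih n)) pg2).
    + by apply: (leb0T_bounded_integrable (M := `|T * n.+1%:R^-1 ^+ 2|)).
    + move=> x _; rewrite /= primitive_subE//.
      by apply: le_trans (sqr_primitive_le x T0 (hg2 n)) _; rewrite ler_pM2l.
  by rewrite Rintegral_cst0T// exprMn expr2 mulrC mulrA.
- apply: (squeeze_cvge _ (cvg_cst _) (cvg0 1)); near=> n.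
  rewrite Lnorm_ge0/= dh mul1r; apply: Lnorm2_le => //; [exact: hg2|exact: hg].
Unshelve. all: by end_near. Qed.

End lebesgue0T.

(** * Integration against a charge and the dual norm *)

Lemma fin_sub_eqe (R : realType) (a b c d : \bar R) : a \is a fin_num -> b \is a fin_num ->
  c \is a fin_num -> d \is a fin_num -> (a - b = c - d)%E -> (a + d = b + c)%E.
Proof.
move: a b c d => [a| |] [b| |] [c| |] [d| |]// _ _ _ _.
by rewrite -!EFinB -!EFinD => -[h]; congr EFin; lra.
Qed.

Lemma fin_addsube (R : realType) (a b c d : \bar R) : a \is a fin_num -> b \is a fin_num ->
  c \is a fin_num -> d \is a fin_num -> ((a - b) + (c - d) = (a + c) - (b + d))%E.
Proof.
move: a b c d => [a| |] [b| |] [c| |] [d| |]// _ _ _ _.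
by rewrite -!EFinB -!EFinD; congr EFin; lra.
Qed.

Section charges.
Context {R : realType}.
Variable T : R.
Local Notation mR := (measurableTypeR R).
Local Notation mu := (leb0T T).
Local Notation I := (I0T T).
Implicit Types (f g : R -> R) (nu : {charge set mR -> \bar R}).

Definition fin_measure_add (m1 m2 : {finite_measure set mR -> \bar R}) := measure_add m1 m2.

Section fin_measure_add.
Variables m1 m2 : {finite_measure set mR -> \bar R}.
HB.instance Definition _ := Measure.on (fin_measure_add m1 m2).
Lemma fin_measure_add_fin : fin_num_fun (fin_measure_add m1 m2).
Proof.
by move=> U mU; rewrite /fin_measure_add measure_addE fin_numD !fin_num_measure.
Qed.
HB.instance Definition _ := @Measure_isFinite.Build _ _ _ (fin_measure_add m1 m2)
  fin_measure_add_fin.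
Lemma fin_measure_addE A : fin_measure_add m1 m2 A = (m1 A + m2 A)%E.
Proof. exact: measure_addE. Qed.

End fin_measure_add.

(* [jpos] and [jneg] with their finite-measure structure. *)
Definition fpos nu : {finite_measure set mR -> \bar R} :=
  jordan_pos (projT2 (cid (hahn_exists nu))).
Definition fneg nu : {finite_measure set mR -> \bar R} :=
  jordan_neg (projT2 (cid (hahn_exists nu))).

Lemma fpos_fnegE nu A : measurable A -> nu A = (fpos nu A - fneg nu A)%E.
Proof.
move=> mA; rewrite (jordan_decomp (projT2 (cid (hahn_exists nu))) mA).
by rewrite /cadd/= cscaleN1.
Qed.

(** The hypothesis says that [fpos nu + m2] and [fneg nu + m1] are the same measure on [D]. Hence
    the Hahn decomposition chosen inside [charge_Rintegral] is immaterial, and computing with a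
    charge reduces to exhibiting some decomposition. *)
Lemma charge_RintegralE nu (m1 m2 : {finite_measure set mR -> \bar R}) (D : set mR) f (M : R) :
  (forall A, measurable A -> A `<=` D -> nu A = (m1 A - m2 A)%E) ->
  measurable D -> measurable_fun D f -> (forall x, D x -> `|f x| <= M) ->
  charge_Rintegral nu D f = \int[m1]_(x in D) f x - \int[m2]_(x in D) f x.
Proof.
move=> num mD mf fM.
have fi (m : {finite_measure set mR -> \bar R}) : m.-integrable D (EFin \o f).
  exact: finite_integrable fM.
have : (\int[measure_add (fpos nu) m2]_(x in D) (f x)%:E =
    \int[measure_add (fneg nu) m1]_(x in D) (f x)%:E)%E.
  apply: eq_measure_integral => A mA AD.
  rewrite -[LHS]/(measure_add (fpos nu) m2 A) -[RHS]/(measure_add (fneg nu) m1 A).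
  rewrite !measure_addE; apply: fin_sub_eqe; rewrite ?fin_num_measure//.
  by rewrite -num// fpos_fnegE.
rewrite (integral_measure_add mD (fi (fpos nu)) (fi m2)).
rewrite (integral_measure_add mD (fi (fneg nu)) (fi m1)) => /(congr1 fine).
have fn m := integrable_fin_num mD (fi m).
rewrite (fineD (fn (fpos nu)) (fn m2)) (fineD (fn (fneg nu)) (fn m1)) => h.
have -> : charge_Rintegral nu D f =
  \int[fpos nu]_(x in D) f x - \int[fneg nu]_(x in D) f x by [].
by rewrite /Rintegral; lra.
Qed.

Lemma charge_RintegralE_pn nu D f :
  charge_Rintegral nu D f = \int[fpos nu]_(x in D) f x - \int[fneg nu]_(x in D) f x.
Proof. by []. Qed.

Lemma charge_Rintegral_cadd nu1 nu2 (D : set mR) f (M : R) :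
  measurable D -> measurable_fun D f -> (forall x, D x -> `|f x| <= M) ->
  charge_Rintegral (cadd nu1 nu2) D f =
  charge_Rintegral nu1 D f + charge_Rintegral nu2 D f.
Proof.
move=> mD mf fM.
have fi (m : {finite_measure set mR -> \bar R}) : m.-integrable D (EFin \o f).
  exact: finite_integrable fM.
rewrite (@charge_RintegralE _ (fin_measure_add (fpos nu1) (fpos nu2))
  (fin_measure_add (fneg nu1) (fneg nu2)) _ _ M)//; last first.
  move=> A mA AD; transitivity (nu1 A + nu2 A)%E; first by [].
  apply: etrans (esym (f_equal2 (fun a b => a - b)%E
    (fin_measure_addE (fpos nu1) (fpos nu2) A) (fin_measure_addE (fneg nu1) (fneg nu2) A))).
  rewrite (fpos_fnegE nu1 mA) (fpos_fnegE nu2 mA).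
  by apply: fin_addsube; rewrite fin_num_measure.
have fn m := integrable_fin_num mD (fi m).
rewrite {1 2}/Rintegral (integral_measure_add mD (fi (fpos nu1)) (fi (fpos nu2))).
rewrite (integral_measure_add mD (fi (fneg nu1)) (fi (fneg nu2))).
rewrite (fineD (fn (fpos nu1)) (fn (fpos nu2))) (fineD (fn (fneg nu1)) (fn (fneg nu2))).
by rewrite !charge_RintegralE_pn /Rintegral; lra.
Qed.

Lemma charge_Rintegral_copp nu (D : set mR) f (M : R) :
  measurable D -> measurable_fun D f -> (forall x, D x -> `|f x| <= M) ->
  charge_Rintegral (copp nu) D f = - charge_Rintegral nu D f.
Proof.
move=> mD mf fM.
rewrite (@charge_RintegralE _ (fneg nu) (fpos nu) _ _ M)//.
  by rewrite charge_RintegralE_pn opprB.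
move=> A mA _; transitivity (- nu A)%E; first by [].
rewrite (fpos_fnegE nu mA) fin_num_oppeB ?fin_num_measure//.
by rewrite addeC.
Qed.

(** The inequality |y| <= c y^2 / 2 + 1 / (2 c) passes from L^2 to L^1. With total mass [K] and
    squared L^2 error below [c ^- 2] it leaves (1 + K) / (2 c), which is [e / 2] for the chosen
    [c]. *)
Lemma L1_approx (m : {finite_measure set mR -> \bar R}) f (M e : R) (T0 : 0 < T) :
  measurable_fun [set: mR] f -> (forall x, `|f x| <= M) -> 0 < e ->
  exists2 phi, Ccinfty T phi & \int[m]_(x in I) `|f x - phi x| < e.
Proof.
move=> mf fM e0; have mI := measurable_I0T T.
have f2 : (\int[m]_(x in I) (f x ^+ 2)%:E < +oo)%E.
  have /integrableP[_] : m.-integrable I (EFin \o (fun x => f x ^+ 2)).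
    apply: (finite_integrable m (M := M ^+ 2)) => //.
      by apply: measurable_funTS; exact: measurable_funX.
    by move=> x _; rewrite normrX lerXn2r// nnegrE// (le_trans (normr_ge0 (f x))).
  by under eq_integral do rewrite gee0_abs ?lee_fin ?sqr_ge0//.
pose K := fine (m I); have K0 : 0 <= K by exact: fine_ge0.
pose c := (K + 1) / e; have c0 : 0 < c by rewrite divr_gt0// ltr_wpDl.
have cV0 : 0 < c ^- 2 by rewrite invr_gt0 exprn_gt0.
have [_ /(_ _ cV0)[phi phiC fphi]] := @sqr_integrable_L2approx _ T m f T0 mf f2.
exists phi => //.
have mfp : measurable_fun [set: mR] (fun x => f x - phi x).
  by apply: measurable_funB => //; exact: Ccinfty_measurable phiC.
have [N N0 phiN] := Ccinfty_bounded T0 phiC.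
have fpN x : `|f x - phi x| <= M + N.
  by rewrite (le_trans (ler_normB _ _))// lerD.
have i1 : m.-integrable I (EFin \o (fun x => `|f x - phi x|)).
  apply: (finite_integrable m (M := M + N)) => //.
    by apply: measurable_funTS; exact: (measurableT_comp (@normr_measurable _ setT) mfp).
  by move=> x _; rewrite normr_id.
have i2 : m.-integrable I (EFin \o (fun x => (f x - phi x) ^+ 2)).
  apply: (finite_integrable m (M := (M + N) ^+ 2)) => //.
    by apply: measurable_funTS; exact: measurable_funX.
  by move=> x _; rewrite normrX lerXn2r// nnegrE// (le_trans _ (fpN x)).
have i2c : m.-integrable I (EFin \o (fun x => c / 2 * (f x - phi x) ^+ 2)).
  by have := integrableZl mI (c / 2) i2.
have ic : m.-integrable I (EFin \o (fun=> (c *+ 2)^-1)).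
  by apply: (finite_integrable m (M := `|(c *+ 2)^-1|)).
apply: (@le_lt_trans _ _ (\int[m]_(x in I) (c / 2 * (f x - phi x) ^+ 2 + (c *+ 2)^-1))).
  apply: le_Rintegral => //; first by have := integrableD mI i2c ic.
  move=> x _; rewrite -[in leRHS](real_normK (num_real (f x - phi x))).
  move: (`|f x - phi x|) => y.
  rewrite -subr_ge0 (_ : _ - _ = (c * y - 1) ^+ 2 / (c *+ 2)).
    by rewrite divr_ge0// ?sqr_ge0// mulrn_wge0// ltW.
  by field; rewrite gt_eqF.
rewrite RintegralD// RintegralZl// Rintegral_cst// -/K.
have J : \int[m]_(x in I) (f x - phi x) ^+ 2 < c ^- 2.
  rewrite -lte_fin /Rintegral fineK//; exact: integrable_fin_num.
apply: (@lt_le_trans _ _ (c / 2 * c ^- 2 + (c *+ 2)^-1 * K)).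
  by rewrite ltrD2r ltr_pM2l// divr_gt0.
have -> : c / 2 * c ^- 2 + (c *+ 2)^-1 * K = e / 2.
  by rewrite /c; field; rewrite gt_eqF//= gt_eqF// ltr_wpDl.
lra.
Qed.

Lemma charge_RintegralB nu f g (M N : R) :
  measurable_fun I f -> (forall x, I x -> `|f x| <= M) ->
  measurable_fun I g -> (forall x, I x -> `|g x| <= N) ->
  charge_Rintegral nu I (fun x => f x - g x) =
  charge_Rintegral nu I f - charge_Rintegral nu I g.
Proof.
move=> mf fM mg gN; have mI := measurable_I0T T.
have fi (m : {finite_measure set mR -> \bar R}) : m.-integrable I (EFin \o f).
  exact: finite_integrable mI mf fM.
have gi (m : {finite_measure set mR -> \bar R}) : m.-integrable I (EFin \o g).
  exact: finite_integrable mI mg gN.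
have e m := RintegralB mI (fi m) (gi m).
by rewrite !charge_RintegralE_pn (e (fpos nu)) (e (fneg nu)); lra.
Qed.

(** The total variation measure of [nu]. *)
Definition ftv nu := fin_measure_add (fpos nu) (fneg nu).

Lemma le_norm_charge_Rintegral nu f (M : R) :
  measurable_fun I f -> (forall x, I x -> `|f x| <= M) ->
  `|charge_Rintegral nu I f| <= \int[ftv nu]_(x in I) `|f x|.
Proof.
move=> mf fM; have mI := measurable_I0T T.
have fi (m : {finite_measure set mR -> \bar R}) : m.-integrable I (EFin \o f).
  exact: finite_integrable mI mf fM.
have nfi (m : {finite_measure set mR -> \bar R}) := integrable_norm (fi m).
rewrite charge_RintegralE_pn (le_trans (ler_normB _ _))//.
have -> : \int[ftv nu]_(x in I) `|f x| =
    \int[fpos nu]_(x in I) `|f x| + \int[fneg nu]_(x in I) `|f x|.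
  rewrite {1}/Rintegral (integral_measure_add mI (nfi (fpos nu)) (nfi (fneg nu))).
  by rewrite fineD//; apply: integrable_fin_num => //; exact: nfi.
by apply: lerD; apply: le_normr_Rintegral => //; exact: fi.
Qed.

Lemma le_Rintegral_measure (m1 m2 : {finite_measure set mR -> \bar R}) f (M : R) :
  measurable_fun I f -> (forall x, I x -> `|f x| <= M) ->
  \int[m1]_(x in I) `|f x| <= \int[fin_measure_add m1 m2]_(x in I) `|f x|
  /\ \int[m2]_(x in I) `|f x| <= \int[fin_measure_add m1 m2]_(x in I) `|f x|.
Proof.
move=> mf fM; have mI := measurable_I0T T.
have fi (m : {finite_measure set mR -> \bar R}) : m.-integrable I (EFin \o f).
  exact: finite_integrable mI mf fM.
have nfi (m : {finite_measure set mR -> \bar R}) := integrable_norm (fi m).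
have -> : \int[fin_measure_add m1 m2]_(x in I) `|f x| =
    \int[m1]_(x in I) `|f x| + \int[m2]_(x in I) `|f x|.
  rewrite {1}/Rintegral (integral_measure_add mI (nfi m1) (nfi m2)).
  by rewrite fineD//; apply: integrable_fin_num => //; exact: nfi.
by rewrite lerDl lerDr !Rintegral_ge0.
Qed.

(** One test function close to [f] in L^1 of the sum of the three variations serves all three
    charges; [C] collects the coefficients. With [a = 1] and [b = 0] this becomes uniqueness of the
    distributional derivative. *)
Lemma charge_Rintegral_ext nu nu1 nu2 (a b : R) f (M : R) (T0 : 0 < T) :
  (forall phi, Ccinfty T phi -> charge_Rintegral nu I phi =
    a * charge_Rintegral nu1 I phi + b * charge_Rintegral nu2 I phi) ->
  measurable_fun [set: mR] f -> (forall x, `|f x| <= M) ->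
  charge_Rintegral nu I f =
    a * charge_Rintegral nu1 I f + b * charge_Rintegral nu2 I f.
Proof.
move=> H mf fM; apply/eqP; rewrite -subr_eq0 -normr_le0.
pose m := fin_measure_add (fin_measure_add (ftv nu) (ftv nu1)) (ftv nu2).
pose C := 1 + `|a| + `|b|.
have C0 : 0 < C by rewrite /C -addrA ltr_pwDl// addr_ge0.
apply/ler_addgt0Pl => e e0; rewrite addr0.
have eC : 0 < e / C by rewrite divr_gt0.
have [phi phiC fphi] := L1_approx m T0 mf fM eC.
have [N N0 phiN] := Ccinfty_bounded T0 phiC.
have mphi := Ccinfty_measurable (D := I) phiC.
have mfI : measurable_fun I f by exact: measurable_funTS.
have mfp : measurable_fun I (fun x => f x - phi x) by exact: measurable_funB.
have fpMN x : I x -> `|f x - phi x| <= M + N.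
  by move=> _; rewrite (le_trans (ler_normB _ _))// lerD.
have B nu' := charge_RintegralB nu' mfI (fun x _ => fM x) mphi (fun x _ => phiN x).
have [h1 h2] := le_Rintegral_measure (fin_measure_add (ftv nu) (ftv nu1)) (ftv nu2) mfp fpMN.
have [h3 h4] := le_Rintegral_measure (ftv nu) (ftv nu1) mfp fpMN.
have L nu' := le_norm_charge_Rintegral nu' mfp fpMN.
have -> : charge_Rintegral nu I f -
    (a * charge_Rintegral nu1 I f + b * charge_Rintegral nu2 I f) =
    charge_Rintegral nu I (fun x => f x - phi x) -
    (a * charge_Rintegral nu1 I (fun x => f x - phi x) +
     b * charge_Rintegral nu2 I (fun x => f x - phi x)).
  by rewrite !B (H _ phiC); ring.
apply: le_trans (ler_normB _ _) _.
apply: (@le_trans _ _ (\int[m]_(x in I) `|f x - phi x| * C)); last first.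
  by rewrite -ler_pdivlMr// ltW.
have -> (y : R) : y * C = y + (`|a| * y + `|b| * y) by rewrite /C; ring.
apply: lerD.
  exact: le_trans (L nu) (le_trans h3 h1).
apply: le_trans (ler_normD _ _) _; rewrite !normrM.
apply: lerD; apply: ler_wpM2l => //.
  exact: le_trans (L nu1) (le_trans h4 h1).
exact: le_trans (L nu2) h2.
Qed.

Lemma normCP f (M : R) : (normC T f <= M%:E)%E <-> forall x, I x -> `|f x| <= M.
Proof.
split=> [fM x xI|fM]; last by apply: ge_ereal_sup => _ [x xI <-]; rewrite lee_fin fM.
by rewrite -lee_fin (le_trans _ fM)//; apply: ereal_sup_ubound; exists x.
Qed.

Lemma C0_measurable f : C0 T f -> measurable_fun (I : set mR) f.
Proof.
case=> fc _ _; apply: open_continuous_measurable_fun; first exact: interval_open.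
by move=> x /fc.
Qed.

Lemma continuous_C0 f : continuous f -> f 0 = 0 -> f T = 0 -> C0 T f.
Proof.
move=> fc f0 fT; split; first by move=> x _; exact: fc.
- by rewrite -[X in _ --> X]f0; apply: cvg_at_right_filter; exact: fc.
- by rewrite -[X in _ --> X]fT; apply: cvg_at_left_filter; exact: fc.
Qed.

Definition clip (y : R) : R := Num.min 1 (Num.max (-1) y).

Lemma clip_continuous : continuous clip.
Proof.
move=> x; apply: (@continuous_min _ _ (fun=> 1)); first exact: cvg_cst.
apply: (@continuous_max _ _ (fun=> -1)); first exact: cvg_cst.
exact: cvg_id.
Qed.

Lemma clip0 : clip 0 = 0.
Proof. by rewrite /clip max_r ?min_r// ltW. Qed.

Lemma norm_clip_le1 y : `|clip y| <= 1.
Proof. by rewrite ler_norml /clip le_min ge_min lexx/= le_max lexx/=; lra. Qed.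

Lemma dist_clip_le s y : `|s| <= 1 -> `|s - clip y| <= `|s - y|.
Proof.
rewrite ler_norml /clip => /andP[s1 s2].
have [y1|y1] := leP y (-1).
  rewrite min_r; last lra.
  rewrite !ger0_norm; lra.
have [y2|y2] := leP 1 y; last by [].
rewrite !ler0_norm; lra.
Qed.

(** One inequality is the bound of a pairing by the variation. For the other, a Hahn decomposition
    provides a sign function whose pairing with [nu] is the full variation. It follows that the norm
    is finite and controls the pairing with any bounded measurable function. *)
Lemma normM_ftv nu (T0 : 0 < T) : normM T nu = ftv nu I.
Proof.
have mI := measurable_I0T T.
have fin : ftv nu I \is a fin_num by exact: fin_num_measure.
apply/eqP; rewrite eq_le; apply/andP; split.
  apply: ge_ereal_sup => _ [phi [phiC /normCP phi1] <-].
  rewrite -(fineK fin) lee_fin.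
  apply: le_trans (ler_norm _) _.
  apply: le_trans (le_norm_charge_Rintegral nu (C0_measurable phiC) phi1) _.
  rewrite -[leRHS]mul1r -(Rintegral_cst _ mI).
  have mphi := C0_measurable phiC.
  apply: le_Rintegral => //.
  - by apply: integrable_norm; exact: finite_integrable mI mphi phi1.
  - by apply: (finite_integrable _ (M := 1)) => // x _; rewrite normr1.
pose PN := projT1 (cid (hahn_exists nu)).
have H : hahn_decomposition nu PN.1 PN.2 by exact: projT2 (cid (hahn_exists nu)).
have [[mP P0] [mN N0] PNT PN0] := H.
have posE A : measurable A -> fpos nu A = nu (A `&` PN.1).
  move=> mA; rewrite -[LHS]/(jordan_pos (projT2 (cid (hahn_exists nu))) A).
  by rewrite jordan_posE cjordan_posE /crestr0 mem_set.
have negE A : measurable A -> fneg nu A = (- nu (A `&` PN.2))%E.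
  move=> mA; rewrite -[LHS]/(jordan_neg (projT2 (cid (hahn_exists nu))) A).
  by rewrite jordan_negE cjordan_negE /crestr0 mem_set.
have mIP := measurableI _ _ mP mI; have mIN := measurableI _ _ mN mI.
have posP : fpos nu (PN.1 `&` I) = fpos nu I.
  by rewrite !posE// setIC setIA setIid setIC.
have posN : fpos nu (PN.2 `&` I) = 0%E.
  by rewrite posE// setIC setIA PN0 set0I charge0.
have negP : fneg nu (PN.1 `&` I) = 0%E.
  by rewrite negE// setIC setIA (setIC PN.2) PN0 set0I charge0 oppe0.
have negN : fneg nu (PN.2 `&` I) = fneg nu I.
  by rewrite !negE// setIC setIA setIid setIC.
(* The sign of nu, approximated in L^1(|nu|) by test functions clipped to [-1, 1]. *)
pose s x : R := \1_(PN.1) x - \1_(PN.2) x.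
have ms : measurable_fun [set: mR] s by apply: measurable_funB; exact: measurable_indic.
have s1 x : `|s x| <= 1.
  rewrite /s !indicE; case: (_ \in _); case: (_ \in _);
    by rewrite ?subrr ?subr0 ?sub0r ?normrN ?normr1 ?normr0.
have snu : charge_Rintegral nu I s = fine (ftv nu I).
  rewrite charge_RintegralE_pn.
  have ind (m : {finite_measure set mR -> \bar R}) (A : set mR) : measurable A ->
      \int[m]_(x in I) (\1_A x : R) = fine (m (A `&` I)).
    by move=> mA; rewrite /Rintegral integral_indic.
  have iind (m : {finite_measure set mR -> \bar R}) (A : set mR) : measurable A ->
      m.-integrable I (EFin \o (\1_A : R -> R)).
    move=> mA; apply: (finite_integrable _ (M := 1)) => //.
    by move=> x _; rewrite indicE; case: (_ \in _); rewrite ?normr1 ?normr0.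
  have RB (m : {finite_measure set mR -> \bar R}) := RintegralB mI (iind m _ mP) (iind m _ mN).
  rewrite (RB (fpos nu)) (RB (fneg nu)) !ind// posP posN negP negN/= subr0 sub0r opprK.
  rewrite -fineD ?fin_num_measure//; congr fine; exact: esym (fin_measure_addE _ _ _).
apply/lee_addgt0Pr => e e0.
have [phi phiC sphi] := L1_approx (ftv nu) T0 ms s1 e0.
(* Clipping costs smoothness, which [C0] does not ask for; the zero values at the endpoints are kept
   because [clip 0 = 0]. *)
pose psi x := clip (phi x).
have psic : continuous psi.
  move=> x; apply: (@continuous_comp _ _ _ phi clip x).
    exact: (@Ccinfty_continuous _ _ _ phiC x).
  exact: (@clip_continuous (phi x)).
have phi0 (x : R) : ~ I x -> phi x = 0 by exact: Ccinfty_out.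
have psiC : C0 T psi.
  by apply: continuous_C0 => //; rewrite /psi phi0 ?clip0// /I0T/= in_itv/= ltxx ?andbF.
have psi1 x : I x -> `|psi x| <= 1 by move=> _; exact: norm_clip_le1.
apply: (@le_trans _ _ ((charge_Rintegral nu I psi)%:E + e%:E)%E); last first.
  by rewrite leeD2r//; apply: ereal_sup_ubound; exists psi => //; split => //; exact/normCP.
rewrite -(fineK fin) -snu -EFinD lee_fin -lerBlDl.
have msI : measurable_fun I s by exact: measurable_funTS.
rewrite -(charge_RintegralB nu msI (fun x _ => s1 x) (C0_measurable psiC) psi1).
apply: le_trans (ler_norm _) _.
have mspsi : measurable_fun I (fun x => s x - psi x).
  by apply: measurable_funB => //; exact: C0_measurable.
have spsi2 x : I x -> `|s x - psi x| <= 1 + 1.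
  by move=> xI; rewrite (le_trans (ler_normB _ _))// lerD// psi1.
apply: le_trans (le_norm_charge_Rintegral nu mspsi spsi2) _.
apply: le_trans (ltW sphi).
have mphi : measurable_fun I phi by exact: Ccinfty_measurable phiC.
have [M M0 phiM] := Ccinfty_bounded T0 phiC.
apply: le_Rintegral => //.
- by apply: integrable_norm; exact: finite_integrable mI mspsi spsi2.
- apply: integrable_norm; apply: (finite_integrable _ (M := 1 + M)) => //.
    exact: measurable_funB.
  by move=> x _; rewrite (le_trans (ler_normB _ _))// lerD.
- by move=> x _; exact: dist_clip_le.
Qed.

End charges.

(** * One-sided differential inequalities *)

Section one_sided_differential.
Context {R : realType} {V : normedModType R}.
Variables (f : V -> R) (u : V).
Hypothesis df : differentiable f u.

Lemma differential_at_right (h : V) :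
  t^-1 * (f (u + t *: h) - f u) @[t --> 0^'+] --> 'd f u h.
Proof.
rewrite -deriveE//; apply: cvg_dnbhs_at_right.
have /cvg_ex[l hl] := diff_derivable (v := h) df.
rewrite /derive (cvg_lim _ hl)//.
rewrite [X in fmap X](_ : _ = fun t => t^-1 *: ((f \o shift u) (t *: h) - f u))//.
by apply/funext => t /=; rewrite [u + _]addrC.
Qed.

Lemma differential_ge (h : V) (C : R) :
  (forall t : R, 0 < t < 1 -> f u + t * C <= f (u + t *: h)) -> C <= 'd f u h.
Proof.
move=> H; apply: (cvgr_to_ge (differential_at_right (h := h))); near=> t.
have t0 : 0 < t by near: t; exact: nbhs_right_gt.
by rewrite ler_pdivlMl// lerBrDl H// t0/=; near: t; exact: nbhs_right_lt.
Unshelve. all: by end_near. Qed.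

Lemma differential_le (h : V) (C : R) :
  (forall t : R, 0 < t < 1 -> f (u + t *: h) <= f u + t * C) -> 'd f u h <= C.
Proof.
move=> H; apply: (cvgr_to_le (differential_at_right (h := h))); near=> t.
have t0 : 0 < t by near: t; exact: nbhs_right_gt.
by rewrite ler_pdivrMl// lerBlDl H// t0/=; near: t; exact: nbhs_right_lt.
Unshelve. all: by end_near. Qed.

(** Convexity bounds the difference quotient in the direction [v - u] by [f v - f u] for every [t]
    in ]0, 1[, and the bound survives the limit. *)
Lemma convex_differential_le (v : V) :
  convex_function (E := V) [set: convex_lmodType V] f ->
  f u + 'd f u (v - u) <= f v.
Proof.
move=> fc; rewrite -lerBrDl; apply: differential_le => t /andP[t0 t1].
have /= := fc (Itv01 (ltW t0) (ltW t1)) v u; rewrite !inE => /(_ Logic.I Logic.I).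
rewrite [X in f X <= _ -> _](_ : _ = u + t *: (v - u)); last first.
  rewrite -[LHS]/(t *: v + (1 - t) *: u).
  by rewrite scalerBl scale1r scalerBr addrCA.
move=> /le_trans; apply.
rewrite -[leLHS]/(t * f v + (1 - t) * f u).
by rewrite mulrBl mul1r mulrBr addrCA.
Qed.

End one_sided_differential.

(** * Supports and distributional derivatives *)

Section supports.
Context {R : realType}.
Variable T : R.
Local Notation mR := (measurableTypeR R).
Local Notation mu := (leb0T T).
Local Notation I := (I0T T).
Implicit Types (f g : R -> R) (nu : {charge set mR -> \bar R}).
Lemma le_charge_Rintegral_normM nu f (M : R) (T0 : 0 < T) :
  measurable_fun I f -> (forall x, I x -> `|f x| <= M) ->
  charge_Rintegral nu I f <= M * fine (normM T nu).
Proof.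
move=> mf fM; have mI := measurable_I0T T.
apply: le_trans (ler_norm _) _; rewrite normM_ftv//.
apply: le_trans (le_norm_charge_Rintegral nu mf fM) _.
rewrite -(Rintegral_cst _ mI); apply: le_Rintegral => //.
- by apply: integrable_norm; exact: finite_integrable mI mf fM.
- by apply: (finite_integrable _ (M := `|M|)).
Qed.

Lemma normM_fin_num nu (T0 : 0 < T) : normM T nu \is a fin_num.
Proof. by rewrite normM_ftv//; apply: fin_num_measure; exact: measurable_I0T. Qed.

(** If [f x > 0], the open set where [f] exceeds [f x / 2] contains [x], and Markov's inequality
    makes it null within ]0, T[, contrary to [x] being in the support. *)
Lemma supp0T_sub_zeros (m : {finite_measure set mR -> \bar R}) f (M : R) :
  continuous f -> (forall x, I x -> 0 <= f x <= M) -> \int[m]_(x in I) f x = 0 ->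
  supp0T T m `<=` [set x | I x /\ f x = 0].
Proof.
move=> fc f0 intf x [xI xsupp]; split => //.
have mI := measurable_I0T T.
have [f_ge0 _] := andP (f0 x xI).
apply/eqP/negPn/negP => fx0.
have fx : 0 < f x by rewrite lt_neqAle eq_sym fx0.
pose U := [set y | f x / 2 < f y].
have oU : open U.
  have : open (f @^-1` [set y | f x / 2 < y]) by apply: open_comp => //; exact: open_gt.
  exact.
have mU : measurable (U : set mR) by exact: open_measurable.
have := xsupp U oU; rewrite /U/= => /(_ _)/eqP; apply; first lra.
have mf : measurable_fun I f by apply: measurable_funTS; exact: continuous_measurable_fun.
have fM y : I y -> `|f y| <= M by move=> yI; have /andP[h1 h2] := f0 y yI; rewrite ger0_norm.
have fi := finite_integrable m mI mf fM.
have : \int[m]_(y in I) (f x / 2 * \1_U y) <= 0.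
  rewrite -intf; apply: le_Rintegral => //.
  - apply: (finite_integrable _ (M := f x / 2)) => //.
      by apply: measurable_funM => //; exact: measurable_indic.
    move=> y _; rewrite normrM indicE ger0_norm ?divr_ge0//.
    by rewrite ler_piMr ?divr_ge0//; case: (_ \in _); rewrite ?normr1 ?normr0.
  - move=> y yI; rewrite indicE; have [/set_mem yU|_] := boolP (y \in U).
      by rewrite mulr1 ltW.
    by rewrite mulr0; have /andP[] := f0 y yI.
rewrite RintegralZl//; last first.
  apply: (finite_integrable _ (M := 1)) => //.
  by move=> y _; rewrite indicE; case: (_ \in _); rewrite ?normr1 ?normr0.
rewrite pmulr_rle0 ?divr_gt0// /Rintegral integral_indic// => mU0.
apply/eqP; rewrite eq_le measure_ge0 andbT.
by rewrite -lee_fin fineK// in mU0; apply: fin_num_measure; exact: measurableI.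
Qed.

Lemma rat_itv_open (U : set R) (x : R) : open U -> U x ->
  exists q r : rat, `]ratr q, ratr r[%classic x /\ (`]ratr q, ratr r[ `<=` U).
Proof.
move=> oU Ux; have /nbhs_ballP[e /= e0 eU] : nbhs x U by exact: open_nbhs_nbhs.
have /rat_in_itvoo[q] : x - e < x by rewrite gtrDl oppr_lt0.
have /rat_in_itvoo[r] : x < x + e by rewrite ltrDl.
rewrite !in_itv/= => /andP[xr re] /andP[eq qx].
exists q, r; split; first by rewrite /= in_itv/= qx xr.
move=> y /=; rewrite in_itv/= => /andP[qy yr]; apply: eU.
by rewrite /ball/= ltr_distlC; apply/andP; split; lra.
Qed.

(** Every point of ]0, T[ where [f] is nonzero lies off the support, hence in a rational interval
    that is null for [m]; there are only countably many of these. *)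
Lemma supp0T_Rintegral_eq0 (m : {finite_measure set mR -> \bar R}) f :
  continuous f -> supp0T T m `<=` [set x | I x /\ f x = 0] ->
  \int[m]_(x in I) f x = 0.
Proof.
move=> fc msupp; have mI := measurable_I0T T.
(* Intervals of positive measure are replaced by the empty set, so that the union over all codes
   stays negligible. *)
pose G (qr : rat * rat) : set mR := if m ([set` `]ratr qr.1, ratr qr.2[%R] `&` I) == 0%E then
     [set` `]ratr qr.1 : R, ratr qr.2[%R] `&` I else set0.
pose F (k : nat) : set mR := if @unpickle (rat * rat)%type k is Some qr then G qr else set0.
have GF qr : G qr `<=` \bigcup_k F k.
  by move=> y Gy; exists (pickle qr); [exact: Logic.I|rewrite /F pickleK].
have F0 k : m.-negligible (F k).
  rewrite /F; case: unpickle => [qr|]; last exact: negligible_set0.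
  rewrite /G; case: ifPn => [/eqP m0|_]; last exact: negligible_set0.
  exists ([set` `]ratr qr.1 : R, ratr qr.2[%R] `&` I); split => //.
  by apply: measurableI => //; exact: measurable_itv.
rewrite /Rintegral (@ae_eq_integral _ _ _ m I (cst 0%E)) ?integral0//.
- apply/measurable_EFinP/measurable_funTS; exact: continuous_measurable_fun.
- apply: negligibleS (negligible_bigcup F0) => x /= /not_implyP[xI fx].
  have : ~ supp0T T m x by move=> /msupp[_ fx0]; apply: fx; rewrite fx0.
  move=> /not_andP[//|] /existsNP[U] /not_implyP[oU] /not_implyP[Ux] /negP/negPn/eqP mU.
  have [q [r [xqr qrU]]] := rat_itv_open oU Ux.
  apply: (GF (q, r)); rewrite /G/=.
  have mqr : measurable ([set` `]ratr q : R, ratr r[%R] `&` I : set mR).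
    by apply: measurableI => //; exact: measurable_itv.
  rewrite ifT//; apply/eqP/eqP; rewrite eq_le measure_ge0 andbT -mU.
  apply: le_measure; rewrite ?inE//.
    by apply: measurableI => //; exact: open_measurable.
  exact: setSI.
Qed.

(** The bound on [p] makes both integrands on the right nonnegative. Extremality of the pairing
    therefore splits into two vanishing integrals, one for each Jordan part, which is a condition on
    the two supports. *)
Lemma charge_Rintegral_defect nu p (M : R) (T0 : 0 < T) : continuous p ->
  (forall x, I x -> `|p x| <= M) ->
  M * fine (normM T nu) - charge_Rintegral nu I p =
  \int[fpos nu]_(x in I) (M - p x) + \int[fneg nu]_(x in I) (M + p x).
Proof.
move=> pc pM; have mI := measurable_I0T T.
have mp : measurable_fun I p by apply: measurable_funTS; exact: continuous_measurable_fun.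
have ip (m : {finite_measure set mR -> \bar R}) := finite_integrable m mI mp pM.
have ic (m : {finite_measure set mR -> \bar R}) : m.-integrable I (EFin \o (fun=> M)).
  by apply: (finite_integrable _ (M := `|M|)).
rewrite (RintegralB mI (ic (fpos nu)) (ip (fpos nu))).
rewrite (RintegralD mI (ic (fneg nu)) (ip (fneg nu))).
rewrite !Rintegral_cst// normM_ftv// charge_RintegralE_pn.
have -> : fine (ftv nu I) = fine (fpos nu I) + fine (fneg nu I).
  rewrite -fineD ?fin_num_measure//; congr fine; exact: fin_measure_addE.
by ring.
Qed.

Lemma charge_extremal_supp nu p (M : R) (T0 : 0 < T) : continuous p ->
  (forall x, I x -> `|p x| <= M) ->
  charge_Rintegral nu I p = M * fine (normM T nu) ->
  supp0T T (jpos nu) `<=` [set x | I x /\ p x = M] /\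
  supp0T T (jneg nu) `<=` [set x | I x /\ p x = - M].
Proof.
move=> pc pM /esym/eqP; rewrite -subr_eq0 charge_Rintegral_defect//.
have b x : I x -> - M <= p x <= M by move=> /pM; rewrite ler_norml.
rewrite paddr_eq0; [|by apply: Rintegral_ge0 => x /b; lra..].
move=> /andP[/eqP pos0 /eqP neg0].
have cm : continuous (fun x => M - p x) by move=> x; apply: cvgB; [exact: cvg_cst|exact: pc].
have cp : continuous (fun x => M + p x) by move=> x; apply: cvgD; [exact: cvg_cst|exact: pc].
have bm x : I x -> 0 <= M - p x <= M + M by move=> /b; lra.
have bp x : I x -> 0 <= M + p x <= M + M by move=> /b; lra.
split=> x /= xs.
  have [xI /eqP] := supp0T_sub_zeros (m := fpos nu) cm bm pos0 xs.
  by rewrite subr_eq0 => /eqP h; split => //; rewrite h.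
have [xI /eqP] := supp0T_sub_zeros (m := fneg nu) cp bp neg0 xs.
by rewrite addrC addr_eq0 => /eqP h; split => //; rewrite h.
Qed.

Lemma charge_supp_extremal nu p (M : R) (T0 : 0 < T) : continuous p ->
  (forall x, I x -> `|p x| <= M) ->
  supp0T T (jpos nu) `<=` [set x | I x /\ p x = M] ->
  supp0T T (jneg nu) `<=` [set x | I x /\ p x = - M] ->
  charge_Rintegral nu I p = M * fine (normM T nu).
Proof.
move=> pc pM sp sn; apply/esym/eqP; rewrite -subr_eq0 charge_Rintegral_defect//.
have cm : continuous (fun x => M - p x) by move=> x; apply: cvgB; [exact: cvg_cst|exact: pc].
have cp : continuous (fun x => M + p x) by move=> x; apply: cvgD; [exact: cvg_cst|exact: pc].
rewrite (supp0T_Rintegral_eq0 (m := fpos nu) cm) ?(supp0T_Rintegral_eq0 (m := fneg nu) cp) ?addr0//.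
  by move=> x xs /=; have [xI ->] := sn x xs; split => //; rewrite subrr.
by move=> x xs /=; have [xI ->] := sp x xs; split => //; rewrite subrr.
Qed.
#[local] Existing Instance leb0T_ae_filter.

(** * Charges with a density, point masses, and the calculus of distributional derivatives *)

Lemma dens_dominates (w : L1 T) : dens w `<< mu.
Proof.
apply/null_content_dominatesP => A mA A0.
rewrite /dens/= /induced_charge; apply: null_set_integral => //.
by apply: measurable_funTS; exact: measurable_int (Lspace1_integrable w).
Qed.

Lemma Rintegral_density (m : {finite_measure set mR -> \bar R}) : m `<< mu ->
  exists2 r : R -> R, mu.-integrable setT (EFin \o r) &
    (forall A, measurable A -> m A = \int[mu]_(x in A) (r x)%:E)%E /\
    forall f (M : R), measurable_fun [set: mR] f -> (forall x, `|f x| <= M) ->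
      \int[m]_(x in I) f x = \int[mu]_x (f x * r x).
Proof.
move=> mmu; have mI := measurable_I0T T.
pose rn := Radon_Nikodym (charge_of_finite_measure m) (fleb0T T).
have rnf x : rn x = (fine (rn x))%:E.
  by rewrite fineK//; exact: Radon_Nikodym_fin_num.
have irn : mu.-integrable setT (EFin \o (fine \o rn)).
  have : (fleb0T T).-integrable setT rn by exact: Radon_Nikodym_integrable.
  by rewrite (_ : rn = EFin \o (fine \o rn))//; apply/funext => x; rewrite {1}rnf.
exists (fine \o rn) => //; split.
  move=> A mA.
  have RNi := @Radon_Nikodym_integral _ _ _ (charge_of_finite_measure m) (fleb0T T) A mmu mA.
  apply: etrans RNi _; apply: eq_integral => x _; exact: rnf.
move=> f M mf fM.
have mfI : measurable_fun I f by exact: measurable_funTS.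
have fi := finite_integrable m mI mfI (fun x _ => fM x).
have ifr := integrable_mul_bounded mf fM irn.
rewrite Rintegral_I0T; last exact: integrable_measurable ifr.
congr fine; rewrite -(Radon_Nikodym_change_of_variables (mu := fleb0T T) mmu mI fi).
by apply: eq_integral => x _; rewrite /= EFinM -rnf.
Qed.

(** The Jordan parts of [dens w] rest on a chosen Hahn decomposition and are not literally the parts
    of [w]. Both are dominated by [mu], and the difference of their Radon-Nikodym densities
    integrates like [w] over every measurable set, so it equals [w] almost everywhere. *)
Lemma charge_Rintegral_dens (w : L1 T) f (M : R) : measurable_fun [set: mR] f ->
  (forall x, `|f x| <= M) ->
  charge_Rintegral (dens w) I f = \int[mu]_x (w x * f x).
Proof.
move=> mf fM; have mI := measurable_I0T T.
have dw := dens_dominates w; have iw := Lspace1_integrable w.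
have [rp irp [rpE rpf]] := @Rintegral_density (fpos (dens w)) (jordan_pos_dominates _ dw).
have [rn irn [rnE rnf]] := @Rintegral_density (fneg (dens w)) (jordan_neg_dominates _ dw).
rewrite charge_RintegralE_pn (rpf f M)// (rnf f M)//.
have ip := integrable_mul_bounded mf fM irp.
have ineg := integrable_mul_bounded mf fM irn.
rewrite -RintegralB//.
have mw := integrable_measurable iw.
have mp := integrable_measurable irp; have mn := integrable_measurable irn.
apply: eq_Rintegral_ae.
- by apply: measurable_funB; apply: measurable_funM.
- exact: measurable_funM.
have irpn : mu.-integrable setT (EFin \o (fun x => rp x - rn x)).
  by have := integrableB measurableT irp irn.
have : ae_eq mu setT (EFin \o w) (EFin \o (fun x => rp x - rn x)).
  apply: integral_ae_eq => //; first exact: measurable_int irpn.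
  move=> E _ mE.
  transitivity (dens w E); first by [].
  rewrite fpos_fnegE// rpE// rnE//; apply: esym.
  exact: (integralB mE (integrableS measurableT mE (@subsetT _ _) irp)
    (integrableS measurableT mE (@subsetT _ _) irn)).
by apply: filterS => x /(_ Logic.I) [->]; rewrite /=; ring.
Qed.

Lemma Rintegral_mscale (k : {nonneg R}) (m : {finite_measure set mR -> \bar R})
    (D : set mR) f : measurable D -> m.-integrable D (EFin \o f) ->
  \int[mscale k m]_(x in D) f x = k%:num * \int[m]_(x in D) f x.
Proof.
move=> mD fi; have mf := measurable_int _ fi.
rewrite /Rintegral integralE [in RHS]integralE.
rewrite !ge0_integral_mscale//; [|exact: measurable_funeneg|exact: measurable_funepos].
have p := integrable_fin_num mD (integrable_funepos mD fi).
have n := integrable_fin_num mD (integrable_funeneg mD fi).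
rewrite -(fineK p) -(fineK n) -!EFinM -!EFinB/=; ring.
Qed.

Lemma charge_Rintegral_cscale (c : R) nu (D : set mR) f (M : R) :
  measurable D -> measurable_fun D f -> (forall x, D x -> `|f x| <= M) ->
  charge_Rintegral (cscale c nu) D f = c * charge_Rintegral nu D f.
Proof.
move=> mD mf fM.
have fi (m : {finite_measure set mR -> \bar R}) := finite_integrable m mD mf fM.
rewrite [charge_Rintegral nu D f]charge_RintegralE_pn; have [c0|c0] := leP 0 c.
  rewrite (@charge_RintegralE _ _ (mscale (NngNum c0) (fpos nu))
    (mscale (NngNum c0) (fneg nu)) _ _ M)//.
    rewrite !Rintegral_mscale//=; [ring|exact: fi..].
  move=> A mA _; transitivity (c%:E * nu A)%E; first by [].
  rewrite fpos_fnegE// muleBr// ?fin_num_adde_defr// fin_num_measure//.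
(* A negative factor exchanges the two Jordan parts. *)
have c1 : 0 <= - c by rewrite oppr_ge0 ltW.
rewrite (@charge_RintegralE _ _ (mscale (NngNum c1) (fneg nu))
  (mscale (NngNum c1) (fpos nu)) _ _ M)//.
  rewrite !Rintegral_mscale//=; [ring|exact: fi..].
move=> A mA _; transitivity (c%:E * nu A)%E; first by [].
rewrite fpos_fnegE//.
transitivity ((- c)%:E * fneg nu A - (- c)%:E * fpos nu A)%E; last by [].
rewrite -(fineK (fin_num_measure (fpos nu) _ mA)) -(fineK (fin_num_measure (fneg nu) _ mA)).
rewrite -!EFinM -!EFinB; congr EFin; ring.
Qed.

Definition delta (x : R) : {charge set mR -> \bar R} :=
  charge_of_finite_measure (@dirac _ mR x R).

Lemma charge_Rintegral_delta (x : R) f (M : R) : I x -> measurable_fun I f ->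
  (forall y, I y -> `|f y| <= M) -> charge_Rintegral (delta x) I f = f x.
Proof.
move=> xI mf fM; have mI := measurable_I0T T.
(* The zero measure is taken as 0 times the Dirac mass, which comes with a finite-measure
   structure. *)
rewrite (@charge_RintegralE _ _ (@dirac _ mR x R)
    (mscale (NngNum (lexx 0)) (@dirac _ mR x R)) _ _ M)//.
  rewrite Rintegral_mscale//=; last exact: finite_integrable mI mf fM.
  rewrite mul0r subr0 /Rintegral integral_dirac//; last exact/measurable_EFinP.
  by rewrite diracE mem_set// mul1e.
move=> A mA _; transitivity (@dirac _ mR x R A - 0%:E * @dirac _ mR x R A)%E; last by [].
by rewrite mul0e sube0.
Qed.

Lemma delta_M0T x : I x -> M0T T (delta x).
Proof.
move=> xI A mA; rewrite /delta /= /charge_of_finite_measure/= !diracE in_setI.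
by rewrite (mem_set xI) andbT.
Qed.

Lemma dens_M0T (w : L1 T) : M0T T (dens w).
Proof.
move=> A mA; have mI := measurable_I0T T.
apply: etrans (negligible_integral (measurableC mI) mA
  (integrableS measurableT mA (@subsetT _ _) (Lspace1_integrable w)) (leb0TCI T)) _.
by rewrite setDE setCK.
Qed.

Lemma cadd_M0T nu1 nu2 : M0T T nu1 -> M0T T nu2 -> M0T T (cadd nu1 nu2).
Proof.
move=> h1 h2 A mA; transitivity (nu1 A + nu2 A)%E; first by [].
by rewrite h1// h2.
Qed.

Lemma cscale_M0T c nu : M0T T nu -> M0T T (cscale c nu).
Proof.
by move=> h A mA; transitivity (c%:E * nu A)%E; [by []|rewrite h].
Qed.

Lemma DmeasP u : BV T u -> M0T T (Dmeas T u) /\ is_distr_deriv T u (Dmeas T u).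
Proof.
by move=> [_ h]; rewrite /Dmeas; case: pselect => // h'; exact: projT2 (cid h').
Qed.

Lemma BV_measurable u : BV T u -> measurable_fun [set: mR] u.
Proof. by move=> [/Lfun1_integrable/integrable_measurable]. Qed.

Lemma Lfun_exists_Lspace (p : \bar R) (p1 : (1 <= p)%E) u : u \in Lfun mu p ->
  exists w : LspaceType mu p1, \forall x \ae mu, w x = u x.
Proof.
move=> up; exists (Lclass (Lfun_Sub p1 up)).
by apply: filterS (LclassE (Lfun_Sub p1 up)) => x /(_ Logic.I).
Qed.

(** Since [Dmeas] is picked by choice, its integrals are computed by comparison with an explicit
    charge. The two agree on test functions, and [charge_Rintegral_ext] carries this over to bounded
    measurable functions. *)
Lemma charge_Rintegral_Dmeas u nu (T0 : 0 < T) : u \in Lfun mu 1 -> M0T T nu ->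
  is_distr_deriv T u nu -> BV T u /\
  forall f (M : R), measurable_fun [set: mR] f -> (forall x, `|f x| <= M) ->
    charge_Rintegral (Dmeas T u) I f = charge_Rintegral nu I f.
Proof.
move=> u1 nuM nuD; have ub : BV T u by split => //; exists nu.
split => // f M mf fM; have [_ uD] := DmeasP ub.
rewrite (@charge_Rintegral_ext _ _ (Dmeas T u) nu nu 1 0 f M T0)//.
  by rewrite mul1r mul0r addr0.
move=> phi phiC; rewrite mul1r mul0r addr0.
by apply: oppr_inj; rewrite -uD// -nuD.
Qed.

(** Sums of classes are known only almost everywhere, and the integrals that define a distributional
    derivative do not see the difference. The comparison charge is the same combination of the two
    derivatives. *)
Lemma Dmeas_lin u v h (a b : R) (T0 : 0 < T) : BV T u -> BV T h ->
  v \in Lfun mu 1 -> (\forall x \ae mu, v x = a * u x + b * h x) ->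
  BV T v /\ forall f (M : R), measurable_fun [set: mR] f -> (forall x, `|f x| <= M) ->
    charge_Rintegral (Dmeas T v) I f =
    a * charge_Rintegral (Dmeas T u) I f + b * charge_Rintegral (Dmeas T h) I f.
Proof.
move=> uB hB v1 vuh; have mI := measurable_I0T T.
have [uM uD] := DmeasP uB; have [hM hD] := DmeasP hB.
have L f (M : R) : measurable_fun I f -> (forall x, I x -> `|f x| <= M) ->
    charge_Rintegral (cadd (cscale a (Dmeas T u)) (cscale b (Dmeas T h))) I f =
    a * charge_Rintegral (Dmeas T u) I f + b * charge_Rintegral (Dmeas T h) I f.
  move=> mf fM; rewrite (charge_Rintegral_cadd _ _ mI mf fM).
  by rewrite !(charge_Rintegral_cscale _ _ mI mf fM).
have [|phi phiC|vB vD] := @charge_Rintegral_Dmeas v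
    (cadd (cscale a (Dmeas T u)) (cscale b (Dmeas T h))) T0 v1.
- by apply: cadd_M0T; exact: cscale_M0T.
- have [M M0 phiM] := Ccinfty_bounded T0 phiC.
  rewrite (L _ M (Ccinfty_measurable phiC) (fun x _ => phiM x)).
  have dphiC := Ccinfty_derive1 T0 phiC.
  have [N N0 dphiN] := Ccinfty_bounded T0 dphiC.
  have mdphi := Ccinfty_measurable (D := setT) dphiC.
  have iu := integrable_mul_bounded mdphi dphiN ((Lfun1_integrable _ _).1 uB.1).
  have ih := integrable_mul_bounded mdphi dphiN ((Lfun1_integrable _ _).1 hB.1).
  have iau : mu.-integrable setT (EFin \o (fun x => a * (derive1 phi x * u x))).
    by have := integrableZl measurableT a iu.
  have ibh : mu.-integrable setT (EFin \o (fun x => b * (derive1 phi x * h x))).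
    by have := integrableZl measurableT b ih.
  transitivity (\int[mu]_x (a * (derive1 phi x * u x) + b * (derive1 phi x * h x))).
    apply: eq_Rintegral_ae.
    + apply: measurable_funM => //.
      exact: integrable_measurable ((Lfun1_integrable _ _).1 v1).
    + exact: measurable_funD (integrable_measurable iau) (integrable_measurable ibh).
    + by apply: filterS vuh => x ->; ring.
  rewrite RintegralD// !RintegralZl//.
  have -> : \int[mu]_x (derive1 phi x * u x) = - charge_Rintegral (Dmeas T u) I phi.
    by rewrite -uD//; apply: eq_Rintegral => x _; rewrite mulrC.
  have -> : \int[mu]_x (derive1 phi x * h x) = - charge_Rintegral (Dmeas T h) I phi.
    by rewrite -hD//; apply: eq_Rintegral => x _; rewrite mulrC.
  by rewrite !mulrN opprD.
split => // f M mf fM; rewrite (vD f M)//; apply: (L f M) => //.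
exact: measurable_funTS.
Qed.

Lemma charge_Rintegral_Dmeas_sub u (w : L1 T) f (M : R) :
  measurable_fun [set: mR] f -> (forall x, `|f x| <= M) ->
  charge_Rintegral (Dmeas_sub u w) I f =
  charge_Rintegral (Dmeas T u) I f - \int[mu]_x (w x * f x).
Proof.
move=> mf fM; have mI := measurable_I0T T.
have mfI : measurable_fun I f by exact: measurable_funTS.
rewrite (charge_Rintegral_cadd _ _ mI mfI (fun x _ => fM x)).
by rewrite (charge_Rintegral_copp _ mI mfI (fun x _ => fM x)) (charge_Rintegral_dens _ mf fM).
Qed.

Lemma normM_le nu (C : R) (T0 : 0 < T) :
  (forall f, measurable_fun [set: mR] f -> (forall x, `|f x| <= 1) ->
    charge_Rintegral nu I f <= C) ->
  fine (normM T nu) <= C.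
Proof.
move=> H; rewrite -lee_fin fineK ?normM_fin_num//.
apply: ge_ereal_sup => _ [phi [phiC /normCP phi1] <-]; rewrite lee_fin.
have mI := measurable_I0T T; have mphi := C0_measurable phiC.
(* A [C0] function is controlled on ]0, T[ only; cut off outside, it is measurable and bounded by 1
   on the whole line. *)
rewrite (_ : charge_Rintegral nu I phi = charge_Rintegral nu I (phi \_ I)).
  apply: H; first exact/(measurable_restrictT _ mI).
  by move=> x; rewrite patchE; case: ifPn => [/set_mem/phi1//|_]; rewrite normr0.
by rewrite /charge_Rintegral; congr (_ - _); apply: eq_Rintegral => x xI; rewrite patchE xI.
Qed.

Lemma normM_lin nu nu1 nu2 (a b : R) (T0 : 0 < T) : 0 <= a -> 0 <= b ->
  (forall f, measurable_fun [set: mR] f -> (forall x, `|f x| <= 1) ->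
    charge_Rintegral nu I f = a * charge_Rintegral nu1 I f + b * charge_Rintegral nu2 I f) ->
  fine (normM T nu) <= a * fine (normM T nu1) + b * fine (normM T nu2).
Proof.
move=> a0 b0 H; apply: normM_le => // f mf f1; rewrite H//.
have mfI : measurable_fun I f by exact: measurable_funTS.
by apply: lerD; apply: ler_wpM2l => //; rewrite -[leRHS]mul1r le_charge_Rintegral_normM.
Qed.

(** For a test function [phi] of integral zero in place of [k], the identity is the definition of
    the derivative applied to the primitive of [phi]. The L^1 error of [phi] bounds the error of its
    primitive uniformly, and the derivative has finite variation. *)
Lemma BV_IBP_approx u k (T0 : 0 < T) : BV T u -> mu.-integrable setT (EFin \o k) ->
  mu.-integrable setT (EFin \o (fun x => u x * k x)) ->
  (forall d : R, 0 < d -> exists phi, [/\ Ccinfty T phi, \int[mu]_x phi x = 0,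
     \int[mu]_x `|u x * k x - u x * phi x| <= d & \int[mu]_x `|k x - phi x| <= d]) ->
  \int[mu]_x (u x * k x) = - charge_Rintegral (Dmeas T u) I (primitive T k).
Proof.
move=> uB ik iuk H; have mI := measurable_I0T T; have [_ uD] := DmeasP uB.
apply/eqP; rewrite -subr_eq0 -normr_le0.
set V := fine (ftv (Dmeas T u) I).
have V0 : 0 <= V by exact: fine_ge0.
apply/ler_addgt0Pl => e e0; rewrite addr0.
have d0 : 0 < e / (1 + V) by rewrite divr_gt0// ltr_pwDl.
have [phi [phiC phi0 uphi kphi]] := H _ d0.
have iphi := Ccinfty_integrable T0 phiC.
have [M M0 phiM] := Ccinfty_bounded T0 phiC.
have PC := Ccinfty_primitive T0 phiC phi0.
have dP : derive1 (primitive T phi) = phi.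
  by apply/funext => x; have [] := primitive_derive1 x T0 phiC.
have := uD _ PC; rewrite dP => uphiE.
have iuphi : mu.-integrable setT (EFin \o (fun x => u x * phi x)).
  apply: (eq_integrable measurableT) (integrable_mul_bounded
    (Ccinfty_measurable (D := setT) phiC) phiM ((Lfun1_integrable _ _).1 uB.1)).
  by move=> x _ /=; rewrite mulrC.
have mpk := primitive_measurable ik; have mpp := primitive_measurable iphi.
have mpkI : measurable_fun I (primitive T k) by exact: measurable_funTS.
have mppI : measurable_fun I (primitive T phi) by exact: measurable_funTS.
have -> : \int[mu]_x (u x * k x) - - charge_Rintegral (Dmeas T u) I (primitive T k) =
    \int[mu]_x (u x * k x - u x * phi x) + charge_Rintegral (Dmeas T u) I
      (fun x => primitive T k x - primitive T phi x).
  rewrite RintegralB// uphiE.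
  rewrite (charge_RintegralB _ mpkI (fun x _ => primitive_bounded ik x)
    mppI (fun x _ => primitive_bounded iphi x)) !opprK.
  by rewrite -addrA [X in _ = _ + X]addrC subrK.
rewrite [leRHS](_ : e = e / (1 + V) + e / (1 + V) * V); last first.
  by field; rewrite gt_eqF// ltr_pwDl.
apply: le_trans (ler_normD _ _) _; apply: lerD.
  apply: le_trans (le_normr_Rintegral _ _) uphi => //.
  by have := integrableB measurableT iuk iuphi.
have ikphi : mu.-integrable setT (EFin \o (fun x => k x - phi x)).
  by have := integrableB measurableT ik iphi.
have pkphi x : I x -> `|primitive T k x - primitive T phi x| <= e / (1 + V).
  by move=> _; rewrite primitive_subE// (le_trans (le_norm_primitive _ ikphi)).
have mpkphi : measurable_fun I (fun x => primitive T k x - primitive T phi x).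
  exact: measurable_funB.
apply: le_trans (le_norm_charge_Rintegral _ mpkphi pkphi) _.
rewrite -(Rintegral_cst _ mI); apply: le_Rintegral => //.
- by apply: integrable_norm; exact: finite_integrable mI mpkphi pkphi.
- by apply: (finite_integrable _ (M := `|e / (1 + V)|)).
Qed.

Lemma Rintegral_young f g (c : R) : 0 < c -> f \in Lfun mu 2%:E -> g \in Lfun mu 2%:E ->
  \int[mu]_x `|f x * g x| <= c * \int[mu]_x (f x ^+ 2) + c^-1 * \int[mu]_x (g x ^+ 2).
Proof.
move=> c0 f2 g2.
have i1 := Lfun2_sqr f2; have i2 := Lfun2_sqr g2.
have i1c : mu.-integrable setT (EFin \o (fun x => c * f x ^+ 2)).
  by have := integrableZl measurableT c i1.
have i2c : mu.-integrable setT (EFin \o (fun x => c^-1 * g x ^+ 2)).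
  by have := integrableZl measurableT c^-1 i2.
rewrite -!RintegralZl// -RintegralD//; apply: le_Rintegral => //.
- exact: integrable_norm (Lfun2_mul f2 g2).
- by have := integrableD measurableT i1c i2c.
- move=> x _; rewrite normrM -(real_normK (num_real (f x))) -(real_normK (num_real (g x))).
  have := normr_ge0 (f x); have := normr_ge0 (g x).
  move: (`|f x|) (`|g x|) => a b a0 b0.

  have ci0 : 0 <= c^-1 by rewrite invr_ge0 ltW.
  have : 0 <= (c * a - b) ^+ 2 / c + a * b := addr_ge0 (mulr_ge0 (sqr_ge0 _) ci0) (mulr_ge0 b0 a0).
  rewrite (_ : (c * a - b) ^+ 2 / c + a * b = c * a ^+ 2 + c^-1 * b ^+ 2 - a * b).
    by rewrite subr_ge0.
  by field; rewrite gt_eqF.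
Qed.

Lemma BV_IBP_L2 u g (T0 : 0 < T) : BV T u -> u \in Lfun mu 2%:E ->
  g \in Lfun mu 2%:E -> \int[mu]_x g x = 0 ->
  \int[mu]_x (u x * g x) = - charge_Rintegral (Dmeas T u) I (primitive T g).
Proof.
move=> uB u2 g2 g0; apply: BV_IBP_approx => //; [exact: Lfun2_integrable|exact: Lfun2_mul|].
move=> d d0; set A := \int[mu]_x (u x ^+ 2).
have A0 : 0 <= A by apply: Rintegral_ge0 => x _; exact: sqr_ge0.
(* Young's inequality with weight [c], at squared L^2 error below [c ^+ 2], leaves [c * A + c] and
   [c * T + c], both at most [d]. *)
pose c := d / (A + T + 1).
have D0 : 0 < A + T + 1 by rewrite ltr_pwDr// addr_ge0// ltW.
have c0 : 0 < c by rewrite divr_gt0.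
have [phi [phiC phi0 gphi]] := Lfun2_mean0_approx T0 g2 g0 (exprn_gt0 2 c0).
have gp2 := Lfun2B g2 (Ccinfty_Lfun2 T0 phiC).
have cd : c * A + c * T + c = d.
  by rewrite /c; field; rewrite gt_eqF.
have cc : c^-1 * \int[mu]_x ((g x - phi x) ^+ 2) <= c.
  by rewrite ler_pdivrMl// -expr2 ltW.
have cA : 0 <= c * A by rewrite mulr_ge0// ltW.
have cT : 0 <= c * T by rewrite mulr_ge0// ltW.
exists phi; split => //.
  under eq_Rintegral do rewrite -mulrBr.
  apply: le_trans (Rintegral_young c0 u2 gp2) _; rewrite -/A; lra.
have := Rintegral_young c0 (Lfun2_cst T 1) gp2.
rewrite expr1n Rintegral_cst0T// mul1r.
under eq_Rintegral do rewrite mul1r.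
move=> /le_trans; apply; lra.
Qed.

(* The primitive k of g vanishes at the endpoints but is not compactly supported:
   it is approximated uniformly by primitives of mean-zero test functions, whose
   own mean is then removed with a fixed bump. *)
Lemma BV_IBP_primitive w g (T0 : 0 < T) : BV T w -> g \in Lfun mu 2%:E ->
  \int[mu]_x g x = 0 -> \int[mu]_x primitive T g x = 0 ->
  \int[mu]_x (w x * primitive T g x) =
  - charge_Rintegral (Dmeas T w) I (primitive T (primitive T g)).
Proof.
move=> wB g2 g0; set k := primitive T g => k0; have ig := Lfun2_integrable g2.
have k2 : k \in Lfun mu 2%:E := primitive_Lfun2 ig.
have ik := Lfun2_integrable k2; have mk := integrable_measurable ik.
have iw := (Lfun1_integrable _ _).1 wB.1.
have bw (h : R -> R) (M : R) : measurable_fun [set: mR] h -> (forall x, `|h x| <= M) ->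
    mu.-integrable setT (EFin \o (fun x => w x * h x)).
  move=> mh hM; apply: (eq_integrable measurableT) (integrable_mul_bounded mh hM iw).
  by move=> x _ /=; rewrite mulrC.
apply: BV_IBP_approx => //; first exact: bw mk (primitive_bounded ig).
(* Only integrability of [w] is available, so the approximation of [k] has to be uniform rather than
   in L^2. *)
move=> d d0; have [psi psiC psi1] := Ccinfty_unit_mass T0.
have [N N0 psiN] := Ccinfty_bounded T0 psiC.
set W := \int[mu]_x `|w x|.
have W0 : 0 <= W by apply: Rintegral_ge0.
have B0 : 0 < 1 + T * N by rewrite ltr_pwDl// mulr_ge0 ?ltW.
have D0 : 0 < 1 + T + W by have := T0; lra.
(* A uniform error [s] leaves [phi] an integral of at most [s * T], whose removal with [psi] adds at
   most [s * T * N]: in total [e]. The two required errors are then [e * W] and [e * T]. *)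
pose e := d / (1 + T + W); pose s := e / (1 + T * N).
have e0 : 0 < e by rewrite divr_gt0.
have s0 : 0 < s by rewrite divr_gt0.
have [chi [chiC chi0 gchi]] := Lfun2_mean0_approx T0 g2 g0 (divr_gt0 (exprn_gt0 2 s0) T0).
have ichi := Ccinfty_integrable T0 chiC.
have phiC := Ccinfty_primitive T0 chiC chi0; set phi := primitive T chi in phiC.
have iphi := Ccinfty_integrable T0 phiC; have ipsi := Ccinfty_integrable T0 psiC.
have kphi x : `|k x - phi x| <= s.
  rewrite -(@ler_pXn2r _ 2)// ?nnegrE// ?(ltW s0)// real_normK ?num_real//.
  rewrite primitive_subE//.
  apply: le_trans (sqr_primitive_le _ T0 (Lfun2B g2 (Ccinfty_Lfun2 T0 chiC))) _.
  by rewrite -ler_pdivlMl// mulrC ltW.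
have ikphi : mu.-integrable setT (EFin \o (fun x => k x - phi x)).
  by have := integrableB measurableT ik iphi.
have phis : `|\int[mu]_x phi x| <= s * T.
  rewrite -normrN -[X in `|X|]add0r -k0 -RintegralB//.
  apply: le_trans (le_normr_Rintegral _ _) _ => //.
  rewrite -(Rintegral_cst0T T0); apply: le_Rintegral => //.
  - exact: integrable_norm.
  - exact: Lfun2_integrable (Lfun2_cst _ _).
pose phi' := fun x => phi x + (- \int[mu]_y phi y) * psi x.
have phiC' : Ccinfty T phi' by apply: CcinftyD => //; exact: CcinftyZ.
have iphi' := Ccinfty_integrable T0 phiC'.
have kphi' x : `|k x - phi' x| <= e.
  rewrite (_ : k x - phi' x = (k x - phi x) + (\int[mu]_y phi y) * psi x);
    last by rewrite /phi'; ring.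
  apply: le_trans (ler_normD _ _) _.
  rewrite [leRHS](_ : e = s + s * T * N); last by rewrite /s; field; rewrite gt_eqF.
  by rewrite lerD// normrM ler_pM.
have mphi' := integrable_measurable iphi'.
have ikphi' : mu.-integrable setT (EFin \o (fun x => k x - phi' x)).
  by have := integrableB measurableT ik iphi'.
have ed : e * (1 + T + W) = d by rewrite /e divfK// gt_eqF.
have eT : 0 <= e * T by rewrite mulr_ge0 ?ltW.
have eW : 0 <= e * W by rewrite mulr_ge0 ?(ltW e0).
exists phi'; split => //.
- rewrite RintegralD//; last by have := integrableZl measurableT (- \int[mu]_y phi y) ipsi.
  by rewrite RintegralZl// psi1 mulr1 subrr.
- apply: le_trans (_ : e * W <= _); last by lra.
  rewrite -RintegralZl//; last exact: integrable_norm.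
  apply: le_Rintegral => //.
  + have := bw _ e (measurable_funB mk mphi') kphi' => ibw.
    apply: (eq_integrable measurableT) (integrable_norm ibw).
    by move=> x _ /=; rewrite mulrBr.
  + by have := integrableZl measurableT e (integrable_norm iw).
  + by move=> x _; rewrite -mulrBr normrM mulrC ler_wpM2r.
- apply: le_trans (_ : e * T <= _); last by lra.
  rewrite -(Rintegral_cst0T T0); apply: le_Rintegral => //.
  + exact: integrable_norm.
  + exact: Lfun2_integrable (Lfun2_cst _ _).
Qed.

(** * Step functions as directions, and boundary values of primitives *)

Definition step (a c x0 : R) : R -> R := fun x => a + c * \1_(`]x0, +oo[) x.

Lemma step_measurable a c x0 : measurable_fun [set: mR] (step a c x0).
Proof.
by apply: measurable_funD => //; apply: measurable_funM => //.
Qed.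

Lemma step_bounded a c x0 x : `|step a c x0 x| <= `|a| + `|c|.
Proof.
rewrite (le_trans (ler_normD _ _))// lerD// normrM ler_piMr// indicE.
by case: (_ \in _); rewrite ?normr1 ?normr0.
Qed.

Lemma step_integrable a c x0 : mu.-integrable setT (EFin \o step a c x0).
Proof.
apply: Lfun2_integrable; exact: bounded_Lfun2 (step_measurable _ _ _) (step_bounded _ _ _).
Qed.

Lemma Rintegral_mul_step g a c x0 : mu.-integrable setT (EFin \o g) ->
  \int[mu]_x (g x * step a c x0 x) =
  a * (\int[mu]_x g x) + c * (\int[mu]_x g x - primitive T g x0).
Proof.
move=> ig; have i1 := integrable_mul_indic (measurable_itv (`]x0, +oo[)%R) ig.
transitivity (\int[mu]_x (a * g x + c * (g x * \1_(`]x0, +oo[) x))).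
  by apply: eq_Rintegral => x _; rewrite /step; ring.
rewrite RintegralD//.
- by rewrite !RintegralZl// Rintegral_mul_indic_gt.
- by have := integrableZl measurableT a ig.
- by have := integrableZl measurableT c i1.
Qed.

Lemma step_BV a c x0 (T0 : 0 < T) : I x0 -> BV T (step a c x0) /\
  forall f (M : R), measurable_fun [set: mR] f -> (forall x, `|f x| <= M) ->
    charge_Rintegral (Dmeas T (step a c x0)) I f = c * f x0.
Proof.
move=> x0I; have mI := measurable_I0T T.
have C f (M : R) : measurable_fun [set: mR] f -> (forall x, `|f x| <= M) ->
    charge_Rintegral (cscale c (delta x0)) I f = c * f x0.
  move=> mf fM; have mfI : measurable_fun I f by exact: measurable_funTS.
  rewrite (charge_Rintegral_cscale _ _ mI mfI (fun x _ => fM x)).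
  by rewrite (charge_Rintegral_delta x0I mfI (fun x _ => fM x)).
have [|phi phiC|sB sD] := @charge_Rintegral_Dmeas (step a c x0)
    (cscale c (delta x0)) T0 ((Lfun1_integrable _ _).2 (step_integrable a c x0)).
- exact/cscale_M0T/delta_M0T.
- have [M M0 phiM] := Ccinfty_bounded T0 phiC.
  rewrite (C _ M (Ccinfty_measurable phiC) phiM).
  have dphiC := Ccinfty_derive1 T0 phiC; have idphi := Ccinfty_integrable T0 dphiC.
  under eq_Rintegral do rewrite mulrC.
  rewrite Rintegral_mul_step// -(primitiveT (lexx T) idphi) !Ccinfty_primitive_derive1//.
  have -> : phi T = 0 by apply: Ccinfty_out T0 phiC _; rewrite /I0T/= in_itv/= ltxx andbF.
  by ring.
split => // f M mf fM; rewrite (sD f M)//; exact: C fM.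
Qed.

Lemma primitive_BV (w : L1 T) (T0 : 0 < T) : BV T (primitive T w) /\
  forall f (M : R), measurable_fun [set: mR] f -> (forall x, `|f x| <= M) ->
    charge_Rintegral (Dmeas T (primitive T w)) I f = \int[mu]_x (w x * f x).
Proof.
have iw := Lspace1_integrable w.
have [||pB pD] := @charge_Rintegral_Dmeas (primitive T w) (dens w) T0
    ((Lfun1_integrable _ _).2 (Lfun2_integrable (primitive_Lfun2 iw))).
- exact: dens_M0T.
- move=> phi phiC; have [M M0 phiM] := Ccinfty_bounded T0 phiC.
  by rewrite primitive_weak_deriv// (charge_Rintegral_dens _ (Ccinfty_measurable phiC) phiM).
split => // f M mf fM; rewrite (pD f M)//.
by rewrite (charge_Rintegral_dens _ mf fM).
Qed.

Lemma charge_RintegralN nu f (M : R) : measurable_fun I f ->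
  (forall x, I x -> `|f x| <= M) ->
  charge_Rintegral nu I (fun x => - f x) = - charge_Rintegral nu I f.
Proof.
move=> mf fM; have mI := measurable_I0T T.
have c0 : charge_Rintegral nu I (fun=> 0) = 0.
  by rewrite /charge_Rintegral !(Rintegral_cst _ mI) !mul0r subrr.
have := @charge_RintegralB _ _ nu (fun=> 0) f 0 M (measurable_cst _) _ mf fM.
rewrite c0 sub0r => <-; last by move=> x _; rewrite normr0.
by congr charge_Rintegral; apply/funext => x; rewrite sub0r.
Qed.

(** The difference [v - k] is orthogonal to test functions, and these approximate the constant 1 in
    L^2. Equality of the integrals is all that is wanted, so full uniqueness of weak derivatives is
    bypassed. *)
Lemma weak_deriv_mean0 h k v (T0 : 0 < T) : weak_deriv T h v -> weak_deriv T h k ->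
  v \in Lfun mu 2%:E -> k \in Lfun mu 2%:E -> \int[mu]_x v x = \int[mu]_x k x.
Proof.
move=> hv hk v2 k2; have d2 := Lfun2B v2 k2.
apply/eqP; rewrite -subr_eq0 -RintegralB//; [|exact: Lfun2_integrable..].
rewrite -normr_le0; set A := \int[mu]_x ((v x - k x) ^+ 2).
have A0 : 0 <= A by apply: Rintegral_ge0 => x _; exact: sqr_ge0.
apply/ler_addgt0Pl => e e0; rewrite addr0.
have A1 : 0 < A + 1 by rewrite ltr_wpDl.
pose c := e / (A + 1); have c0 : 0 < c by rewrite divr_gt0.
have [phi phiC phi1] := Lfun2_approx T0 (Lfun2_cst T 1) (exprn_gt0 2 c0).
have phi2 := Ccinfty_Lfun2 T0 phiC; have p2 := Lfun2B (Lfun2_cst T 1) phi2.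
have i1 := Lfun2_mul d2 phi2; have i2 := Lfun2_mul d2 p2.
have := hv _ phiC; rewrite hk// => /oppr_inj vk.
have Z : \int[mu]_x ((v x - k x) * phi x) = 0.
  have iv := Lfun2_mul v2 phi2; have ik := Lfun2_mul k2 phi2.
  under eq_Rintegral do rewrite mulrBl.
  by rewrite RintegralB// vk subrr.
have -> : \int[mu]_x (v x - k x) = \int[mu]_x ((v x - k x) * (1 - phi x)).
  rewrite -[RHS]addr0 -Z -RintegralD//; apply: eq_Rintegral => x _; ring.
apply: le_trans (le_normr_Rintegral _ _) _ => //.
apply: le_trans (Rintegral_young c0 d2 p2) _; rewrite -/A.
rewrite [leRHS](_ : e = c * A + c); last by rewrite /c; field; rewrite gt_eqF.
by rewrite lerD// ler_pdivrMl// -expr2 ltW.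
Qed.

(** The approximating derivatives have integral [phi n T = 0], which passes to the L^2 limit [v];
    [weak_deriv_mean0] transfers it from this unspecified weak derivative to [k]. *)
Lemma H10_primitive_mean0 k (T0 : 0 < T) : k \in Lfun mu 2%:E -> H10 T (primitive T k) ->
  \int[mu]_x k x = 0.
Proof.
move=> k2 [_ [v [v2 pv [phi [phiC _ phiv]]]]].
have ik := Lfun2_integrable k2; have iv := Lfun2_integrable v2.
rewrite -(weak_deriv_mean0 T0 pv (primitive_weak_deriv T0 ik) v2 k2).
apply/eqP; rewrite -sqrf_eq0 -normr_le0 normrX real_normK ?num_real//.
apply/ler_addgt0Pl => e e0; rewrite addr0.
(* The squared integral of [v] is at most [T] times the squared L^2 distance from [v] to
   [derive1 (phi n)]; at distance below [s] this is less than [e]. *)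
pose s := Num.sqrt (e / T).
have s0 : 0 < s by rewrite sqrtr_gt0 divr_gt0.
have [n] := cvge0_ex phiv s0.
have dC := Ccinfty_derive1 T0 (phiC n); have d2 := Ccinfty_Lfun2 T0 dC.
have dv2 := Lfun2B d2 v2.
rewrite (Lnorm2E dv2).
rewrite lte_fin ltr_sqrt ?divr_gt0// ltr_pdivlMr// mulrC => /ltW; apply: le_trans.
apply: le_trans (sqr_Rintegral_le T0 dv2).
rewrite RintegralB//; last exact: Lfun2_integrable.
rewrite -[X in X - _](primitiveT (lexx T) (Lfun2_integrable d2)) Ccinfty_primitive_derive1//.
rewrite (Ccinfty_out T0 (phiC n)) ?sub0r ?sqrrN//.
by rewrite /I0T/= in_itv/= ltxx andbF.
Qed.

Lemma primitiveN k x : mu.-integrable setT (EFin \o k) ->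
  primitive T (fun y => - k y) x = - primitive T k x.
Proof.
move=> ik; have mk := integrable_measurable ik.
have mx := measurable_itv (`]-oo, x[)%R.
have mNk : measurable_fun [set: mR] (fun y => - k y) by exact: measurableT_comp.
rewrite !primitive_ltE// -mulN1r -RintegralZl//; last exact: integrable_mul_indic.
by apply: eq_Rintegral => y _; rewrite mulN1r mulNr.
Qed.

Lemma primitive_regularity k (T0 : 0 < T) : k \in Lfun mu 2%:E ->
  \int[mu]_x k x = 0 -> \int[mu]_x primitive T k x = 0 ->
  let P := fun x => - primitive T (primitive T k) x in
  [/\ H10 T (primitive T k), H2 T P & H10 T P].
Proof.
move=> k2 k0 p0; have ik := Lfun2_integrable k2.
have p2 := primitive_Lfun2 ik; have ip := Lfun2_integrable p2.
have Nk2 := Lfun2Z (-1) k2; have Np2 := Lfun2Z (-1) p2.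
have iNk := Lfun2_integrable Nk2; have iNp := Lfun2_integrable Np2.
(* Written as the primitive of an opposite function, P falls under the same lemmas as p. *)
have -> : (fun x => - primitive T (primitive T k) x) =
    primitive T (fun x => -1 * primitive T k x).
  by apply/funext => x; rewrite -primitiveN//; congr primitive; apply/funext => y; rewrite mulN1r.
have pN : primitive T (fun x => -1 * k x) = (fun x => -1 * primitive T k x).
  apply/funext => x; rewrite mulN1r -primitiveN//; congr primitive.
  by apply/funext => y; rewrite mulN1r.
split; first exact: primitive_H10.
- split; first exact: primitive_Lfun2.
  exists (fun x => -1 * primitive T k x), (fun x => -1 * k x); split => //.
    exact: primitive_weak_deriv.
  by rewrite -pN; exact: primitive_weak_deriv.
- by apply: primitive_H10 => //; rewrite RintegralZl// p0 mulr0.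
Qed.

(** * Optimality conditions *)

Section objective.
Variables (alpha beta : R).
Hypotheses (a0 : 0 <= alpha) (b0 : 0 <= beta).
Local Notation obj := (TGV_obj (T := T) alpha beta).

Lemma TGV_objE u (w : L1 T) (T0 : 0 < T) : obj u w =
  (alpha * fine (normM T (Dmeas_sub u w)) + beta * fine (normM T (Dmeas T w)))%:E.
Proof. by rewrite EFinD !EFinM !fineK ?normM_fin_num. Qed.

(** Both charges depend linearly on the pair of function and field, so [obj] behaves as a seminorm
    of that pair. Coefficients [1] and [t] serve a general direction, [1 - t] and [0] the direction
    [- u]. *)
Lemma TGV_obj_lin u h v (w eta z : L1 T) (a b : R) (T0 : 0 < T) : 0 <= a -> 0 <= b ->
  BV T u -> BV T h -> BV T w -> BV T eta -> v \in Lfun mu 1 ->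
  (\forall x \ae mu, v x = a * u x + b * h x) ->
  (\forall x \ae mu, z x = a * w x + b * eta x) ->
  [/\ BV T v, BV T z & fine (obj v z) <= a * fine (obj u w) + b * fine (obj h eta)].
Proof.
move=> a_ge0 b_ge0 uB hB wB etaB v1 vE zE.
have z1 : (z : R -> R) \in Lfun mu 1 by exact: Lspace_Lfun.
have [vB vD] := Dmeas_lin T0 uB hB v1 vE; have [zB zD] := Dmeas_lin T0 wB etaB z1 zE.
split => //; rewrite !TGV_objE//=.
have h1 : fine (normM T (Dmeas_sub v z)) <=
    a * fine (normM T (Dmeas_sub u w)) + b * fine (normM T (Dmeas_sub h eta)).
  apply: normM_lin => // f mf f1; rewrite !(charge_Rintegral_Dmeas_sub _ _ mf f1) (vD _ 1)//.
  have iw := integrable_mul_bounded mf f1 (Lspace1_integrable w).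
  have ieta := integrable_mul_bounded mf f1 (Lspace1_integrable eta).
  have iaw : mu.-integrable setT (EFin \o (fun x => a * (f x * w x))).
    by have := integrableZl measurableT a iw.
  have ibeta : mu.-integrable setT (EFin \o (fun x => b * (f x * eta x))).
    by have := integrableZl measurableT b ieta.
  have -> : \int[mu]_x (z x * f x) =
      a * \int[mu]_x (w x * f x) + b * \int[mu]_x (eta x * f x).
    transitivity (\int[mu]_x (a * (f x * w x) + b * (f x * eta x))).
      apply: eq_Rintegral_ae.
      - by apply: measurable_funM => //; exact: BV_measurable.
      - exact: measurable_funD (integrable_measurable iaw) (integrable_measurable ibeta).
      - by apply: filterS zE => x ->; ring.
    rewrite RintegralD// !RintegralZl//.
    by congr (_ * _ + _ * _); apply: eq_Rintegral => x _; rewrite mulrC.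
  move: (charge_Rintegral (Dmeas T u) _ _) (charge_Rintegral (Dmeas T h) _ _) => A B.
  by rewrite mulrBr mulrBr opprD addrACA.
have h2 : fine (normM T (Dmeas T z)) <=
    a * fine (normM T (Dmeas T w)) + b * fine (normM T (Dmeas T eta)).
  by apply: normM_lin => // f mf f1; exact: zD f1.
have := ler_wpM2l a0 h1; have := ler_wpM2l b0 h2.
move: (normM T (Dmeas_sub v z)) (normM T (Dmeas T z)) => x1 x2.
move: (normM T (Dmeas_sub u w)) (normM T (Dmeas T w)) => y1 y2.
move: (normM T (Dmeas_sub h eta)) (normM T (Dmeas T eta)) => z1' z2'.
move: (fine x1) (fine x2) (fine y1) (fine y2) (fine z1') (fine z2').
clear; move=> {}x1 {}x2 {}y1 {}y2 {}z1' {}z2'.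
by rewrite !mulrDr => ? ?; lra.
Qed.

(** The first integration by parts pairs p with Dv, which is split as Dv - w plus w; the integral of
    [w] against p is what the second one rewrites. The two vanishing integrals remove all boundary
    terms, so [v] and [w] need no boundary values. *)
Lemma Rintegral_gradE v (w : L1 T) g (T0 : 0 < T) : BV T v -> v \in Lfun mu 2%:E ->
  BV T w -> g \in Lfun mu 2%:E -> \int[mu]_x g x = 0 ->
  \int[mu]_x primitive T g x = 0 ->
  \int[mu]_x (g x * v x) = - (charge_Rintegral (Dmeas_sub v w) I (primitive T g) +
    charge_Rintegral (Dmeas T w) I (fun x => - primitive T (primitive T g) x)).
Proof.
move=> vB v2 wB g2 g0 p0; have ig := Lfun2_integrable g2; have mI := measurable_I0T T.
have ip := Lfun2_integrable (primitive_Lfun2 ig).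
have mp := integrable_measurable ip; have mP := primitive_measurable ip.
under eq_Rintegral do rewrite mulrC.
rewrite BV_IBP_L2// (charge_Rintegral_Dmeas_sub _ _ mp (primitive_bounded ig)).
rewrite BV_IBP_primitive//.
have -> : charge_Rintegral (Dmeas T w) I (fun x => - primitive T (primitive T g) x) =
    - charge_Rintegral (Dmeas T w) I (primitive T (primitive T g)).
  exact: charge_RintegralN (measurable_funTS mP) (fun x _ => primitive_bounded ip x).
move: (charge_Rintegral (Dmeas T v) _ _) (charge_Rintegral (Dmeas T w) _ _) => A B.
by rewrite opprK addrK.
Qed.

Lemma TGV_fineK u (w : L1 T) (T0 : 0 < T) : obj u w = (fine (obj u w))%:E.
Proof. by rewrite TGV_objE. Qed.

Lemma TGV_le_obj u (w : L1 T) : BV T w -> (TGV T alpha beta u <= obj u w)%E.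
Proof. by move=> wB; apply: ereal_inf_lbound; exists w. Qed.

Lemma BV_add_scale (u h : L2 T) (t : R) :
  [/\ \forall x \ae mu, (u + t *: h : L2 T) x = 1 * u x + t * h x,
     (u : R -> R) \in Lfun mu 2%:E & (u : R -> R) \in Lfun mu 1].
Proof.
split; last 2 first.
- exact: Lspace_Lfun.
- by apply/Lfun1_integrable/Lfun2_integrable; exact: Lspace_Lfun.
by apply: filterS2 (Lspace_addE u (t *: h)) (Lspace_scaleE t h) => x -> ->; rewrite mul1r.
Qed.

Lemma L1_lin (a b : R) (w eta : L1 T) :
  exists z : L1 T, \forall x \ae mu, z x = a * w x + b * eta x.
Proof.
exists (a *: w + b *: eta).
apply: filterS3 (Lspace_addE (a *: w) (b *: eta)) (Lspace_scaleE a w) (Lspace_scaleE b eta).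
by move=> x -> -> ->.
Qed.

(* Here Dh - eta and D eta are c and d times the Dirac mass at x0. *)
Lemma TGV_obj_step a b c d x0 (T0 : 0 < T) : I x0 ->
  exists (h : L2 T) (eta : L1 T),
  [/\ BV T h, BV T eta, fine (obj h eta) <= alpha * `|c| + beta * `|d|,
      \forall x \ae mu, h x = step a c x0 x + primitive T eta x
    & \forall x \ae mu, eta x = step b d x0 x].
Proof.
move=> x0I; have [sB sD] := @step_BV a c x0 T0 x0I; have [qB qD] := @step_BV b d x0 T0 x0I.
have [eta etaE] : exists eta : L1 T, \forall x \ae mu, eta x = step b d x0 x :=
  Lfun_exists_Lspace _ qB.1.
have [pB pD] := primitive_BV eta T0.
have E1 : \forall x \ae mu, eta x = 1 * step b d x0 x + 0 * step b d x0 x.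
  by apply: filterS etaE => x ->; rewrite mul1r mul0r addr0.
have [etaB etaD] := Dmeas_lin T0 qB qB (Lspace_Lfun eta) E1.
have ip := primitive_Lfun2 (Lspace1_integrable eta).
have s2 : step a c x0 \in Lfun mu 2%:E.
  exact: bounded_Lfun2 (step_measurable _ _ _) (step_bounded _ _ _).
have [h hE] : exists h : L2 T, \forall x \ae mu, h x = step a c x0 x + primitive T eta x :=
  Lfun_exists_Lspace _ (Lfun2D s2 ip).
have h1 : (h : R -> R) \in Lfun mu 1.
  by apply/Lfun1_integrable/Lfun2_integrable; exact: Lspace_Lfun.
have E2 : \forall x \ae mu, h x = 1 * step a c x0 x + 1 * primitive T eta x.
  by apply: filterS hE => x ->; rewrite !mul1r.
have [hB hD] := Dmeas_lin T0 sB pB h1 E2.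
exists h, eta; split => //.
rewrite TGV_objE//=; apply: lerD; apply: ler_wpM2l => //; apply: normM_le => // f mf f1.
  rewrite (charge_Rintegral_Dmeas_sub _ _ mf f1) (hD _ 1)// (sD _ 1)// (pD _ 1)//.
  by rewrite !mul1r addrK (le_trans (ler_norm _))// normrM ler_piMr.
by rewrite (etaD _ 1)// (qD _ 1)// mul1r mul0r addr0 (le_trans (ler_norm _))// normrM ler_piMr.
Qed.

(** * Necessary and sufficient first-order conditions *)

Section minimizer.
Variables (f : L2 T -> R) (u g : L2 T) (w : L1 T).
Hypotheses (df : differentiable f u) (fg : is_gradient f u g).
Hypotheses (uB : BV T u) (wB : BV T w).
Hypothesis uw : TGV T alpha beta u = obj u w.

(** Minimality compares the value at [u] with that at [u + t *: h], where [z], free to depend on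
    [t], bounds the TGV term from above. The number [obj u w] is finite and cancels, leaving the
    hypothesis of [differential_ge]. *)
Lemma minimizer_gradient_ge (h : L2 T) (C : R) (T0 : 0 < T) :
  is_minimizer f alpha beta u ->
  (forall t, 0 < t < 1 -> exists2 z : L1 T, BV T (u + t *: h : L2 T) /\ BV T z &
     fine (obj (u + t *: h : L2 T) z) <= fine (obj u w) + t * C) ->
  - C <= \int[mu]_x (g x * h x).
Proof.
move=> [_ umin] H; rewrite -fg; apply: differential_ge => // t t01.
have [z [uhB zB] zC] := H _ t01.
have := umin _ uhB; rewrite /J uw => /le_trans/(_ (leeD2l _ (TGV_le_obj _ zB))).
rewrite (TGV_fineK u w T0) (TGV_fineK _ z T0) -!EFinD lee_fin.
move=> /le_trans/(_ (lerD (lexx _) zC)).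
by rewrite addrC addrCA lerD2l mulrN lerBlDr.
Qed.

Lemma minimizer_gradient_obj (h : L2 T) (eta : L1 T) (T0 : 0 < T) :
  is_minimizer f alpha beta u -> BV T h -> BV T eta ->
  - fine (obj h eta) <= \int[mu]_x (g x * h x).
Proof.
move=> umin hB etaB; apply: minimizer_gradient_ge => // t /andP[/ltW t0 t1].
have [z zE] := L1_lin 1 t w eta; have [E _ _] := BV_add_scale u h t.
have [_ _ v1] := BV_add_scale (u + t *: h) h t.
have [vB zB vz] := TGV_obj_lin T0 ler01 t0 uB hB wB etaB v1 E zE.
by exists z => //; move: vz; rewrite mul1r.
Qed.

(** Scaling the pair of [u] and [w] by [1 - t] lowers the bound on the TGV term at rate [obj u w].
    This is the converse of [minimizer_gradient_obj] in the direction [u]. *)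
Lemma minimizer_gradient_self (T0 : 0 < T) :
  is_minimizer f alpha beta u -> \int[mu]_x (g x * u x) <= - fine (obj u w).
Proof.
move=> umin; rewrite lerNr.
have -> : - (\int[mu]_x (g x * u x)) = \int[mu]_x (g x * (- u : L2 T) x).
  by rewrite -!fg linearN.
rewrite -[leLHS]opprK; apply: minimizer_gradient_ge => // t /andP[/ltW t0 /ltW t1].
have [z zE] := L1_lin (1 - t) 0 w w; have [E _ _] := BV_add_scale u (- u) t.
have [_ _ v1] := BV_add_scale (u + t *: (- u)) u t.
(* The combination is rewritten with second coefficient 0, since [TGV_obj_lin] takes nonnegative
   coefficients and would otherwise add [t * obj] instead of subtracting it. *)
have E' : \forall x \ae mu, (u + t *: (- u) : L2 T) x = (1 - t) * u x + 0 * u x.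
  by apply: filterS2 E (Lspace_oppE u) => x -> ->; ring.
have t1' : 0 <= 1 - t by rewrite subr_ge0.
have [vB zB vz] := TGV_obj_lin T0 t1' (lexx 0) uB uB wB wB v1 E' zE.
exists z => //; rewrite (le_trans vz)// mul0r addr0 mulrBl mul1r mulrN//.
Qed.

(** The integrals of [g] and of its primitive are not known to vanish at this stage, so
    [Rintegral_gradE] is out of reach. As [h] is a step plus a primitive, [primitive_IBP] applies
    and keeps the boundary terms explicit; values 0, 1 and -1 of the four parameters then isolate
    each condition. *)
Lemma minimizer_step a b c d x0 (T0 : 0 < T) : is_minimizer f alpha beta u -> I x0 ->
  - (alpha * `|c| + beta * `|d|) <=
  a * (\int[mu]_x g x) + c * (\int[mu]_x g x - primitive T g x0) +
  (\int[mu]_x g x * \int[mu]_x step b d x0 x -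
   (b * (\int[mu]_x primitive T g x) +
    d * (\int[mu]_x primitive T g x - primitive T (primitive T g) x0))).
Proof.
move=> umin x0I; have [h [eta [hB etaB objh hE etaE]]] := TGV_obj_step a b c d T0 x0I.
have := minimizer_gradient_obj T0 umin hB etaB; rewrite -lerN2 opprK => /le_trans/(_ objh).
have g2 := Lspace_Lfun g; have ig := Lfun2_integrable g2.
have ieta := Lspace1_integrable eta; have ip := Lfun2_integrable (primitive_Lfun2 ig).
have ipeta := primitive_Lfun2 ieta.
have s2 : step a c x0 \in Lfun mu 2%:E.
  exact: bounded_Lfun2 (step_measurable _ _ _) (step_bounded _ _ _).
have i1 := Lfun2_mul g2 s2; have i2 := Lfun2_mul g2 ipeta.
rewrite lerNl; congr (_ <= _).
transitivity (\int[mu]_x (g x * step a c x0 x + g x * primitive T eta x)).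
  apply: eq_Rintegral_ae.
  - apply: measurable_funM; first exact: integrable_measurable ig.
    exact: BV_measurable.
  - exact: measurable_funD (integrable_measurable i1) (integrable_measurable i2).
  - by apply: filterS hE => x ->; rewrite mulrDr.
rewrite RintegralD//.
rewrite Rintegral_mul_step//; congr (_ + _).
have := primitive_IBP ig ieta; rewrite [LHS]addrC => /(canRL (addrK _)) ->.
have -> : \int[mu]_x eta x = \int[mu]_x step b d x0 x.
  apply: eq_Rintegral_ae => //; [exact: BV_measurable|exact: step_measurable].
congr (_ - _); rewrite -Rintegral_mul_step//; apply: eq_Rintegral_ae.
- by apply: measurable_funM; [exact: primitive_measurable|exact: BV_measurable].
- by apply: measurable_funM; [exact: primitive_measurable|exact: step_measurable].
- by apply: filterS etaE => x ->.
Qed.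

Lemma minimizer_bounds (T0 : 0 < T) : is_minimizer f alpha beta u ->
  [/\ \int[mu]_x g x = 0, \int[mu]_x primitive T g x = 0,
      forall x, I x -> `|primitive T g x| <= alpha
    & forall x, I x -> `|- primitive T (primitive T g) x| <= beta].
Proof.
move=> umin; have xI : I (T / 2) by rewrite /I0T/= in_itv/=; apply/andP; split; lra.
(* For [b = d = 0] the product of the two integrals in [minimizer_step] drops out, which isolates
   the integral of [g]; [T / 2] is just some point of the interval. *)
have S0 : \int[mu]_x step 0 0 (T / 2) x = 0.
  transitivity (\int[mu]_x (0 : R)); last by rewrite Rintegral_cst0T// mul0r.
  by apply: eq_Rintegral => x _; rewrite /step mul0r addr0.
have H a b c d x0 := @minimizer_step a b c d x0 T0 umin.
have Z : \int[mu]_x g x = 0.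
  have := H (- 1) 0 0 0 _ xI; have := H 1 0 0 0 _ xI.
  by rewrite S0 normr0 => ? ?; lra.
have {}H b c d x0 : I x0 -> - (alpha * `|c| + beta * `|d|) <= - (c * primitive T g x0) -
    (b * (\int[mu]_x primitive T g x) +
     d * (\int[mu]_x primitive T g x - primitive T (primitive T g) x0)).
  move=> x0I; apply: le_trans (H 0 b c d x0 x0I) _.
  by rewrite Z !mul0r sub0r mulrN add0r add0r.
have Z' : \int[mu]_x primitive T g x = 0.
  have := H (- 1) 0 0 _ xI; have := H 1 0 0 _ xI.
  by rewrite normr0 => ? ?; lra.
split => // x xI'; rewrite ler_norml; apply/andP; split.
- have := H 0 (- 1) 0 _ xI'; rewrite normr0 normrN1; lra.
- have := H 0 1 0 _ xI'; rewrite normr0 normr1; lra.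
- have := H 0 0 (- 1) _ xI'; rewrite Z' normr0 normrN1; lra.
- have := H 0 0 1 _ xI'; rewrite Z' normr0 normr1; lra.
Qed.

Let p := primitive T g.
Let P x := - primitive T p x.

Let g2 : (g : R -> R) \in Lfun mu 2%:E := Lspace_Lfun g.
Let ig : mu.-integrable setT (EFin \o (g : R -> R)) := Lfun2_integrable g2.
Let ip : mu.-integrable setT (EFin \o p) := Lfun2_integrable (primitive_Lfun2 ig).
Let pc : continuous p := primitive_continuous ig.
Let Pc : continuous P.
Proof. by move=> x; apply: cvgN; exact: primitive_continuous. Qed.

Let mp : measurable_fun I p := measurable_funTS (primitive_measurable ig).
Let mP : measurable_fun I P.
Proof. by apply: measurable_funTS; exact: continuous_measurable_fun Pc. Qed.

(** Weak duality: each pairing is at most its weight times the norm of its charge. Since [z] is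
    free, the infimum over it bounds TGV of [v] from below. *)
Lemma gradient_le_obj v (z : L1 T) (T0 : 0 < T) : BV T v -> v \in Lfun mu 2%:E -> BV T z ->
  \int[mu]_x g x = 0 -> \int[mu]_x p x = 0 ->
  (forall x, I x -> `|p x| <= alpha) -> (forall x, I x -> `|P x| <= beta) ->
  - (\int[mu]_x (g x * v x)) <= fine (obj v z).
Proof.
move=> vB v2 zB g0 p0 pa Pb; rewrite (Rintegral_gradE T0 vB v2 zB g2 g0 p0) opprK TGV_objE//=.
by apply: lerD; exact: le_charge_Rintegral_normM.
Qed.

Lemma minimizer_supports (T0 : 0 < T) : is_minimizer f alpha beta u ->
  [/\ supp0T T (jpos (Dmeas_sub u w)) `<=` [set x | I x /\ p x = alpha],
      supp0T T (jneg (Dmeas_sub u w)) `<=` [set x | I x /\ p x = - alpha],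
      supp0T T (jpos (Dmeas T w)) `<=` [set x | I x /\ P x = beta]
    & supp0T T (jneg (Dmeas T w)) `<=` [set x | I x /\ P x = - beta]].
Proof.
move=> umin; have [g0 p0 pa Pb] := minimizer_bounds T0 umin.
have := minimizer_gradient_self T0 umin.
rewrite (Rintegral_gradE T0 uB (Lspace_Lfun u) wB g2 g0 p0) lerN2 TGV_objE//=.
have h1 := le_charge_Rintegral_normM (Dmeas_sub u w) T0 mp pa.
have h2 := le_charge_Rintegral_normM (Dmeas T w) T0 mP Pb.
rewrite -/p -/P => H.
(* The pairings add up to at least the sum of their upper bounds, so each bound is attained. *)
have e1 : charge_Rintegral (Dmeas_sub u w) I p = alpha * fine (normM T (Dmeas_sub u w)).
  apply/eqP; rewrite eq_le h1/= -(lerD2r (charge_Rintegral (Dmeas T w) I P)).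
  by apply: le_trans H; rewrite lerD2l.
have e2 : charge_Rintegral (Dmeas T w) I P = beta * fine (normM T (Dmeas T w)).
  apply/eqP; rewrite eq_le h2/= -(lerD2l (charge_Rintegral (Dmeas_sub u w) I p)).
  by apply: le_trans H; rewrite lerD2r.
have [s1 s2] := charge_extremal_supp T0 pc pa e1.
have [s3 s4] := charge_extremal_supp T0 Pc Pb e2.
by split.
Qed.

Lemma supports_minimizer (T0 : 0 < T) :
  convex_function (E := L2 T) [set: convex_lmodType (L2 T)] f ->
  \int[mu]_x g x = 0 -> \int[mu]_x p x = 0 ->
  (forall x, I x -> `|p x| <= alpha) -> (forall x, I x -> `|P x| <= beta) ->
  supp0T T (jpos (Dmeas_sub u w)) `<=` [set x | I x /\ p x = alpha] ->
  supp0T T (jneg (Dmeas_sub u w)) `<=` [set x | I x /\ p x = - alpha] ->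
  supp0T T (jpos (Dmeas T w)) `<=` [set x | I x /\ P x = beta] ->
  supp0T T (jneg (Dmeas T w)) `<=` [set x | I x /\ P x = - beta] ->
  is_minimizer f alpha beta u.
Proof.
move=> fc g0 p0 pa Pb s1 s2 s3 s4; split=> [|v vB]; first exact: uB.
(* The support conditions make both pairings extremal, which turns weak duality into equality at
   [u]. *)
have uE : fine (obj u w) = - \int[mu]_x (g x * u x).
  rewrite (Rintegral_gradE T0 uB (Lspace_Lfun u) wB g2 g0 p0) opprK TGV_objE//=.
  by rewrite (charge_supp_extremal T0 pc pa s1 s2) (charge_supp_extremal T0 Pc Pb s3 s4).
have vTGV : ((- \int[mu]_x (g x * v x))%:E <= TGV T alpha beta v)%E.
  apply: le_ereal_inf_tmp => _ [z zB <-]; rewrite (TGV_fineK _ _ T0) lee_fin.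
  exact: gradient_le_obj (Lspace_Lfun v) zB g0 p0 pa Pb.
rewrite /J uw (TGV_fineK _ _ T0) uE; apply: le_trans (leeD2l _ vTGV).
rewrite -!EFinD lee_fin -!fg.
have := convex_differential_le df v fc; rewrite linearB/=.
by rewrite lerBrDr -addrA [- _ + _]addrC.
Qed.

End minimizer.
End objective.
End supports.

Theorem theorem4 (R : realType) (T alpha beta : R)
    (hT : 0 < T) (halpha : 0 < alpha) (hbeta : 0 < beta)
    (f : L2 T -> R) (hf : forall u : L2 T, differentiable f u)
    (ubar : L2 T) (hubar : BV T ubar)
    (wbar : L1 T) (hwbar : BV T wbar)
    (hTGV : TGV T alpha beta ubar = TGV_obj alpha beta ubar wbar)
    (gradf : L2 T) (hgradf : is_gradient f ubar gradf) :
  let pbar : R -> R := primitive T gradf in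
  let Pbar : R -> R := fun x => - primitive T pbar x in
  let cond_i :=
    [/\ H10 T pbar, H2 T Pbar /\ H10 T Pbar,
        (normC T pbar <= alpha%:E)%E & (normC T Pbar <= beta%:E)%E] in
  let cond_ii :=
    [/\ supp0T T (jpos (Dmeas_sub ubar wbar)) `<=` [set x | I0T T x /\ pbar x = alpha],
        supp0T T (jneg (Dmeas_sub ubar wbar)) `<=` [set x | I0T T x /\ pbar x = - alpha],
        supp0T T (jpos (Dmeas T wbar)) `<=` [set x | I0T T x /\ Pbar x = beta]
      & supp0T T (jneg (Dmeas T wbar)) `<=` [set x | I0T T x /\ Pbar x = - beta]] in
  (is_minimizer f alpha beta ubar -> cond_i /\ cond_ii) /\
  (convex_function (E := L2 T) [set: convex_lmodType (L2 T)] f ->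
     cond_i -> cond_ii -> is_minimizer f alpha beta ubar).

Proof.
move=> pbar Pbar cond_i cond_ii; have g2 := Lspace_Lfun gradf.
have ig := Lfun2_integrable g2; have p2 := primitive_Lfun2 ig.
have a0 := ltW halpha; have b0 := ltW hbeta.
split=> [umin|fc [pH [_ PH] /normCP pa /normCP Pb] [s1 s2 s3 s4]].
  have [g0 p0 pa Pb] := minimizer_bounds a0 b0 (hf ubar) hgradf hubar hwbar hTGV hT umin.
  have [pH P2 PH] := primitive_regularity hT g2 g0 p0.
  split; first by split=> //; exact/normCP.
  by have [] := minimizer_supports a0 b0 (hf ubar) hgradf hubar hwbar hTGV hT umin.
have g0 := H10_primitive_mean0 hT g2 pH.
(* The function [Pbar] is the primitive of [- pbar], so the lemma used for [pbar] applies to it as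
   well. *)
have p0 : \int[leb0T T]_x pbar x = 0.
  have p2' := Lfun2Z (-1) p2; apply/eqP; rewrite -oppr_eq0 -mulN1r.
  rewrite -RintegralZl//; last exact: Lfun2_integrable.
  apply/eqP; apply: (H10_primitive_mean0 hT p2').
  rewrite (_ : primitive T _ = Pbar)//; apply/funext => x.
  rewrite /Pbar -primitiveN//; last exact: Lfun2_integrable.
  by congr primitive; apply/funext => y; rewrite mulN1r.
exact: supports_minimizer (hf ubar) hgradf hubar hwbar hTGV hT fc g0 p0 pa Pb s1 s2 s3 s4.
Qed.
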